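(* Let $\lambda>\theta>1$. For each $\varepsilon>0$ there is $\delta>0$ such that, for all $n$ large enough, taking $G=K_n$ and $\beta=\lambda/n$, \[ \mathbb{P}_\theta\big(|\mathcal{C}_1(\pi)|\geq \delta n\big)\geq 1-\varepsilon , \] where $\mathcal{C}_1(\pi)$ denotes a largest cycle of the random permutation $\pi=\pi(\omega)$ of $\{1,\dots,n\}$ and $|\mathcal{C}_1(\pi)|$ its number of elements.
   Context: Let $G=K_n=(V,E)$ be the complete graph on $V=\{1,\dots,n\}$ with edge set $E=\binom{V}{2}$, and let $\beta>0$. Under the probability measure $\mathbb{P}_1$, $\omega=(\omega_{xy}:xy\in E)$ is a collection of independent rate 1 Poisson processes on $[0,\beta]$ indexed by the edges. Write $(xy,t)\in\omega$ if $\omega_{xy}$ has an event at time $t$. Almost surely, the points of $\omega$ can be listed as $(x_iy_i,t_i)$, $i=1,\dots,N$, with $0<t_1<\dots<t_N<\beta$. Let $\tau_i=(x_i,y_i)$ be the transposition of $x_i$ and $y_i$, and set $\pi=\pi(\omega)=\tau_N\cdots\tau_2\tau_1$ (a permutation of $V$). Let $\ell=\ell(\omega)$ be the number of cycles in the disjoint-cycle decomposition of $\pi(\omega)$, including singletons, and let $\mathcal{C}_1(\pi),\dots,\mathcal{C}_\ell(\pi)$ be the cycles ordered by decreasing size (ties broken by any rule). For $\theta\geq 1$ the probability measure $\mathbb{P}_\theta$ is defined by \[ \frac{d\mathbb{P}_\theta}{d\mathbb{P}_1}(\omega)=\frac{\theta^{\ell(\omega)}}{Z}, \] where $Z=Z(\theta,\beta)$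 is the normalizing constant making $\mathbb{P}_\theta$ a probability measure. *)

(* Defs.v *)
From HB Require Import structures.
From mathcomp Require Import all_boot all_order all_algebra all_fingroup.
From mathcomp Require Import all_classical all_reals all_analysis.
From mathcomp Require Import measurable_realfun.

Set Implicit Arguments.
Unset Strict Implicit.
Unset Printing Implicit Defensive.

Import Order.TTheory GRing.Theory Num.Theory.
Import numFieldNormedType.Exports.

Local Open Scope classical_set_scope.
Local Open Scope ring_scope.

(* An unordered pair {x, y} of distinct vertices of K_n is encoded by its
   increasing ordering (x, y), so each edge occurs exactly once. *)
Definition edge (n : nat) := {p : 'I_n * 'I_n | (p.1 < p.2)%N}.

Definition transp (n : nat) (e : edge n) : {perm 'I_n} :=
  tperm (val e).1 (val e).2.

Section poisson.
Context (R : realType) (d : measure_display) (Omega : measurableType d).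
Variable P : probability Omega R.

Definition mutually_independent (I : finType) (F : I -> set (set Omega)) :=
  forall (J : {set I}) (A : I -> set Omega), (forall i, i \in J -> F i (A i)) ->
    P (\bigcap_(i in [set` J]) A i) = (\prod_(i in J) P (A i))%E.

(* A point process on the line, seen as a random set of points, is observed
   through its number of points (possibly +oo) in each Borel set. *)
Definition npoints (X : Omega -> set R) (B : set R) (o : Omega) : \bar R :=
  counting (X o `&` B).

Definition sigma_count (X : Omega -> set R) (B : set R) : set (set Omega) :=
  preimage_set_system setT (npoints X B) measurable.

Definition sigma_process (X : Omega -> set R) : set (set Omega) :=
  <<s \bigcup_(B in (measurable : set (set R))) sigma_count X B >>.

(* [poisson_prob r k] does not depend on [k]; unlike [poisson_pmf], it is
   the Dirac mass at 0 when r = 0, as needed for Lebesgue-null sets [B]. *)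
Record poisson_process (beta : R) (X : Omega -> set R) : Prop := PoissonProcess {
  poisson_process_sub : forall o, X o `<=` `[0, beta] ;
  poisson_process_measurable : forall B : set R, measurable B ->
    measurable_fun setT (npoints X B) ;
  poisson_process_law : forall B : set R, measurable B -> B `<=` `[0, beta] ->
    forall U : set nat,
      P (npoints X B @^-1` [set k%:R%:E | k in U]) =
      poisson_prob (fine (lebesgue_measure B)) 0 U ;
  poisson_process_indep : forall (k : nat) (B : 'I_k -> set R),
    (forall i, measurable (B i)) -> (forall i, B i `<=` `[0, beta]) ->
    trivIset setT B ->
    mutually_independent (fun i => sigma_count X (B i)) }.

Definition independent_poisson_processes (n : nat) (beta : R)
    (omega : edge n -> Omega -> set R) : Prop :=
  (forall e, poisson_process beta (omega e)) /\
  mutually_independent (fun e => sigma_process (omega e)).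

End poisson.

Section permutation.
Context (R : realType) (n : nat).

Definition time_listing (w : edge n -> set R) : set (seq (edge n * R)) :=
  [set s | sorted (fun p q => p.2 < q.2) s /\
           forall p : edge n * R, p \in s <-> w p.1 p.2].

(* A configuration has at most one time listing.  When it has none (infinitely
   many points or coinciding times, an event of probability 0), the permutation
   is set to 1.  The product of permutations applies its left factor first, so
   this is tau_N o ... o tau_1. *)
Definition pi_perm (w : edge n -> set R) : {perm 'I_n} :=
  (\prod_(p <- xget [::] (time_listing w)) transp p.1)%g.

Definition num_cycles (s : {perm 'I_n}) : nat := #|porbits s|.

Definition largest_cycle (s : {perm 'I_n}) : nat :=
  (\max_(C in porbits s) #|C|)%N.

End permutation.

Section weighted.
Context (R : realType) (d : measure_display) (Omega : measurableType d).
Context (P : probability Omega R) (n : nat) (omega : edge n -> Omega -> set R).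
Variable theta : R.

Definition weight (o : Omega) : R :=
  theta ^+ num_cycles (pi_perm (fun e => omega e o)).

Definition partition_fun : R := (\int[P]_o weight o)%R.

Definition P_theta (A : set Omega) : \bar R :=
  (\int[P]_(o in A) (weight o / partition_fun)%:E)%E.

End weighted.

(* Main.v *)
(** Colour each cycle of [pi] red with probability [1 / theta], independently: the
    weight [theta ^ l] is the sum over unions [S] of cycles of [(theta - 1) ^ k],
    where [k] is the number of cycles outside [S].  Given [S] and the steps that do
    not join two points of the current image of [S], the remaining steps perform
    an unweighted random transposition walk on [S].  If all cycles of [pi] were
    short, [S] would have about [n / theta] points, by Chebyshev; the walk on
    [S] would then be supercritical, as [lambda / theta > 1], and it would create
    a cycle of linear length whatever its initial permutation.

    The last fact is shown in two phases.  For any word of transpositions, the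
    number of steps plus the number of components of their graph is at most
    [n] plus twice the number of steps that split a cycle.  In the
    supercritical regime the left-hand side exceeds [n] linearly, whereas splits
    are rare as long as few points lie in cycles of length at least [K]; so a
    linear number of points get into such cycles.  Then, as in Schramm's
    argument, few further steps suffice to double the length
    [K, 2K, 4K, ...] up to a linear one, since merging is faster than
    fragmentation at every level.

    Cutting [[0, beta]] into many slots reduces the Poisson processes to words with
    independent letters.  No measurability of [pi] is needed: the integrals are
    compared with those of step functions over the events that fix the word. *)
Require Import Defs.
From HB Require Import structures.
From mathcomp Require Import all_boot all_order all_algebra all_fingroup.
From mathcomp Require Import all_classical all_reals all_analysis.
From mathcomp Require Import measurable_realfun.
From mathcomp Require Import ring lra zify.

Set Implicit Arguments.
Unset Strict Implicit.
Unset Printing Implicit Defensive.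

Import Order.TTheory GRing.Theory Num.Theory.
Import numFieldNormedType.Exports.

Local Open Scope ring_scope.

(** * Sums over words *)

(** The weight [theta ^ l] destroys the independence of the steps, and the red walk recovers it only
    once everything outside [S] is fixed. Its starting permutation is then uncontrolled, so every
    estimate on unweighted walks has to be uniform in the initial permutation. Hence cycles are
    related to components of the graph by an inequality valid for every word and every start. The
    number of steps plus components minus points is the number of independent circuits of the
    multigraph. Its linear growth is proved without the survival probability of a branching process:
    a number [g] below its image under the generating function bounds the mean number of components
    from below, and a suitable [g] exists as soon as the mean degree exceeds 1. Expectations are
    finite sums with weights that need not be normalized, so exposing letters or restricting to [S]
    only changes the weights. The number of slots grows with [n] fixed; error terms that vanish in
    this limit may therefore be exponential in [n]. *)

Section WordSum.
Context {R : realFieldType} {X : finType}.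
Implicit Types (u v : X -> R) (F : nat) (f g : seq X -> R).

(* An unnormalized expectation over words of [F] independent letters: the
   weights [u] need not sum to 1. *)
Fixpoint wsum u F f : R :=
  if F is F'.+1 then \sum_x u x * wsum u F' (fun w => f (x :: w)) else f [::].

Lemma eq_wsum u F f g : f =1 g -> wsum u F f = wsum u F g.
Proof.
elim: F f g => [|F IH] f g fg /=; first exact: fg.
by apply: eq_bigr => x _; congr (_ * _); apply: IH => w; apply: fg.
Qed.

Lemma eq_wsum_weight u v F f : u =1 v -> wsum u F f = wsum v F f.
Proof.
move=> uv; elim: F f => [//|F IH] f /=.
by apply: eq_bigr => x _; rewrite uv IH.
Qed.

Lemma wsumD u F f g : wsum u F (fun w => f w + g w) = wsum u F f + wsum u F g.
Proof.
elim: F f g => [//|F IH] f g /=.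
by rewrite -big_split; apply: eq_bigr => x _; rewrite IH mulrDr.
Qed.

Lemma wsumZ u F (c : R) f : wsum u F (fun w => c * f w) = c * wsum u F f.
Proof.
elim: F f => [//|F IH] f /=.
by rewrite mulr_sumr; apply: eq_bigr => x _; rewrite IH mulrCA.
Qed.


Lemma wsum_sum u F (I : Type) (r : seq I) (P : pred I) (h : I -> seq X -> R) :
  wsum u F (fun w => \sum_(i <- r | P i) h i w) =
  \sum_(i <- r | P i) wsum u F (h i).
Proof.
elim: F h => [//|F IH] h /=.
rewrite exchange_big /=; apply: eq_bigr => x _.
by rewrite IH mulr_sumr.
Qed.

Lemma wsum_cst u F (c : R) : wsum u F (fun=> c) = (\sum_x u x) ^+ F * c.
Proof.
elim: F => [|F IH] /=; first by rewrite mul1r.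
by rewrite exprS -mulrA mulr_suml; apply: eq_bigr => x _; rewrite IH.
Qed.

Lemma ler_in_wsum u F f g : (forall x, 0 <= u x) ->
  (forall w, all (fun x => u x != 0) w -> size w = F -> f w <= g w) ->
  wsum u F f <= wsum u F g.
Proof.
move=> u0; elim: F f g => [|F IH] f g fg /=; first exact: fg.
apply: ler_sum => x _; have [->|ux] := eqVneq (u x) 0; first by rewrite !mul0r.
apply: ler_wpM2l => //; apply: IH => w uw szw; apply: fg => /=.
  by rewrite ux.
by rewrite szw.
Qed.

Lemma ler_wsum u F f g : (forall x, 0 <= u x) -> (forall w, f w <= g w) ->
  wsum u F f <= wsum u F g.
Proof. by move=> u0 fg; apply: ler_in_wsum. Qed.

Lemma wsum_ge0 u F f : (forall x, 0 <= u x) -> (forall w, 0 <= f w) ->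
  0 <= wsum u F f.
Proof.
move=> u0 f0; rewrite -[leLHS](mulr0 ((\sum_x u x) ^+ F)) -wsum_cst.
exact: ler_wsum.
Qed.

Lemma wsum_cat u F F' f :
  wsum u (F + F') f = wsum u F (fun w => wsum u F' (fun w' => f (w ++ w'))).
Proof.
elim: F f => [//|F IH] f /=.
by apply: eq_bigr => x _; rewrite IH.
Qed.

(** The binomial formula with the letters of [star] exposed first: each of them contributes a factor
    [G] to the bound, each other letter a factor [y]. In the induction a letter outside [star] is
    absorbed into [g] and turns [b] into [b * y]; a letter of [star] turns [b] into [b * G]. *)
Lemma wsum_split_ge (star : pred X) u (g : seq X -> seq X -> R) (b y G : R) F :
  (forall x, 0 <= u x) ->
  (forall F' w', (F' <= F)%N -> b * y ^+ F' * G ^+ size w' <=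
     wsum (fun x => if star x then 0 else u x) F' (g ^~ w')) ->
  b * (y + G * \sum_(x | star x) u x) ^+ F <=
  wsum u F (fun w => g [seq x <- w | ~~ star x] [seq x <- w | star x]).
Proof.
move=> u0; elim: F b g => [|F IH] b g gge.
  by have := gge 0 [::] isT; rewrite !mulr1 /= => ->.
rewrite /= [leRHS](bigID star) /= exprS mulrDl mulrDr [leRHS]addrC; apply: lerD.
  rewrite mulrA [leRHS](_ : _ = wsum u F (fun w =>
      \sum_(x | ~~ star x) u x * g (x :: [seq z <- w | ~~ star z]) [seq z <- w | star z])).
    apply: (IH _ (fun w' w'' => \sum_(x | ~~ star x) u x * g (x :: w') w'')).
    move=> F' w' leF; rewrite wsum_sum [leLHS](_ : _ = b * y ^+ F'.+1 * G ^+ size w'); last first.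
      by rewrite exprS !mulrA.
    apply: le_trans (gge F'.+1 w' leF) _; rewrite /= (bigID star) /= big1 ?add0r.
      by apply: ler_sum => x /negbTE sx; rewrite sx wsumZ.
    by move=> x ->; rewrite mul0r.
  rewrite wsum_sum; apply: eq_bigr => x /negbTE sx; rewrite wsumZ; congr (_ * _).
  by apply: eq_wsum => w; rewrite /= sx.
set S := \sum_(x | star x) u x; set Y := y + _.
rewrite [leLHS](_ : _ = S * (b * G * Y ^+ F)); last by ring.
rewrite mulr_suml; apply: ler_sum => x sx.
apply: ler_wpM2l => //; under eq_wsum do rewrite sx.
apply: (IH _ (fun w' w'' => g w' (x :: w''))) => F' w' leF.
apply: le_trans (gge F' (x :: w') (leqW leF)); rewrite /= exprS.
by rewrite [leRHS](_ : _ = b * G * y ^+ F' * G ^+ size w'); [|ring].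
Qed.

(* Efron-Stein, comparing each letter with the neutral letter [o]. *)
Lemma wsum_variance u (o : X) F f : (forall x, 0 <= u x) -> \sum_x u x = 1 ->
  (forall w w' x, `|f (w ++ x :: w') - f (w ++ o :: w')| <= (x != o)%:R) ->
  wsum u F (fun w => f w ^+ 2) - (wsum u F f) ^+ 2 <=
  F%:R * \sum_(x | x != o) u x.
Proof.
move=> u0 u1; elim: F f => [|F IH] f lip; first by rewrite /= subrr mul0r.
set q := \sum_(x | x != o) u x.
(* Averaging over the first letter keeps the Lipschitz property; the conditional variance is at most
   the second moment about the value at [o], hence at most [q]. *)
pose h w := \sum_x u x * f (x :: w).
have hE : wsum u F.+1 f = wsum u F h.
  by rewrite wsum_sum /=; apply: eq_bigr => x _; rewrite wsumZ.
have -> : wsum u F.+1 (fun w => f w ^+ 2) =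
    wsum u F (fun w => \sum_x u x * f (x :: w) ^+ 2).
  by rewrite wsum_sum /=; apply: eq_bigr => x _; rewrite wsumZ.
have var1 w : \sum_x u x * f (x :: w) ^+ 2 <= q + h w ^+ 2.
  rewrite -lerBlDr; set c := f (o :: w).
  apply: le_trans (_ : \sum_x u x * (f (x :: w) - c) ^+ 2 <= _).
    have -> : \sum_x u x * (f (x :: w) - c) ^+ 2 =
      \sum_x u x * f (x :: w) ^+ 2 - c *+ 2 * h w + c ^+ 2.
      rewrite -[c ^+ 2]mul1r -u1 mulr_suml /h mulr_sumr -sumrB -big_split /=.
      by apply: eq_bigr => x _; ring.
    have := sqr_ge0 (h w - c); rewrite sqrrB; lra.
  rewrite (bigD1 o) //= subrr expr0n mulr0 add0r /q; apply: ler_sum => x xo.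
  rewrite ler_piMr // -[leLHS]ger0_norm ?sqr_ge0 // normrX expr_le1 //.
  by have := lip [::] w x; rewrite xo.
have lip_h w w' x : `|h (w ++ x :: w') - h (w ++ o :: w')| <= (x != o)%:R.
  rewrite -sumrB; apply: le_trans (ler_norm_sum _ _ _) _.
  rewrite -[leRHS]mul1r -[X in X * _]u1 mulr_suml; apply: ler_sum => z _.
  rewrite -mulrBr normrM (ger0_norm (u0 z)); apply: ler_wpM2l => //.
  exact: (lip (z :: w)).
rewrite hE mulrS mulrDl mul1r.
have := ler_wsum F u0 var1; rewrite wsumD wsum_cst u1 expr1n mul1r.
have := IH h lip_h; rewrite -/q; lra.
Qed.

Lemma wsum_chebyshev u F f (t : R) : (forall x, 0 <= u x) -> \sum_x u x = 1 -> 0 < t ->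
  wsum u F (fun w => (f w <= wsum u F f - t)%R%:R) <=
  (wsum u F (fun w => f w ^+ 2) - (wsum u F f) ^+ 2) / t ^+ 2.
Proof.
move=> u0 u1 t0; set m := wsum u F f; rewrite ler_pdivlMr ?exprn_gt0 //.
have -> : wsum u F (fun w => f w ^+ 2) - m ^+ 2 = wsum u F (fun w => (f w - m) ^+ 2).
  rewrite -(_ : wsum u F (fun w => f w ^+ 2 + ((- (m *+ 2)) * f w + m ^+ 2)) = wsum u F (fun w => (f w - m) ^+ 2)).
    by rewrite !wsumD wsumZ wsum_cst u1 expr1n -/m; ring.
  by apply: eq_wsum => w; ring.
rewrite mulrC -wsumZ; apply: ler_wsum => // w.
have [le_w|_] := leP (f w) (m - t); last by rewrite mulr0 sqr_ge0.
rewrite mulr1 -(sqrrN (f w - m)) ler_sqr ?nnegrE; lra.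
Qed.

Lemma wsum_markov u F f (t : R) : (forall x, 0 <= u x) -> 0 < t ->
  (forall w, 0 <= f w) ->
  wsum u F (fun w => (t <= f w)%R%:R) <= wsum u F f / t.
Proof.
move=> u0 t0 f0; rewrite ler_pdivlMr // mulrC -wsumZ; apply: ler_wsum => // w.
by have [le_w|_] := leP t (f w); rewrite ?mulr1 ?mulr0.
Qed.

End WordSum.

(** * Components of the random graph *)

Section Exploration.
Context {T : finType}.
Implicit Types (w : seq (option (T * T))) (A B D W : {set T}).

Definition linked w : rel T :=
  [rel a b | (Some (a, b) \in w) || (Some (b, a) \in w)].

Definition reachable w A : {set T} :=
  [set b | [exists a in A, connect (linked w) a b]].


Lemma reachable_min w A D : A \subset D ->
  (forall a b, linked w a b -> a \in D -> b \in D) -> reachable w A \subset D.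
Proof.
move=> /fintype.subsetP AD closedD; apply/fintype.subsetP => b.
rewrite inE => /existsP[a /andP[/AD aD /connectP[c pc ->]]].
elim: c a aD pc => [//|c1 c IH] a aD /= /andP[ac1 pc].
by apply: IH pc; apply: closedD ac1 aD.
Qed.

Context {R : realFieldType}.
Implicit Types (q p s G x : R).

(** Steps are ordered pairs, diagonal ones included, so that the total weight is exactly
    [q + p * #|W|%:R ^+ 2]. Restricting the walk to a subset amounts to changing [W]. *)
Definition step_weight q p W (o : option (T * T)) : R :=
  if o is Some (a, b) then p *+ ((a \in W) && (b \in W)) else q.

Lemma step_weight_ge0 q p W o : 0 <= q -> 0 <= p -> 0 <= step_weight q p W o.
Proof. by move=> q0 p0; case: o => [[a b]|] //=; rewrite mulrn_wge0. Qed.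

Lemma big_option (I : finType) (f : option I -> R) :
  \sum_o f o = f None + \sum_i f (Some i).
Proof.
rewrite (bigD1 None) //=; congr (_ + _).
rewrite (reindex_omap Some id) /=; last by case.
by apply: eq_bigl => i; rewrite eqxx.
Qed.


Lemma sum_step_weight q p W : \sum_o step_weight q p W o = q + p * #|W|%:R ^+ 2.
Proof.
rewrite big_option; congr (_ + _).
rewrite (eq_bigr (fun ab : T * T => p * ((ab.1 \in W) && (ab.2 \in W))%:R)); last first.
  by move=> [a b] _ /=; rewrite mulr_natr.
rewrite -mulr_sumr; congr (_ * _); rewrite -natr_sum -natrX -mulnn -cardsX -sum1_card.
congr (_%:R); rewrite [RHS]big_mkcond /=.
by apply: eq_bigr => -[a b] _; rewrite finset.in_setX; case: ifP.
Qed.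

(* Exploration of the clusters of [A] in the random graph: the steps at one
   point [v] of [A] are exposed first, and each of them adds at most one point
   to [A].  [G] is a sub-fixed point of the generating function of the
   approximating branching process. *)
Lemma explore_ge q p s G x N : 0 <= q -> 0 <= p -> 0 <= G -> G <= s -> s <= 1 ->
  0 <= x <= 1 -> p * (2 * #|T|%:R) * (1 - G) <= x * q ->
  G <= s * (1 - x) ^+ N ->
  forall W A F, (F <= N)%N ->
  G ^+ #|A| * (q + p * #|W|%:R ^+ 2) ^+ F <=
  wsum (step_weight q p W) F (fun w => s ^+ #|reachable w A|).
Proof.
move=> q0 p0 G0 Gs s1 /andP[x0 x1] px Gsx W.
have s0 : 0 <= s by apply: le_trans Gs.
have G1 : G <= 1 by apply: le_trans Gs s1.
have [n] := ubnP #|W|; elim: n W => // n IH W; rewrite ltnS => leWn A F leFN.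
have u0 o : 0 <= step_weight q p W o by exact: step_weight_ge0.
(* If [A] misses [W], no step of nonzero weight meets [A] and nothing new is reached. *)
have [/setP AW0|[v /setIP[vA vW]]] := set_0Vmem (A :&: W).
  rewrite mulrC -sum_step_weight -wsum_cst; apply: ler_in_wsum => // w uw _.
  apply: le_trans (_ : s ^+ #|A| <= _); first by rewrite lerXn2r ?nnegrE.
  rewrite ler_wiXn2l //; apply/subset_leq_card/reachable_min => // a b ab aA.
  suff aW : a \in W by have := AW0 a; rewrite !inE aA aW.
  by case/orP: ab => /(allP uw) /=; case: (a \in W) => //; rewrite ?andbF mulr0n eqxx.
pose star (o : option (T * T)) := if o is Some (a, b) then (a == v) || (b == v) else false.
pose other (o : option (T * T)) := if o is Some (a, b) then if a == v then b else a else v.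
(* Once the steps at [v] are exposed, [v] is removed and its neighbours join [A]; the outer factor
   [s] in [g] accounts for [v] itself. *)
pose new w' := (A :|: [set y in [seq other o | o <- w']]) :\ v.
pose g (w w' : seq (option (T * T))) : R := s * s ^+ #|reachable w (new w')|.
apply: le_trans (_ : wsum (step_weight q p W) F
  (fun w => g [seq o <- w | ~~ star o] [seq o <- w | star o]) <= _); last first.
  apply: ler_wsum => // w; rewrite /g -exprS ler_wiXn2l //.
  set w1 := [seq o <- w | ~~ star o]; set w2 := [seq o <- w | star o].
  set D := reachable w1 _.
  apply: leq_trans (_ : (#|v |: D| <= _)%N); last by rewrite cardsU1; case: (v \notin D).
  apply/subset_leq_card/reachable_min.
    apply/fintype.subsetP => a aA; rewrite !inE; have [//|av] := eqVneq a v.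
    by apply/existsP; exists a; rewrite !inE av aA /=.
  move=> a b ab; rewrite !inE => aD.
  have [//|bv /=] := eqVneq b v.
  have [av|av] := eqVneq a v.
    apply/existsP; exists b; rewrite connect0 andbT !inE bv /= orbC.
    apply/orP; left; apply/mapP; subst a.
    case/orP: ab => abw; [exists (Some (v, b))|exists (Some (b, v))];
      by rewrite ?/w2 ?mem_filter /= ?eqxx ?orbT ?(negbTE bv).
  move: aD; rewrite (negbTE av) /= => /existsP[c /andP[cD cona]].
  apply/existsP; exists c; rewrite cD; apply: connect_trans cona (connect1 _).
  by rewrite /linked /= /w1 !mem_filter /= (negbTE av) (negbTE bv).
have cW : (#|W| = #|W :\ v|.+1)%N by rewrite (cardsD1 v W) vW.
have cA : (#|A| = #|A :\ v|.+1)%N by rewrite (cardsD1 v A) vA.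
set m := #|W :\ v| in cW; set k := #|A :\ v| in cA.
have starE : \sum_(o | star o) step_weight q p W o = p * (2 * m%:R + 1).
  have := sum_step_weight q p W; rewrite (bigID star) /=.
  have -> : \sum_(o | ~~ star o) step_weight q p W o = q + p * m%:R ^+ 2.
    rewrite -sum_step_weight big_mkcond; apply: eq_bigr => -[[a b]|] //= _.
    by rewrite !inE negb_or; case: eqP => //=; case: eqP => //=; rewrite andbF.
  move/(canRL (addrK _)) ->; rewrite cW -natr1; ring.
apply: le_trans (wsum_split_ge (b := s * G ^+ k) (y := q + p * m%:R ^+ 2) (G := G) u0 _);
  last first.
  move=> F' w' leF'; rewrite (eq_wsum_weight (v := step_weight q p (W :\ v))); last first.
    case=> [[a b]|] //=; rewrite !inE.
    by case: eqP => //=; case: eqP => //=; rewrite ?andbF ?mulr0n.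
  rewrite /g wsumZ -!mulrA; apply: ler_wpM2l => //.
  apply: le_trans (IH (W :\ v) _ (new w') F' _).
  - rewrite mulrCA mulrC; apply: ler_wpM2r; last first.
      rewrite -exprD ler_wiXn2l // /new finset.setDUl.
      apply: leq_trans (leq_card_setU _ _) _; rewrite leq_add2l.
      apply: leq_trans (subset_leq_card (subsetDl _ _)) _.
      by rewrite cardsE; apply: leq_trans (card_size _) _; rewrite size_map.
    by rewrite exprn_ge0 // addr_ge0 // mulr_ge0 ?sqr_ge0.
  - by rewrite -cW in leWn *.
  - exact: leq_trans leF' leFN.
rewrite starE cA exprS; set Y0 := q + p * #|W|%:R ^+ 2.
have Y00 : 0 <= Y0 by rewrite addr_ge0 // mulr_ge0 ?sqr_ge0.
(* Removing [v] from [W] takes [p * (2 * m + 1)] off the weight of a letter and the star steps give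
   back [G] times as much: a relative loss of at most [x] per letter. The hypothesis
   [G <= s * (1 - x) ^+ N] makes up for it over at most [N] letters. *)
have Y1 : (1 - x) * Y0 <= q + p * m%:R ^+ 2 + G * (p * (2 * m%:R + 1)).
  have mT : m%:R + 1 <= #|T|%:R :> R by rewrite natr1 ler_nat -cW max_card.
  have : p * (2 * m%:R + 1) * (1 - G) <= x * Y0.
    apply: le_trans (_ : x * q <= _); last first.
      by rewrite ler_wpM2l // lerDl mulr_ge0 // sqr_ge0.
    apply: le_trans px; rewrite ler_wpM2r ?subr_ge0 // ler_wpM2l //; lra.
  rewrite /Y0 cW -natr1; lra.
rewrite [leLHS](_ : _ = G ^+ k * (G * Y0 ^+ F)); last by ring.
rewrite [leRHS](_ : _ = G ^+ k * (s * (q + p * m%:R ^+ 2 + G * (p * (2 * m%:R + 1))) ^+ F)); last by ring.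
apply: ler_wpM2l; first exact: exprn_ge0.
apply: le_trans (_ : s * (1 - x) ^+ F * Y0 ^+ F <= _).
  apply: ler_wpM2r; first exact: exprn_ge0.
  apply: le_trans Gsx _; apply: ler_wpM2l => //; rewrite ler_wiXn2l //; lra.
rewrite -mulrA -exprMn ler_wpM2l // lerXn2r ?nnegrE //.
  rewrite mulr_ge0 //; lra.
by apply: le_trans Y1; rewrite mulr_ge0 //; lra.
Qed.

End Exploration.

(** * Counting classes through unions of classes *)

Section Saturated.
Context {T U : finType} (c : T -> U).

Definition saturated (A : {set T}) :=
  [forall x, forall y, (c x == c y) ==> ((x \in A) == (y \in A))].

Lemma saturatedP (A : {set T}) :
  reflect (forall x y, c x = c y -> (x \in A) = (y \in A)) (saturated A).
Proof.
apply: (iffP forallP) => [satA x y cxy|satA x].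
  by have /forallP/(_ y) := satA x; rewrite cxy eqxx => /eqP.
by apply/forallP => y; apply/implyP => /eqP/satA ->.
Qed.

Lemma saturated_preim (B : {set U}) : saturated (c @^-1: B).
Proof. by apply/saturatedP => x y; rewrite !inE => ->. Qed.

Lemma preim_imset_saturated (A : {set T}) : saturated A -> c @^-1: (c @: A) = A.
Proof.
move=> /saturatedP satA; apply/setP => x; rewrite inE.
apply/imsetP/idP => [[y yA /satA ->//]|xA]; by exists x.
Qed.

Lemma preim_inj : {in powerset (c @: [set: T]) &, injective (fun B : {set U} => c @^-1: B)}.
Proof.
move=> B B'; rewrite !inE => /fintype.subsetP sB /fintype.subsetP sB' eqB.
apply/setP => y; apply/idP/idP => yB.
  have /imsetP[x _ yE] := sB _ yB.
  by have := congr1 (fun C : {set T} => x \in C) eqB; rewrite !inE -yE yB.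
have /imsetP[x _ yE] := sB' _ yB.
by have := congr1 (fun C : {set T} => x \in C) eqB; rewrite !inE -yE yB.
Qed.

Lemma saturated_imset :
  [set A | saturated A] = (fun B : {set U} => c @^-1: B) @: powerset (c @: [set: T]).
Proof.
apply/setP => A; rewrite inE; apply/idP/imsetP => [satA|[B _ ->]].
  exists (c @: A); last by rewrite preim_imset_saturated.
  by rewrite inE imsetS // finset.subsetT.
exact: saturated_preim.
Qed.

Lemma card_saturated : #|[set A | saturated A]| = (2 ^ #|c @: [set: T]|)%N.
Proof. by rewrite saturated_imset (card_in_imset preim_inj) card_powerset. Qed.

Lemma card_classes (R : numFieldType) :
  \sum_x (#|[set y | c y == c x]|%:R)^-1 = #|c @: [set: T]|%:R :> R.
Proof.
rewrite (partition_big_imset c) /= -sum1_card natr_sum.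
rewrite (eq_bigl (mem (c @: [set: T]))); last first.
  by move=> y; apply/imsetP/imsetP => -[x _ ->]; exists x.
apply: eq_bigr => y /imsetP[x0 _ ->].
rewrite (eq_bigr (fun=> (#|[set y | c y == c x0]|%:R)^-1)) => [|x /eqP ->//].
rewrite (eq_bigl (mem [set y | c y == c x0])); last by move=> x; rewrite /= inE.
rewrite sumr_const -[LHS]mulr_natl mulfV // pnatr_eq0 -lt0n card_gt0.
by apply/set0Pn; exists x0; rewrite inE.
Qed.

End Saturated.

Section SymmetricDifference.
Context {T : finType}.
Implicit Types (A B C : {set T}) (H K : {set {set T}}).

Definition symdiff A B : {set T} := [set x | (x \in A) (+) (x \in B)].

Lemma symdiffK A B : symdiff (symdiff A B) B = A.
Proof. by apply/setP => x; rewrite !inE addbK. Qed.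

Lemma symdiffC A B : symdiff A B = symdiff B A.
Proof. by apply/setP => x; rewrite !inE addbC. Qed.

Lemma symdiff_inj B : injective (symdiff^~ B).
Proof. by apply: can_inj (symdiff ^~ B) _ => A; rewrite symdiffK. Qed.

Definition symdiff_closed H := forall A B, A \in H -> B \in H -> symdiff A B \in H.

(* For subspaces of (Z/2)^T this is dim H + dim K <= dim (H inter K) + |T|. *)
Lemma card_symdiff_closed H K : symdiff_closed H -> symdiff_closed K ->
  (#|H| * #|K| <= #|H :&: K| * 2 ^ #|T|)%N.
Proof.
move=> cH cK; rewrite -cardsX -[X in (X <= _)%N]sum1_card.
rewrite (partition_big (fun AB => symdiff AB.1 AB.2) xpredT) //=.
apply: leq_trans (_ : (\sum_(C : {set T}) #|H :&: K| <= _)%N); last first.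
  by rewrite sum_nat_const mulnC -cardsT -powersetT card_powerset cardsT.
apply: leq_sum => C _; rewrite sum1_card.
set S := fun AB => _.
have [[A0 B0] /andP[]|S0] := pickP S; last by rewrite (eq_card0 S0).
rewrite finset.in_setX /= => /andP[A0H B0K] /eqP CE.
have SE A B : (A, B) \in S -> [/\ A \in H, B \in K & C = symdiff A B].
  by rewrite /S unfold_in finset.in_setX /= => /andP[/andP[-> ->] /eqP ->].
(* Each fibre injects into [H :&: K] by subtracting its member [(A0, B0)]: as both pairs have
   difference [C], the differences of first and of second components agree. *)
rewrite -(card_in_imset (f := fun AB => symdiff AB.1 A0) (D := S)); last first.
  move=> [A B] [A' B'] /SE[_ _ CAB] /SE[_ _ CAB'] /= /symdiff_inj eqA.
  by rewrite -eqA in CAB' *; have := CAB; rewrite CAB' !(symdiffC A) => /symdiff_inj ->.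
apply/subset_leq_card/fintype.subsetP => _ /imsetP[[A B] /SE[AH BK CAB] ->].
rewrite inE /= cH //=; suff -> : symdiff A A0 = symdiff B B0 by exact: cK.
apply/setP => x; have := congr1 (fun D : {set T} => x \in D) CAB.
by rewrite -CE !inE; do 4 case: (x \in _).
Qed.

End SymmetricDifference.

Section Components.
Context {T : finType}.
Implicit Types (w : seq (option (T * T))) (o : option (T * T)) (A B : {set T}).

Definition component w (v : T) : {set T} := reachable w [set v].

Lemma linked_sym w : symmetric (linked w).
Proof. by move=> a b; rewrite /linked /= orbC. Qed.

Lemma mem_component w u v : (u \in component w v) = connect (linked w) v u.
Proof.
rewrite inE; apply/existsP/idP => [[a /andP[/set1P -> //]]|vu].
by exists v; rewrite set11.
Qed.

Lemma component_eq w u v : (component w u == component w v) = (u \in component w v).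
Proof.
have symw : connect_sym (linked w) by apply/sym_connect_sym/linked_sym.
rewrite mem_component; apply/eqP/idP => [euv|vu].
  by rewrite -mem_component -euv mem_component.
by apply/setP => x; rewrite !mem_component -(same_connect symw vu).
Qed.

Definition ncomp w := #|component w @: [set: T]|.

Lemma ncompE (R : numFieldType) w :
  (ncomp w)%:R = \sum_v (#|component w v|%:R)^-1 :> R.
Proof.
rewrite -(card_classes (component w)); apply: eq_bigr => v _.
congr (_%:R^-1); apply: eq_card => u; rewrite inE component_eq.
by [].
Qed.

(* Points of (Z/2)^T that are constant on components: counting them turns
   statements about numbers of components into dimension counts. *)
Definition uncut A o := if o is Some (a, b) then (a \in A) == (b \in A) else true.

Definition invariants w : {set {set T}} := [set A | all (uncut A) w].

Lemma uncut_linked w A a b : all (uncut A) w -> linked w a b ->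
  (a \in A) = (b \in A).
Proof. by move=> /allP aw /orP[] /aw /eqP. Qed.

Lemma invariantsE w : invariants w = [set A | saturated (component w) A].
Proof.
apply/setP => A; rewrite !inE; apply/idP/saturatedP => [Aw x y /eqP|satA].
  rewrite component_eq mem_component => /connectP[p pp ->].
  by elim: p y pp => [//|z p IH] y /= /andP[/(uncut_linked Aw) -> /IH].
apply/allP => -[[a b]|] //= ow; apply/eqP/satA/eqP; rewrite component_eq mem_component.
by apply: connect1; rewrite /linked /= ow orbT.
Qed.

Lemma card_invariants w : #|invariants w| = (2 ^ ncomp w)%N.
Proof. by rewrite invariantsE card_saturated. Qed.

Lemma uncut_symdiff A B o : uncut A o -> uncut B o -> uncut (symdiff A B) o.
Proof. by case: o => [[a b]|] //= /eqP Aab /eqP Bab; rewrite !inE Aab Bab. Qed.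

Lemma invariants_closed w : symdiff_closed (invariants w).
Proof.
move=> A B; rewrite !inE => /allP Aw /allP Bw.
by apply/allP => o ow; rewrite uncut_symdiff ?Aw ?Bw.
Qed.

Lemma ncomp_cat_cons w o w' : ncomp (w ++ o :: w') = ncomp (o :: w ++ w').
Proof.
apply: (@expnI 2) => //; rewrite -!card_invariants.
by apply: eq_card => A; rewrite !inE !all_cat /= !all_cat andbCA.
Qed.

Lemma ncomp_None w : ncomp (None :: w) = ncomp w.
Proof.
by apply: (@expnI 2) => //; rewrite -!card_invariants.
Qed.

Lemma ncomp_cons_le w o : (ncomp (o :: w) <= ncomp w)%N.
Proof.
rewrite -(@leq_exp2l 2) // -!card_invariants; apply/subset_leq_card/fintype.subsetP => A.
by rewrite !inE /= => /andP[].
Qed.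

(** A step imposes one linear equation over Z/2 on the invariant sets, so it at most halves their
    number: two sets that violate it differ by one that satisfies it. *)
Lemma ncomp_cons_ge w o : (ncomp w <= (ncomp (o :: w)).+1)%N.
Proof.
rewrite -(@leq_exp2l 2) // expnS -!card_invariants mul2n -addnn.
rewrite -(cardsID (invariants (o :: w)) (invariants w)); apply: leq_add.
  by apply: subset_leq_card; apply: finset.subsetIr.
have [->|[A0]] := set_0Vmem (invariants w :\: invariants (o :: w)).
  by rewrite cards0.
rewrite finset.in_setD => /andP[]; rewrite !inE /= => + A0w; rewrite A0w andbT => A0o.
rewrite -(card_imset _ (symdiff_inj (B := A0))).
apply/subset_leq_card/fintype.subsetP => _ /imsetP[A + ->].
rewrite finset.in_setD => /andP[]; rewrite !inE /= => + Aw; rewrite Aw andbT => Ao.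
have := invariants_closed (w := w) (A := A) (B := A0); rewrite !inE Aw A0w => -> //.
rewrite andbT; move: A0o Ao; case: (o) => [[a b]|] //=; rewrite !inE.
by do 4 case: (_ \in _).
Qed.

End Components.

(** * Random transpositions and cycle lengths *)

Section PermSteps.
Context {T : finType}.
Implicit Types (s : {perm T}) (o : option (T * T)) (w : seq (option (T * T))).
Local Open Scope nat_scope.

Definition act o : {perm T} := if o is Some (a, b) then tperm a b else 1%g.

Definition run w s : {perm T} := foldl (fun s o => act o * s)%g s w.

Lemma porbit_min s x (D : {set T}) : x \in D -> (forall z, z \in D -> s z \in D) ->
  porbit s x \subset D.
Proof.
move=> xD sD; apply/fintype.subsetP => _ /porbitP[i ->].
by elim: i => [|i IH]; rewrite ?perm1 // expgSr permM; apply: sD.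
Qed.

Lemma mem_porbit_step s x z : z \in porbit s x -> s z \in porbit s x.
Proof. by case/porbitP => i ->; rewrite -permM -expgSr mem_porbit. Qed.

Lemma tperm_mulE s a b z : (tperm a b * s)%g z =
  if z == a then s b else if z == b then s a else s z.
Proof. by rewrite permM; case: tpermP => [->|->|/eqP/negbTE -> /eqP/negbTE ->]; rewrite ?eqxx //; case: eqP => // ->. Qed.

(** The formula [porbits_mul_tperm] for the change in the number of cycles, applied to both [s] and
    [tperm a b * s], excludes the other case. *)
Lemma porbit_tperm_merge s a b : b \notin porbit s a ->
  b \in porbit (tperm a b * s) a.
Proof.
move=> bNa; have ab : a != b by apply: contraNneq bNa => <-; exact: porbit_id.
have := porbits_mul_tperm s a b; have := porbits_mul_tperm (tperm a b * s) a b.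
have aNb : a \notin porbit s b by rewrite porbit_sym.
rewrite /= !mulgA tperm2 mul1g ab aNb [b \in _]porbit_sym.
by case: (a \in _) => //=; lia.
Qed.

Lemma porbit_tperm_split s a b : a != b -> b \in porbit s a ->
  b \notin porbit (tperm a b * s) a.
Proof.
move=> ab ba.
have := porbits_mul_tperm s a b; have := porbits_mul_tperm (tperm a b * s) a b.
rewrite /= !mulgA tperm2 mul1g ab [a \in porbit s b]porbit_sym ba [b \in _]porbit_sym.
by case: (a \in _) => //=; lia.
Qed.

(** The two permutations differ only by exchanging the images of [a] and [b], so a set stable under
    the new one and containing both points or neither is stable under [s]. *)
Lemma sub_porbit_tperm s a b v :
  (a \in porbit (tperm a b * s) v) = (b \in porbit (tperm a b * s) v) ->
  porbit s v \subset porbit (tperm a b * s) v.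
Proof.
set s' := (tperm a b * s)%g => ab; apply: porbit_min (porbit_id _ _) _ => z zv.
have := tperm_mulE s a b; rewrite -/s' => s'E.
have [za|za] := eqVneq z a.
  suff -> : s z = s' b by rewrite mem_porbit_step // -ab -za.
  by rewrite s'E eqxx za; case: eqP => // ->.
have [zb|zb] := eqVneq z b.
  suff -> : s z = s' a by rewrite mem_porbit_step // ab -zb.
  by rewrite s'E eqxx zb.
suff -> : s z = s' z by rewrite mem_porbit_step.
by rewrite s'E (negbTE za) (negbTE zb).
Qed.

Lemma sub_porbit_merge s a b v : b \notin porbit s a ->
  porbit s v \subset porbit (tperm a b * s) v.
Proof.
move=> /porbit_tperm_merge; rewrite -eq_porbit_mem => /eqP eab.
by apply: sub_porbit_tperm; rewrite !(porbit_sym _ _ v) -!eq_porbit_mem eab.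
Qed.

Lemma card_porbit_merge s a b v : b \notin porbit s a -> v \in porbit s a ->
  #|porbit s v| + #|porbit s b| <= #|porbit (tperm a b * s) v|.
Proof.
move=> bNa va; have eva : porbit s v = porbit s a by apply/eqP; rewrite eq_porbit_mem.
have dis : #|porbit s v :&: porbit s b| = 0.
  apply/eqP; rewrite cards_eq0; apply/eqP/setP => z; rewrite !inE eva.
  apply/negP => /andP[]; rewrite -!eq_porbit_mem => /eqP -> /eqP eab.
  by move: bNa; rewrite -eq_porbit_mem eab eqxx.
rewrite -cardsUI dis addn0.
apply/subset_leq_card; rewrite finset.subUset sub_porbit_merge //=.
have /fintype.subsetP/(_ v va) := sub_porbit_merge a bNa.
rewrite -eq_porbit_mem => /eqP ->.
have /eqP <- : porbit (tperm a b * s) b == porbit (tperm a b * s) a.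
  by rewrite eq_porbit_mem porbit_tperm_merge.
exact: sub_porbit_merge.
Qed.

(* The points whose cycle gets shorter, to a length below [K]. *)
Definition lost K s o : {set T} :=
  [set v | #|porbit (act o * s) v| < minn K #|porbit s v|].

Definition fragment K s a b : {set T} :=
  if (b \in porbit s a) && (#|porbit (tperm a b * s) a| < K)
  then porbit (tperm a b * s) a else finset.set0.

Lemma lost_None K s : lost K s None = finset.set0.
Proof.
by apply/setP => v; rewrite !inE mul1g leq_min [X in _ && X]ltnn andbF.
Qed.

Lemma lost_subset K s a b :
  lost K s (Some (a, b)) \subset fragment K s a b :|: fragment K s b a.
Proof.
apply/fintype.subsetP => v; rewrite inE /= leq_min => /andP[vK vlt].
have ba : b \in porbit s a.
  apply: contraLR vlt => bNa; rewrite -leqNgt.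
  exact/subset_leq_card/sub_porbit_merge.
have : (a \in porbit (tperm a b * s) v) || (b \in porbit (tperm a b * s) v).
  apply: contraLR vlt; rewrite negb_or => /andP[av bv]; rewrite -leqNgt.
  by apply/subset_leq_card/sub_porbit_tperm; rewrite (negbTE av) (negbTE bv).
rewrite /fragment ba porbit_sym [b \in _]porbit_sym.
rewrite [a \in porbit s b]porbit_sym ba /= (tpermC b a) inE => /orP[]; rewrite -eq_porbit_mem => /eqP <-.
  by rewrite vK porbit_id.
by rewrite vK porbit_id orbT.
Qed.

(** After the cut, the piece of [a] consists of [a] and of the points that follow [b] under [s]
    until [a] is met again. *)
Lemma porbit_return s a b : b \in porbit s a ->
  (s ^+ #|porbit (tperm a b * s) a|)%g b = a.
Proof.
move=> ba; set s' : {perm T} := (tperm a b * s)%g; set i := #|_|.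
have [ab|ab] := eqVneq a b.
  by rewrite -ab permX {}/i {}/s' -ab tperm1 mul1g iter_porbit.
have bNa := porbit_tperm_split ab ba; rewrite -/s' in bNa.
have s'E := tperm_mulE s a b; rewrite -/s' in s'E.
have i0 : 0 < i by rewrite lt0n card_porbit_neq0.
have Ut := uniq_traject_porbit s' a; rewrite -/i in Ut.
have main j : 0 < j <= i -> (s ^+ j)%g b = (s' ^+ j)%g a.
  elim: j => [//|[|j] IH] /andP[_ ji]; first by rewrite !expg1 s'E eqxx.
  rewrite expgSr permM IH ?(ltnW ji) // (expgSr s' j.+1) (permM _ s') s'E.
  have /negbTE -> : (s' ^+ j.+1)%g a != b.
    by apply: contraNneq bNa => <-; exact: mem_porbit.
  have [E|//] := eqVneq.
  have := nth_uniq a (_ : 0 < size (traject s' a i)) (_ : j.+1 < size (traject s' a i)) Ut.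
  by rewrite size_traject !nth_traject // -!permX E expg0 perm1 eqxx => /(_ i0 ji).
by rewrite main ?i0 ?leqnn // permX iter_porbit.
Qed.

(** By [porbit_return], the length of the piece of [a] determines [b]. So at most [K] choices of [b]
    give a piece shorter than [K], and each contributes fewer than [K] points. *)
Lemma card_fragment K s a : \sum_b #|fragment K s a b| <= K * K.
Proof.
case: K => [|K].
  by rewrite big1 // => b _; rewrite /fragment ltn0 andbF cards0.
set P := [pred b | (b \in porbit s a) && (#|porbit (tperm a b * s) a| < K.+1)].
apply: leq_trans (_ : \sum_(b | P b) K.+1 <= _).
  rewrite [X in _ <= X]big_mkcond; apply: leq_sum => b _.
  by rewrite /fragment /P /=; case: ifP => [/andP[_ /ltnW]|]; rewrite ?cards0.
rewrite sum_nat_const leq_mul2r /=.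
rewrite -[X in _ <= X]card_ord -(card_in_imset (f := fun b => inord #|porbit (tperm a b * s) a| : 'I_K.+1) (D := P)).
  exact: max_card.
move=> b b' /andP[ba bK] /andP[b'a b'K] /(congr1 val); rewrite /= !inordK // => E.
by apply: (@perm_inj _ (s ^+ #|porbit (tperm a b * s) a|)%g); rewrite {2}E !porbit_return.
Qed.

Lemma sum_card_lost K s :
  \sum_ab #|lost K s (Some ab)| <= 2 * #|T| * (K * K).
Proof.
apply: leq_trans (_ : \sum_a \sum_b (#|fragment K s a b| + #|fragment K s b a|) <= _).
  rewrite pair_big /=; apply: leq_sum => -[a b] _.
  exact: leq_trans (subset_leq_card (lost_subset _ _ _ _)) (leq_card_setU _ _).
under eq_bigr do rewrite big_split /=.
rewrite big_split /= [X in _ + X <= _]exchange_big /= addnn -mul2n -mulnA leq_mul2l /=.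
by rewrite -sum_nat_const; apply: leq_sum => a _; exact: card_fragment.
Qed.

Definition big_cycles K s : {set T} := [set v | K <= #|porbit s v|].

Lemma card_big_cycles_step K s o :
  #|big_cycles K s| <= #|big_cycles K (act o * s)| + #|lost K s o|.
Proof.
apply: leq_trans (leq_card_setU _ _); apply/subset_leq_card/fintype.subsetP => v.
rewrite !inE leq_min => vK; case: leqP => //= lt; apply: leq_trans lt vK.
Qed.

Definition cyclic_step s o := if o is Some (a, b) then b \in porbit s a else false.

Lemma card_cyclic_step K s :
  #|[set ab | cyclic_step s (Some ab)]| <= #|T| * K + #|big_cycles K s| * #|T|.
Proof.
rewrite -sum1_card (eq_bigl (fun ab : T * T => xpredT ab.1 && (ab.2 \in porbit s ab.1))); last first.
  by case=> a b; rewrite inE.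
rewrite -(pair_big_dep xpredT (fun a b => b \in porbit s a) (fun _ _ => 1)) /=.
rewrite (bigID (mem (big_cycles K s))) [X in X <= _]addnC /=; apply: leq_add.
  apply: leq_trans (_ : \sum_(a : T) K <= _); last by rewrite sum_nat_const.
  rewrite [X in X <= _]big_mkcond; apply: leq_sum => a _.
  by case: ifP => //; rewrite inE -ltnNge sum1_card => /ltnW.
rewrite -sum_nat_const; apply: leq_sum => a _.
by rewrite sum1_card max_card.
Qed.

Lemma card_porbits_step s o :
  isSome o + #|porbits (act o * s)| <= #|porbits s| + 2 * cyclic_step s o.
Proof.
case: o => [[a b]|] /=; last by rewrite mul1g muln0 addn0.
have := porbits_mul_tperm s a b; rewrite /= porbit_sym.
(* A diagonal step does nothing but counts as cyclic, which leaves the inequality true. *)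
have [->|ab] := eqVneq a b; first by rewrite porbit_id; lia.
by case: (b \in _) => /=; lia.
Qed.

Fixpoint cyclic_steps w s := if w is o :: w' then
  cyclic_step s o + cyclic_steps w' (act o * s)%g else 0.

Lemma card_porbits_run w s :
  count isSome w + #|porbits (run w s)| <= #|porbits s| + 2 * cyclic_steps w s.
Proof.
elim: w s => [|o w IH] s /=; first by rewrite muln0 addn0.
rewrite -/(run w (act o * s)%g).
rewrite -addnA mulnDr [X in _ <= X]addnA.
apply: leq_trans (leq_add (leqnn _) (IH (act o * s)%g)) _.
by rewrite addnA leq_add2r card_porbits_step.
Qed.

Lemma porbit_saturatedP s (A : {set T}) :
  reflect (forall x, (s x \in A) = (x \in A)) (saturated (porbit s) A).
Proof.
apply: (iffP (saturatedP _ _)) => [satA x|sA x y].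
  by apply: satA; rewrite -{2}(expg1 s) porbit_perm.
move=> /eqP; rewrite eq_porbit_mem => /porbitP[i ->].
by elim: i => [|i IH]; rewrite ?perm1 // expgSr permM sA.
Qed.

Lemma card_porbit_saturated s :
  #|[set A | saturated (porbit s) A]| = 2 ^ #|porbits s|.
Proof.
rewrite card_saturated; congr (2 ^ _); apply: eq_card => A.
by apply/imsetP/imsetP => -[x _ ->]; exists x.
Qed.

(* A set invariant under [s] and under the steps of [w] is invariant under
   [run w s]. *)
Lemma ncomp_run w s : ncomp w + #|porbits s| <= #|porbits (run w s)| + #|T|.
Proof.
rewrite -(@leq_exp2l 2) // !expnD -card_invariants -!card_porbit_saturated.
apply: leq_trans (card_symdiff_closed (@invariants_closed _ w) _) _.
  move=> A B; rewrite !inE => /porbit_saturatedP sA /porbit_saturatedP sB.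
  by apply/porbit_saturatedP => x; rewrite !inE sA sB.
rewrite leq_mul2r; apply/orP; right; apply/subset_leq_card/fintype.subsetP => A.
rewrite !inE => /andP[]; elim: w s => [//|o w IH] s /= /andP[Ao Aw] sA.
apply: IH => //; apply/porbit_saturatedP => x; rewrite permM (porbit_saturatedP _ _ sA).
by case: o Ao => [[a b]|] /=; rewrite ?perm1 // => /eqP ab; case: tpermP => [->|->|].
Qed.

(** The numbers of cycles at the start and at the end cancel between [ncomp_run] and
    [card_porbits_run], so the bound does not depend on the initial permutation. *)
Lemma excess_le w s : count isSome w + ncomp w <= #|T| + 2 * cyclic_steps w s.
Proof. by have := ncomp_run w s; have := card_porbits_run w s; lia. Qed.

End PermSteps.

(** * One doubling of the cycle length *)

Section Stage.
Context {T : finType}.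
Implicit Types (s : {perm T}) (o : option (T * T)) (w : seq (option (T * T))) (A : {set T}).

(* The points of [A] whose cycle is never cut to a length below [K]. *)
Fixpoint marks K w s A : {set T} :=
  if w is o :: w' then marks K w' (act o * s)%g (A :\: lost K s o) else A.

Lemma marks_subset K w s A : marks K w s A \subset A.
Proof.
elim: w s A => //= o w IH s A.
exact: fintype.subset_trans (IH _ _) (subsetDl _ _).
Qed.

Lemma unlost_big k K s o A : (k <= K)%N -> A \subset big_cycles k s ->
  A :\: lost K s o \subset big_cycles k (act o * s)%g.
Proof.
move=> kK /fintype.subsetP As; apply/fintype.subsetP => v.
rewrite finset.in_setD !inE => /andP[+ /As]; rewrite inE leq_min negb_and -!leqNgt.
by case/orP => [Kv _|sv kv]; [exact: leq_trans Kv|exact: leq_trans sv].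
Qed.

Lemma unlost_small K s o A :
  (A :\: lost K s o) :\: big_cycles K (act o * s)%g \subset A :\: big_cycles K s.
Proof.
apply/fintype.subsetP => v; rewrite !inE leq_min negb_and -!leqNgt.
case/andP=> smallv /andP[lv ->]; rewrite andbT.
by case/orP: lv smallv => [->//|le]; apply: contra => /leq_trans; exact.
Qed.

Lemma merge_pairs k s A v : A \subset big_cycles k s -> v \in A ->
  (#|porbit s v| < 2 * k)%N ->
  (k * (#|A| - 2 * k) <= #|[set ab : T * T |
     v \in big_cycles (2 * k) (act (Some ab) * s)%g]|)%N.
Proof.
move=> /fintype.subsetP As vA vk.
apply: leq_trans (_ : (#|finset.setX (porbit s v) (A :\: porbit s v)| <= _)%N).
  rewrite cardsX; apply: leq_mul; first by have := As v vA; rewrite inE.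
  rewrite leq_subLR -(cardsID (porbit s v) A) leq_add2r.
  by apply: leq_trans (subset_leq_card (finset.subsetIr _ _)) (ltnW vk).
apply/subset_leq_card/fintype.subsetP => -[a b].
rewrite finset.in_setX finset.in_setD !inE /= => /andP[av /andP[bv bA]].
have eav : porbit s a = porbit s v by apply/eqP; rewrite eq_porbit_mem.
apply: leq_trans (card_porbit_merge (_ : b \notin porbit s a) _).
- rewrite mul2n -addnn; apply: leq_add; first by have := As v vA; rewrite inE.
  by have := As b bA; rewrite inE.
- by rewrite eav.
- by rewrite porbit_sym.
Qed.

Context {R : realFieldType}.
Variables (q p : R).
Hypotheses (q0 : 0 <= q) (p0 : 0 <= p) (qp : q + p * #|T|%:R ^+ 2 = 1).

Local Notation u := (step_weight q p [set: T]).

Lemma step_weightT_ge0 o : 0 <= u o. Proof. exact: step_weight_ge0. Qed.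

Lemma step_weightT_Some ab : u (Some ab) = p.
Proof. by case: ab => a b; rewrite /= !inE. Qed.

Lemma sum_step_weightT : \sum_o u o = 1.
Proof. by rewrite sum_step_weight cardsT. Qed.

Lemma mean_lost K s : \sum_o u o * #|lost K s o|%:R <= p * (2 * #|T|%:R * K%:R ^+ 2).
Proof.
rewrite big_option lost_None cards0 mulr0 add0r.
under eq_bigr do rewrite step_weightT_Some.
rewrite -mulr_sumr -natr_sum ler_wpM2l // -natrX -!natrM ler_nat.
exact: sum_card_lost.
Qed.

Lemma mean_marks K s A F :
  wsum u F (fun w => #|A|%:R - #|marks K w s A|%:R) <=
  F%:R * (p * (2 * #|T|%:R * K%:R ^+ 2)).
Proof.
elim: F s A => [|F IH] s A; first by rewrite /= subrr mul0r.
rewrite -natr1 mulrDl mul1r addrC.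
apply: le_trans (_ : \sum_o u o * (#|lost K s o|%:R +
   F%:R * (p * (2 * #|T|%:R * K%:R ^+ 2))) <= _); last first.
  under eq_bigr do rewrite mulrDr.
  by rewrite big_split /= -mulr_suml sum_step_weightT mul1r lerD2r mean_lost.
apply: ler_sum => o _; apply: ler_wpM2l; first exact: step_weightT_ge0.
apply: le_trans (_ : wsum u F (fun w => #|lost K s o|%:R +
  (#|A :\: lost K s o|%:R - #|marks K w (act o * s)%g (A :\: lost K s o)|%:R)) <= _).
  apply: ler_wsum => [|w /=]; first exact: step_weightT_ge0.
  rewrite addrA lerD2r -natrD ler_nat -(cardsID (lost K s o) A) leq_add2r.
  exact: subset_leq_card (finset.subsetIr _ _).
by rewrite wsumD wsum_cst sum_step_weightT expr1n mul1r lerD2l IH.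
Qed.

(** The truncation at [tau] keeps the merging rate bounded below: as long as the quantity is
    nonzero, at least [tau] marked points are available as partners. The event that fewer remain is
    paid for by [mean_marks]. *)
Definition unmerged k (tau : R) s A : R :=
  #|A :\: big_cycles (2 * k) s|%:R *+ (tau <= #|A|%:R)%R.

(* A marked point in a cycle shorter than [2 * k] is merged by one step with
   another marked point, hence into a cycle of length at least [2 * k], with
   probability of order [p * k * tau]. *)
Lemma mean_unmerged k tau s A : (2 * k)%:R <= tau -> A \subset big_cycles k s ->
  \sum_o u o * unmerged k tau (act o * s)%g (A :\: lost (2 * k) s o) <=
  (1 - p * (k%:R * (tau - (2 * k)%:R))) * unmerged k tau s A.
Proof.
move=> ktau As; rewrite /unmerged; have [tauA|Atau] := leP tau; last first.
  rewrite mulr0 big1 // => o _.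
  rewrite (_ : (tau <= _)%R = false) ?mulr0 //; apply/negbTE; rewrite -ltNge.
  by apply: le_lt_trans Atau; rewrite ler_nat subset_leq_card // subsetDl.
rewrite mulr1n; set U := A :\: big_cycles (2 * k) s.
pose ind o v : R := (v \in (A :\: lost (2 * k) s o) :\: big_cycles (2 * k) (act o * s)%g)%:R.
apply: le_trans (_ : \sum_o u o * \sum_(v in U) ind o v <= _).
  apply: ler_sum => o _; apply: ler_wpM2l; first exact: step_weightT_ge0.
  apply: le_trans (_ : #|(A :\: lost (2 * k) s o) :\: big_cycles (2 * k) (act o * s)%g|%:R <= _).
    by case: (tau <= _)%R; rewrite ?mulr1n ?mulr0n.
  rewrite /ind -natr_sum ler_nat -sum1_card big_mkcond [leqRHS]big_mkcond /=.
  apply: leq_sum => v _; case: ifP => // vU.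
  by have /fintype.subsetP/(_ v vU) -> := unlost_small (2 * k) s o A.
under eq_bigr do rewrite mulr_sumr.
rewrite exchange_big /= mulrC -sum1_card natr_sum mulr_suml; apply: ler_sum => v vU.
rewrite mul1r lerBrDl.
have [vA vk] : v \in A /\ (#|porbit s v| < 2 * k)%N.
  by move: vU; rewrite finset.in_setD inE -ltnNge => /andP[].
have := merge_pairs As vA vk.
set P := [set ab | _] => leP.
(* A step of [P] puts [v] into a long cycle, so for every letter at most one of the two indicators
   is 1. *)
apply: le_trans (_ : \sum_o u o * ((if o is Some ab then (ab \in P)%:R else 0) + ind o v) <= _).
  under [leRHS]eq_bigr do rewrite mulrDr.
  rewrite big_split /= lerD2r big_option mulr0 add0r.
  under eq_bigr do rewrite step_weightT_Some.
  rewrite -mulr_sumr ler_wpM2l // -natr_sum.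
  have -> : (\sum_ab (ab \in P) = #|P|)%N.
    by rewrite -sum1_card [RHS]big_mkcond; apply: eq_bigr => ab _; case: (ab \in P).
  apply: le_trans (_ : (k * (#|A| - 2 * k))%:R <= _); last by rewrite ler_nat.
  rewrite [leRHS]natrM ler_wpM2l // natrB ?lerD2r //.
  by rewrite -(ler_nat R); exact: le_trans tauA.
rewrite -[leRHS]sum_step_weightT; apply: ler_sum => o _.
rewrite ler_piMr ?step_weightT_ge0 // /ind finset.in_setD.
case: o => [ab|]; last by rewrite add0r lern1; case: (_ && _).
by rewrite /P inE; case: (v \in big_cycles _ _) => /=; rewrite ?addr0 ?add0r ?lern1 //; case: (_ \in _).
Qed.

Lemma wsum_unmerged k tau s A F : (2 * k)%:R <= tau -> A \subset big_cycles k s ->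
  p * (k%:R * (tau - (2 * k)%:R)) <= 1 ->
  wsum u F (fun w => unmerged k tau (run w s) (marks (2 * k) w s A)) <=
  (1 - p * (k%:R * (tau - (2 * k)%:R))) ^+ F * unmerged k tau s A.
Proof.
move=> ktau + r1; elim: F s A => [|F IH] s A As; first by rewrite mul1r.
rewrite exprSr -mulrA.
apply: le_trans (ler_wpM2l _ (mean_unmerged ktau As)); last first.
  by rewrite exprn_ge0 // subr_ge0.
rewrite mulr_sumr; apply: ler_sum => o _; rewrite mulrCA.
apply: ler_wpM2l; first exact: step_weightT_ge0.
apply: IH; apply: unlost_big As; lia.
Qed.

(** All points of [big_cycles k s] are marked at the start; one that is missing from the next level
    at the end was lost or is unmerged. If fewer than [mu * n / 2] marks remain, at least as many
    were lost, and the trivial bound [n] on the unmerged points is at most [2 / mu] times the loss: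
    hence the factor [1 + 2 / mu]. *)
Lemma stage_loss k (mu : R) s F : 0 < mu -> (4 * k)%:R <= mu * #|T|%:R ->
  mu * #|T|%:R <= #|big_cycles k s|%:R ->
  p * (k%:R * (mu * #|T|%:R / 2 - (2 * k)%:R)) <= 1 ->
  wsum u F (fun w => Num.max 0 (#|big_cycles k s|%:R - #|big_cycles (2 * k) (run w s)|%:R)) <=
  (1 - p * (k%:R * (mu * #|T|%:R / 2 - (2 * k)%:R))) ^+ F * #|T|%:R +
  (1 + 2 / mu) * (F%:R * (p * (2 * #|T|%:R * (2 * k)%:R ^+ 2))).
Proof.
move=> mu0 kmu muM r1; set A := big_cycles k s; set tau := mu * #|T|%:R / 2 in r1 *.
have k0 : (k <= 2 * k)%N by lia.
have ktau : (2 * k)%:R <= tau by rewrite /tau; move: kmu; rewrite !natrM; lra.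
have u0 := step_weightT_ge0.
have c0 : 0 <= 1 + 2 / mu by rewrite addr_ge0 // divr_ge0 // ltW.
apply: le_trans (_ : wsum u F (fun w =>
  unmerged k tau (run w s) (marks (2 * k) w s A) +
  (1 + 2 / mu) * (#|A|%:R - #|marks (2 * k) w s A|%:R)) <= _); last first.
  rewrite wsumD wsumZ; apply: lerD; last by apply: ler_wpM2l => //; exact: mean_marks.
  apply: le_trans (wsum_unmerged F ktau (subxx _) r1) _.
  apply: ler_wpM2l; first by rewrite exprn_ge0 // subr_ge0.
  rewrite /unmerged; apply: le_trans (_ : #|A :\: big_cycles (2 * k) s|%:R <= _).
    by case: (tau <= _)%R; rewrite ?mulr1n ?mulr0n.
  by rewrite ler_nat max_card.
apply: ler_wsum => // w.
set B := marks (2 * k) w s A; set M' := big_cycles (2 * k) (run w s).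
have BA : (#|B| <= #|A|)%N by rewrite subset_leq_card // marks_subset.
have d0 : 0 <= #|A|%:R - #|B|%:R :> R by rewrite subr_ge0 ler_nat.
have un0 : 0 <= unmerged k tau (run w s) B by rewrite /unmerged mulrn_wge0.
rewrite ge_max; apply/andP; split; first by rewrite addr_ge0 // mulr_ge0.
have BM : #|B|%:R <= #|B :\: M'|%:R + #|M'|%:R :> R.
  rewrite -natrD ler_nat -(cardsID M' B) addnC leq_add2l.
  exact: subset_leq_card (finset.subsetIr _ _).
rewrite mulrDl mul1r.
suff : #|B :\: M'|%:R <= unmerged k tau (run w s) B + 2 / mu * (#|A|%:R - #|B|%:R).
  lra.
rewrite /unmerged -/M'; have [_|Btau] := leP tau.
  by rewrite mulr1n lerDl mulr_ge0 // divr_ge0 // ltW.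
rewrite mulr0n add0r; apply: le_trans (_ : #|T|%:R <= _); first by rewrite ler_nat max_card.
rewrite mulrAC ler_pdivlMr //; move: muM Btau; rewrite -/A /tau; lra.
Qed.

End Stage.

(** * Linear mass in cycles of bounded length *)

Section MeanComponents.
Context {R : realFieldType}.

Lemma bernoulli_ge (z : R) F : 0 <= z <= 1 -> 1 - F%:R * z <= (1 - z) ^+ F.
Proof.
move=> /andP[z0 z1]; elim: F => [|F IH]; first by rewrite mul0r subr0.
rewrite exprS; apply: le_trans (_ : (1 - z) * (1 - F%:R * z) <= _); last first.
  by rewrite ler_wpM2l // subr_ge0.
rewrite -natr1; have : 0 <= F%:R * (z * z) by rewrite !mulr_ge0.
lra.
Qed.

Lemma exprn_secant (s t : R) j : 0 <= s -> s <= t ->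
  j.+1%:R * (s ^+ j * (t - s)) <= t ^+ j.+1 - s ^+ j.+1.
Proof.
move=> s0 st; have t0 := le_trans s0 st.
elim: j => [|j IH]; first by rewrite !mul1r.
rewrite -natr1 exprS [t ^+ j.+2]exprS [s ^+ j.+2]exprS.
have h1 : s * (j.+1%:R * (s ^+ j * (t - s))) <= s * (t ^+ j.+1 - s ^+ j.+1).
  exact: ler_wpM2l.
have h2 : s ^+ j.+1 * (t - s) <= t ^+ j.+1 * (t - s).
  by rewrite ler_wpM2r ?subr_ge0 // lerXn2r.
move: h1 h2; rewrite !exprS; lra.
Qed.

(* A Riemann sum for the integral of [s ^ j * ds / s] over [0, 1]. *)
Lemma inv_ge_riemann (s : nat -> R) r j : (0 < j)%N ->
  (forall i, (1 <= i <= r)%N -> 0 < s i) ->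
  (forall i, (1 <= i < r)%N -> s i <= s i.+1) -> s r <= 1 ->
  \sum_(1 <= i < r) s i ^+ j * (s i.+1 / s i - 1) <= j%:R^-1.
Proof.
case: j => // j _ s0 smono sr1; rewrite -[leRHS]mul1r ler_pdivlMr ?ltr0n // mulrC.
case: r s0 smono sr1 => [|r] s0 smono sr1; first by rewrite big_geq // mulr0.
rewrite mulr_sumr; apply: le_trans (_ : \sum_(1 <= i < r.+1) (s i.+1 ^+ j.+1 - s i ^+ j.+1) <= _).
  rewrite big_nat_cond [leRHS]big_nat_cond; apply: ler_sum => i /andP[/andP[i1 ir] _].
  have si : 0 < s i by apply: s0; rewrite i1 ltnW.
  apply: le_trans (exprn_secant j (ltW si) (smono i _)); last by rewrite i1.
  rewrite exprSr -mulrA mulrBr mulr1 [s i * (_ / _)]mulrC divfK ?gt_eqF //.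
rewrite telescope_sumr // -[leRHS]subr0 lerB //.
  by rewrite exprn_ile1 // ltW // s0 // leqnn.
by rewrite exprn_ge0 // ltW // s0.
Qed.

End MeanComponents.

Section Phase1.
Context {T : finType} {R : realFieldType}.
Variables (q p : R).
Hypotheses (q0 : 0 < q) (p0 : 0 <= p) (qp : q + p * #|T|%:R ^+ 2 = 1).
Local Notation u := (step_weight q p [set: T]).
Local Notation n := #|T|%:R.
Implicit Types (s : {perm T}) (o : option (T * T)) (w : seq (option (T * T))).

Let u0 : forall o, 0 <= u o := step_weightT_ge0 (ltW q0) p0.
Let u1 : \sum_o u o = 1 := sum_step_weightT qp.

(* Since 1/j is the integral of [s ^ j.-1] over [0, 1], the bounds of
   [explore_ge] on the generating function of the size of a component, taken at
   [r] points, bound the mean of its inverse. *)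
Lemma mean_inv_component (g c1 : R) F r v :
  let y := p * (2 * n) / q in
  y <= 1 / 2 -> F%:R * y <= c1 * (1 - y) -> 0 < g -> g <= 1 -> c1 * g <= 1 ->
  g <= (1 - y * (1 - g)) ^+ F -> (0 < r)%N ->
  g - c1 * g ^+ 2 / 2 - 2 / r%:R <=
  wsum u F (fun w => (#|component w v|%:R)^-1).
Proof.
move=> y y2 Fy g0 g1 cg gF r0.
have y0 : 0 <= y by rewrite /y divr_ge0 ?(ltW q0) // !mulr_ge0.
have c10 : 0 <= c1.
  have : 0 <= c1 * (1 - y) by apply: le_trans Fy; rewrite mulr_ge0.
  by rewrite pmulr_lge0 //; lra.
have rR : 0 < r%:R :> R by rewrite ltr0n.
(* A grid of equally spaced values up to [g], at which [explore_ge] is applied. *)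
pose D := g / r%:R; pose G i := D * i%:R.
have D0 : 0 < D by rewrite divr_gt0.
have D1 : D <= 1.
  rewrite ler_pdivrMr // mul1r; apply: le_trans g1 _; by rewrite ler1n.
have Gr : G r = g by rewrite /G /D divfK ?gt_eqF.
have Gg i : (i <= r)%N -> G i <= g.
  by move=> ir; rewrite -Gr ler_pM2l // ler_nat.
have G0 i : 0 <= G i by rewrite mulr_ge0 // ltW.
have Gp i : (0 < i)%N -> 0 < G i by move=> i0; rewrite mulr_gt0 // ltr0n.
have GS i : G i.+1 = G i + D by rewrite /G -natr1 mulrDr mulr1.
pose x i := y * (1 - G i).
have x0 i : (i <= r)%N -> 0 <= x i.
  by move=> /Gg ?; rewrite mulr_ge0 //; lra.
have xy i : (i <= r)%N -> x i <= y.
  by move=> ir; rewrite ler_piMr // lerBlDr lerDl.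
have x1 i : (i <= r)%N -> 0 < 1 - x i by move=> /xy; lra.
(* The least [s] allowed by [explore_ge] at [G i] for [F] letters; at [G r = g] it is at most 1 by
   the hypothesis on [g]. *)
pose sq i := G i / (1 - x i) ^+ F.
have pw i : (i <= r)%N -> 0 < (1 - x i) ^+ F by move=> /x1; exact: exprn_gt0.
have sq0 i : (1 <= i <= r)%N -> 0 < sq i.
  by move=> /andP[i1 ir]; rewrite divr_gt0 ?Gp ?pw.
(* In the limit, [G ds / s] is at least [(1 - c1 * G) dG], whose integral over [[0, g]] is
   [g - c1 * g ^+ 2 / 2]. This is the discrete form; the error of the grid is of order [D <= 1 / r],
   covered by [2 / r]. *)
have ratio i : (1 <= i < r)%N -> D - c1 * D * G i.+1 <= G i * (sq i.+1 / sq i - 1).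
  move=> /andP[i1 ir]; have ir' := ltnW ir.
  pose d := 1 - x i.+1; have dy : 1 - y <= d by rewrite lerD2l lerN2 xy.
  have d0 : 0 < d by exact: x1.
  have yD : y * D <= y by rewrite ler_piMr.
  have yD0 : 0 <= y * D by rewrite mulr_ge0 // ltW.
  pose z := y * D / d.
  have z0 : 0 <= z by rewrite divr_ge0 // ltW.
  have z1 : z <= 1 by rewrite ler_pdivrMr // mul1r; lra.
  have E : (1 - x i) ^+ F / (1 - x i.+1) ^+ F = (1 - z) ^+ F.
    rewrite -expr_div_n; congr (_ ^+ _); rewrite /z.
    have h := lt0r_neq0 d0.
    by apply: (mulIf h); rewrite divfK // mulrBl divfK // /d /x GS; ring.
  have Fz : F%:R * z <= c1 * D.
    rewrite mulrA ler_pdivrMr // mulrA [leRHS]mulrAC ler_wpM2r ?(ltW D0) //.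
    by apply: le_trans Fy _; rewrite ler_wpM2l.
  have -> : G i * (sq i.+1 / sq i - 1) = G i.+1 * (1 - z) ^+ F - G i.
    rewrite -E /sq; have h1 := lt0r_neq0 (pw _ ir); have h2 := lt0r_neq0 (pw _ ir').
    have h3 := lt0r_neq0 (Gp _ i1); field.
    by rewrite h1 h2 h3.
  have b := bernoulli_ge F (introT andP (conj z0 z1)).
  apply: le_trans (_ : G i.+1 * (1 - c1 * D) - G i <= _).
    rewrite GS; lra.
  rewrite lerD2r ler_wpM2l //; lra.
have gap i : (1 <= i < r)%N -> 0 <= D - c1 * D * G i.+1.
  move=> /andP[i1 ir]; rewrite -mulrA mulrCA -{1}[D]mulr1 -mulrBr mulr_ge0 ?(ltW D0) //.
  rewrite subr_ge0; apply: le_trans cg; rewrite ler_wpM2l // Gg //.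
have sqmono i : (1 <= i < r)%N -> sq i <= sq i.+1.
  move=> ir; have := ratio i ir; have := gap i ir; have /andP[i1 ir'] := ir.
  have si : 0 < sq i by rewrite sq0 // i1 ltnW.
  move=> h1 h2; have := le_trans h1 h2; rewrite pmulr_rge0 ?Gp // subr_ge0.
  by rewrite ler_pdivlMr // mul1r.
have sqr1 : sq r <= 1.
  by rewrite /sq ler_pdivrMr ?pw // mul1r /x Gr.
have sqle1 i : (1 <= i <= r)%N -> sq i <= 1.
  move=> /andP[i1 ir]; rewrite -(subKn ir).
  have : (r - i < r)%N by rewrite ltn_subrL i1.
  elim: (r - i)%N => [|k IH] kr; first by rewrite subn0.
  apply: le_trans (sqmono (r - k.+1)%N _) _; first by rewrite subn_gt0 kr ltn_subrL.
  by rewrite subnSK ?IH // ltnW.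
apply: le_trans (_ : wsum u F (fun w => \sum_(1 <= i < r)
   sq i ^+ #|component w v| * (sq i.+1 / sq i - 1)) <= _); last first.
  apply: ler_wsum => // w; apply: inv_ge_riemann => //.
  by rewrite card_gt0; apply/set0Pn; exists v; rewrite mem_component connect0.
rewrite wsum_sum.
apply: le_trans (_ : \sum_(1 <= i < r) (D - c1 * D * G i.+1) <= _); last first.
  rewrite big_nat_cond [leRHS]big_nat_cond; apply: ler_sum => i /andP[ir _].
  apply: le_trans (ratio i ir) _; have /andP[i1 ir'] := ir.
  under eq_wsum do rewrite mulrC.
  rewrite wsumZ mulrC ler_wpM2l //.
    have si : 0 < sq i by rewrite sq0 // i1 ltnW.
    by rewrite subr_ge0 ler_pdivlMr // mul1r sqmono.
  have leG1 : G i <= 1 by apply: le_trans (Gg _ (ltnW ir')) g1.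
  have pw1 : (1 - x i) ^+ F <= 1.
    rewrite exprn_ile1 //; first by rewrite ltW // x1 // ltnW.
    by rewrite lerBlDr lerDl x0 // ltnW.
  have Gs : G i <= sq i.
    by rewrite /sq ler_pdivlMr ?pw ?(ltnW ir') // ler_piMr.
  have s1 : sq i <= 1 by rewrite sqle1 // i1 ltnW.
  have := @explore_ge T R q p (sq i) (G i) (x i) F (ltW q0) p0 (G0 i) Gs s1 _ _ _ [set: T] [set v] F (leqnn _).
  rewrite cards1 expr1 cardsT qp expr1n mulr1; apply.
  - by rewrite x0 ?(ltnW ir') //= (le_trans (xy _ (ltnW ir'))) //; lra.
  - by rewrite /x [leRHS]mulrAC /y divfK // gt_eqF.
  - by rewrite /sq divfK // gt_eqF // pw // ltnW.
have sumE m : \sum_(1 <= i < m.+1) (D - c1 * D * G i.+1) =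
    D * m%:R - c1 * D ^+ 2 * (m%:R * (m%:R + 3) / 2).
  elim: m => [|m IH]; first by rewrite big_geq // !mul0r !mulr0 subr0.
  rewrite big_nat_recr //= IH /G -!natr1; by field.
have [r1 rm] : exists k, r = k.+1 by exists r.-1; rewrite prednK.
have Dr : D <= 1 / r%:R by rewrite /D ler_wpM2r // invr_ge0 ltW.
have Dm : D * r1%:R = g - D by rewrite -Gr /G rm -natr1; ring.
have cgD : c1 * g * D <= 1 * D by rewrite ler_wpM2r // ltW.
have cDD : 0 <= c1 * D * D by rewrite !mulr_ge0 // ltW.
rewrite rm sumE -rm.
rewrite (_ : c1 * D ^+ 2 * (r1%:R * (r1%:R + 3) / 2) =
             c1 * (D * r1%:R * (D * r1%:R + 3 * D) / 2)); last by ring.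
rewrite Dm; lra.
Qed.

Lemma mean_ncomp (g c1 : R) F r :
  let y := p * (2 * n) / q in
  y <= 1 / 2 -> F%:R * y <= c1 * (1 - y) -> 0 < g -> g <= 1 -> c1 * g <= 1 ->
  g <= (1 - y * (1 - g)) ^+ F -> (0 < r)%N ->
  n * (g - c1 * g ^+ 2 / 2 - 2 / r%:R) <= wsum u F (fun w => (ncomp w)%:R).
Proof.
move=> y y2 Fy g0 g1 cg gF r0.
rewrite (eq_wsum _ _ (fun w => ncompE R w)) wsum_sum.
rewrite mulr_natl -sumr_const; apply: ler_sum => v _.
exact: (@mean_inv_component g c1 F r v).
Qed.

Lemma sum_step_weight_some : \sum_(o | o != None) u o = p * n ^+ 2.
Proof.
have := u1; rewrite (bigD1 None) //= => /(canRL (addKr _)) ->.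
by rewrite -[X in _ + X]qp /= addKr.
Qed.

Lemma mean_count F : wsum u F (fun w => (count isSome w)%:R) = F%:R * (p * n ^+ 2).
Proof.
elim: F => [|F IH]; first by rewrite mul0r.
rewrite /=; transitivity (\sum_o (u o * (o != None)%:R + u o * (F%:R * (p * n ^+ 2)))).
  apply: eq_bigr => o _; rewrite -mulrDr -IH; congr (_ * _).
  have := wsum_cst u F (o != None)%:R; rewrite u1 expr1n mul1r => <-; rewrite -wsumD.
  by apply: eq_wsum => w; rewrite -natrD; case: o.
rewrite big_split /= -mulr_suml u1 mul1r -natr1 mulrDl mul1r addrC; congr (_ + _).
rewrite -sum_step_weight_some [RHS]big_mkcond /=; apply: eq_bigr => o _.
by case: (o != None); rewrite ?mulr1 ?mulr0.
Qed.

Definition edges_components w : R := (count isSome w)%:R + (ncomp w)%:R.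

(** A step adds one to the count and removes at most one component, so putting it in place of [None]
    raises the sum by 0 or 1. *)
Lemma edges_components_lip w w' o :
  `|edges_components (w ++ o :: w') - edges_components (w ++ None :: w')| <= (o != None)%:R.
Proof.
rewrite /edges_components !ncomp_cat_cons ncomp_None !count_cat /= add0n.
have := ncomp_cons_le (w ++ w') o; have := ncomp_cons_ge (w ++ w') o.
case: o => [ab|] /=; last by rewrite ncomp_None add0n subrr normr0.
rewrite -!(ler_nat R) -natr1 !natrD; set a := (count _ _)%:R; set b := (count _ _)%:R.
by move=> h1 h2; rewrite ler_norml; apply/andP; split; lra.
Qed.

Fixpoint subcritical_steps K (d : R) w s : nat :=
  if w is o :: w' then
    (((#|big_cycles K s|%:R <= d)%R && cyclic_step s o) +
     subcritical_steps K d w' (act o * s)%g)%N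
  else 0%N.

Fixpoint total_lost K w s : nat :=
  if w is o :: w' then (#|lost K s o| + total_lost K w' (act o * s)%g)%N else 0%N.

Lemma mean_total_lost K s F :
  wsum u F (fun w => (total_lost K w s)%:R) <= F%:R * (p * (2 * n * K%:R ^+ 2)).
Proof.
elim: F s => [|F IH] s; first by rewrite mul0r.
rewrite -natr1 mulrDl mul1r addrC.
apply: le_trans (_ : \sum_o u o * (#|lost K s o|%:R +
   F%:R * (p * (2 * n * K%:R ^+ 2))) <= _); last first.
  under eq_bigr do rewrite mulrDr.
  by rewrite big_split /= -mulr_suml u1 mul1r lerD2r (mean_lost q p0).
apply: ler_sum => o _; apply: ler_wpM2l => //.
apply: le_trans (_ : wsum u F (fun w => #|lost K s o|%:R +
  (total_lost K w (act o * s)%g)%:R) <= _).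
  by apply: ler_wsum => // w; rewrite /= natrD.
by rewrite wsumD wsum_cst u1 expr1n mul1r lerD2l IH.
Qed.

Lemma mean_cyclic_step K d s : 0 <= d ->
  \sum_o u o * ((#|big_cycles K s|%:R <= d)%R && cyclic_step s o)%:R <=
  p * (n * K%:R + d * n).
Proof.
move=> d0; rewrite big_option andbF mulr0 add0r.
under eq_bigr do rewrite step_weightT_Some.
rewrite -mulr_sumr ler_wpM2l // -natr_sum.
have [le_d|_] := leP _ d; last first.
  by rewrite big1 // addr_ge0 // !mulr_ge0.
apply: le_trans (_ : #|[set ab | cyclic_step s (Some ab)]|%:R <= _).
  rewrite ler_nat -sum1_card [leqRHS]big_mkcond; apply: leq_sum => ab _.
  by rewrite inE; case: (cyclic_step _ _).
apply: le_trans (_ : (#|T| * K + #|big_cycles K s| * #|T|)%:R <= _).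
  by rewrite ler_nat card_cyclic_step.
by rewrite natrD !natrM lerD2l ler_wpM2r.
Qed.

Lemma mean_subcritical K d s F : 0 <= d ->
  wsum u F (fun w => (subcritical_steps K d w s)%:R) <= F%:R * (p * (n * K%:R + d * n)).
Proof.
move=> d0; elim: F s => [|F IH] s; first by rewrite mul0r.
rewrite -natr1 mulrDl mul1r addrC.
apply: le_trans (_ : \sum_o u o * (((#|big_cycles K s|%:R <= d)%R && cyclic_step s o)%:R +
   F%:R * (p * (n * K%:R + d * n))) <= _); last first.
  under eq_bigr do rewrite mulrDr.
  by rewrite big_split /= -mulr_suml u1 mul1r lerD2r mean_cyclic_step.
apply: ler_sum => o _; apply: ler_wpM2l => //.
apply: le_trans (_ : wsum u F (fun w =>
  ((#|big_cycles K s|%:R <= d)%R && cyclic_step s o)%:R +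
  (subcritical_steps K d w (act o * s)%g)%:R) <= _).
  by apply: ler_wsum => // w; rewrite /= natrD.
by rewrite wsumD wsum_cst u1 expr1n mul1r lerD2l IH.
Qed.

Lemma big_cycles_run K w s :
  (#|big_cycles K s| <= #|big_cycles K (run w s)| + total_lost K w s)%N.
Proof.
elim: w s => [|o w IH] s; first by rewrite addn0.
apply: leq_trans (card_big_cycles_step K s o) _.
by rewrite /= addnCA addnC leq_add2l; exact: IH.
Qed.

(* Either all the splits occur while few points lie in cycles of length at least
   [K], or at some time many do and only those lost afterwards may be missing
   at the end. *)
Lemma subcritical_or_big K d w s :
  subcritical_steps K d w s = cyclic_steps w s \/
  d < (#|big_cycles K (run w s)| + total_lost K w s)%:R.
Proof.
elim: w s => [|o w IH] s; first by left.
have [le_d|lt_d] := leP #|big_cycles K s|%:R d; last first.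
  by right; apply: lt_le_trans lt_d _; rewrite ler_nat big_cycles_run.
have [E|lt_d] := IH (act o * s)%g; [left|right].
  by rewrite /= le_d E.
by apply: lt_le_trans lt_d _; rewrite ler_nat /= leq_add2l leq_addl.
Qed.

(** Here [c] is the mean degree of the graph, and the number of steps plus components has mean at
    least [n * (1 + alpha)]. If it exceeds its mean minus [alpha * n / 2], [excess_le] yields at
    least [alpha * n / 4] cyclic steps. The three terms bound the fluctuation of this sum, the
    chance of so many cyclic steps while at most [d * n] points lie in long cycles, and the chance
    of losing [d * n / 2] points. *)
Lemma phase1 (g c1 alpha d : R) F r K s :
  let y := p * (2 * n) / q in let c := F%:R * (p * (2 * n)) in
  y <= 1 / 2 -> F%:R * y <= c1 * (1 - y) -> 0 < g -> g <= 1 -> c1 * g <= 1 ->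
  g <= (1 - y * (1 - g)) ^+ F -> (0 < r)%N -> (0 < #|T|)%N ->
  0 < alpha -> 1 + alpha <= c / 2 + g - c1 * g ^+ 2 / 2 - 2 / r%:R -> 0 < d ->
  wsum u F (fun w => (#|big_cycles K (run w s)|%:R <= d * n / 2)%R%:R) <=
  2 * c / (alpha ^+ 2 * n) + 2 * c * (K%:R / n + d) / alpha + 2 * c * K%:R ^+ 2 / (d * n).
Proof.
move=> y c y2 Fy g0 g1 cg gF r0 T0 a0 ale d0.
have n0 : 0 < n :> R by rewrite ltr0n.
have cE : F%:R * p = c / (2 * n) by rewrite /c; field; rewrite gt_eqF.
have mE : n * (1 + alpha) <= wsum u F edges_components.
  rewrite /edges_components wsumD mean_count.
  apply: le_trans (lerD (lexx _) (mean_ncomp y2 Fy g0 g1 cg gF r0)).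
  rewrite (_ : F%:R * (p * n ^+ 2) = n * (c / 2)); last by rewrite mulrA cE; field; rewrite gt_eqF.
  by rewrite -mulrDr ler_pM2l //; move: ale; lra.
pose t := alpha * n / 2; have t0 : 0 < t by rewrite divr_gt0 // mulr_gt0.
have dn0 : 0 < d * n by rewrite mulr_gt0.
have var := wsum_variance F u0 u1 edges_components_lip.
have cheb := wsum_chebyshev F edges_components u0 u1 t0.
have lostP := wsum_markov F u0 (divr_gt0 dn0 (ltr0n R 2)) (fun w => ler0n R (total_lost K w s)).
have an0 : 0 < alpha * n / 4 by rewrite divr_gt0 // mulr_gt0.
have subP := wsum_markov F u0 an0 (fun w => ler0n R (subcritical_steps K (d * n) w s)).
set m := wsum u F edges_components in mE var cheb.
apply: le_trans (_ : wsum u F (fun w => (edges_components w <= m - t)%R%:R +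
   (alpha * n / 4 <= (subcritical_steps K (d * n) w s)%:R)%R%:R +
   (d * n / 2 <= (total_lost K w s)%:R)%R%:R) <= _).
  apply: ler_wsum => // w.
  have [small|_] := leP #|big_cycles K (run w s)|%:R (d * n / 2); last by rewrite mulr0n !addr_ge0.
  have [E|big] := subcritical_or_big K (d * n) w s; last first.
    have -> : (d * n / 2 <= (total_lost K w s)%:R)%R.
      by move: big; rewrite natrD; lra.
    by rewrite lerDr addr_ge0.
  have [_|ltE] := leP (edges_components w) (_ - t); first by rewrite -addrA lerDl addr_ge0.
  have -> : (alpha * n / 4 <= (subcritical_steps K (d * n) w s)%:R)%R.
    have := excess_le w s; rewrite E -(ler_nat R) [leRHS]natrD natrM [leLHS]natrD => ex.
    move: ltE; rewrite /edges_components /t; lra.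
  by rewrite mulr0n add0r lerDl.
rewrite !wsumD; apply: lerD; first apply: lerD.
- apply: le_trans cheb _; rewrite ler_pdivrMr; last exact: exprn_gt0.
  apply: le_trans var _.
  rewrite sum_step_weight_some /t mulrA cE; rewrite le_eqVlt; apply/predU1P; left; field.
  by rewrite !gt_eqF.
- apply: le_trans subP _; rewrite ler_pdivrMr //.
  apply: le_trans (mean_subcritical K s F (ltW dn0)) _.
  rewrite mulrA cE; rewrite le_eqVlt; apply/predU1P; left; field; by rewrite !gt_eqF.
- apply: le_trans lostP _; rewrite ler_pdivrMr ?divr_gt0 //.
  apply: le_trans (mean_total_lost K s F) _.
  rewrite mulrA cE; rewrite le_eqVlt; apply/predU1P; left; field; by rewrite !gt_eqF.
Qed.

End Phase1.

(** * From bounded to linear cycle lengths *)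

Section Levels.
Context {T : finType} {R : realFieldType}.
Variables (q p : R).
Hypotheses (q0 : 0 <= q) (p0 : 0 <= p) (qp : q + p * #|T|%:R ^+ 2 = 1).
Local Notation u := (step_weight q p [set: T]).
Local Notation n := #|T|%:R.
Implicit Types (s : {perm T}) (o : option (T * T)) (w : seq (option (T * T))).

Let u0 : forall o, 0 <= u o := step_weightT_ge0 q0 p0.
Let u1 : \sum_o u o = 1 := sum_step_weightT qp.

Lemma run_cat w w' s : run (w ++ w') s = run w' (run w s).
Proof. by rewrite /run foldl_cat. Qed.

(** The maximum on the right is the deficit with respect to twice the threshold. Level [j] increases
    it by at most [D j] in mean, and falling below [th] at the end requires a deficit of more than
    [th], as in Markov's inequality. If a level is already below [th], its deficit alone makes the
    bound trivial. *)
Lemma levels (th : R) m k (N : nat -> nat) (D : nat -> R) s : 0 < th ->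
  (forall j, (j < m)%N -> 0 <= D j) ->
  (forall j s, (j < m)%N -> th <= #|big_cycles (k * 2 ^ j) s|%:R ->
     wsum u (N j) (fun w => Num.max 0 (#|big_cycles (k * 2 ^ j) s|%:R -
        #|big_cycles (k * 2 ^ j.+1) (run w s)|%:R)) <= D j) ->
  wsum u (\sum_(j < m) N j) (fun w => (#|big_cycles (k * 2 ^ m) (run w s)|%:R < th)%R%:R) <=
  (\sum_(j < m) D j + Num.max 0 (2 * th - #|big_cycles k s|%:R)) / th.
Proof.
move=> th0; elim: m k N D s => [|m IH] k N D s D0 stage.
  rewrite !big_ord0 muln1 add0r /= ler_pdivlMr //.
  have [lt_th|_] := ltP #|_|%:R th; last by rewrite mul0r le_max lexx.
  by rewrite mul1r le_max; apply/orP; right; lra.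
have sumD0 : 0 <= \sum_(j < m) D j.+1 by apply: sumr_ge0 => j _; apply: D0; rewrite ltnS.
rewrite !big_ord_recl wsum_cat ler_pdivlMr // mulrC -wsumZ.
have [small|large] := ltP #|big_cycles k s|%:R th.
  apply: le_trans (_ : th <= _).
    rewrite -[leRHS]mul1r -[X in _ <= X * _](expr1n _ (N 0%N)) -u1 -wsum_cst u1.
    apply: ler_wsum => // w; rewrite ler_piMr ?(ltW th0) //.
    rewrite -[leRHS]mulr1 -[X in _ <= X * _](expr1n _ (\sum_(i < m) N (lift ord0 i))%N) -u1 -wsum_cst u1.
    by apply: ler_wsum => // w'; rewrite lern1; case: (_ < _)%R.
  apply: le_trans (_ : Num.max 0 (2 * th - #|big_cycles k s|%:R) <= _).
    by rewrite le_max; apply/orP; right; lra.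
  by rewrite lerDr addr_ge0 // D0.
pose X w : R := Num.max 0 (#|big_cycles k s|%:R - #|big_cycles (k * 2) (run w s)|%:R).
apply: le_trans (_ : wsum u (N 0%N) (fun w => X w + (\sum_(j < m) D j.+1 +
   Num.max 0 (2 * th - #|big_cycles k s|%:R))) <= _); last first.
  rewrite wsumD wsum_cst u1 expr1n mul1r -addrA; apply: lerD => //.
  have := stage 0%N s; rewrite !muln1 expn1; exact.
apply: ler_wsum => // w.
have := IH (k * 2)%N (fun j => N j.+1) (fun j => D j.+1) (run w s).
rewrite ler_pdivlMr // mulrC -wsumZ => {}IH.
apply: le_trans (_ : \sum_(j < m) D j.+1 + Num.max 0 (2 * th - #|big_cycles (k * 2) (run w s)|%:R) <= _).
  apply: le_trans (IH _ _).
  - rewrite -wsumZ; apply: ler_wsum => // w'; rewrite run_cat expnS mulnA //.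
  - by move=> j jm; apply: D0.
  - move=> j s' jm; have := stage j.+1 s' jm; rewrite !expnS !mulnA; exact.
rewrite addrCA lerD2l /X ge_max; apply/andP; split.
  by rewrite addr_ge0 // le_max lexx.
set a := #|big_cycles k s|%:R; set b := #|big_cycles _ _|%:R.
apply: le_trans (_ : (a - b) + (2 * th - a) <= _); first lra.
by apply: lerD; rewrite le_max lexx orbT.
Qed.

Lemma expr_le_inv (x : R) N : 0 <= x <= 1 -> (1 - x) ^+ N * (1 + N%:R * x) <= 1.
Proof.
move=> /andP[x0 x1]; elim: N => [|N IH]; first by rewrite mul0r addr0 mulr1.
apply: le_trans IH; rewrite exprSr -mulrA ler_wpM2l ?exprn_ge0 ?subr_ge0 //.
rewrite -natr1; have : 0 <= (N%:R + 1) * x ^+ 2 by rewrite mulr_ge0 ?sqr_ge0 // addr_ge0.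
lra.
Qed.

(** As [8 * k <= mu * n], the merging rate is at least [p * k * mu * n / 4], so [A] counts
    relaxation times and the unmerged fraction is at most [1 / A]. The constant 40 is 32, from the
    number of steps before rounding, plus 8, from rounding it up. *)
Lemma stage_bound k (mu A : R) N s : 0 < mu -> mu <= 1 -> 1 <= A -> (0 < k)%N ->
  0 < p -> (8 * k)%:R <= mu * n ->
  A * 4 / (p * k%:R * mu * n) <= N%:R -> N%:R <= A * 4 / (p * k%:R * mu * n) + 1 ->
  mu * n <= #|big_cycles k s|%:R ->
  wsum u N (fun w => Num.max 0 (#|big_cycles k s|%:R - #|big_cycles (2 * k) (run w s)|%:R)) <=
  n / A + (1 + 2 / mu) * (40 / mu) * (A * k%:R).
Proof.
move=> mu0 mu1 A1 k0 p_gt0 k8 NA NA' Mk.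
have kR : 1 <= k%:R :> R by rewrite ler1n.
have kn : k%:R <= n :> R.
  have : 0 <= n :> R by []. 
  move: k8; rewrite natrM => k8 n_ge0.
  have : mu * n <= 1 * n by rewrite ler_wpM2r.
  lra.
have n0 : 0 < n :> R by apply: lt_le_trans kn; lra.
set rho := p * (k%:R * (mu * n / 4)).
set r := p * (k%:R * (mu * n / 2 - (2 * k)%:R)).
have pn1 : p * n ^+ 2 <= 1 by rewrite -[leRHS]qp lerDr.
have rho_r : rho <= r.
  rewrite ler_wpM2l // ler_wpM2l //; move: k8; rewrite !natrM; lra.
have rho0 : 0 < rho by rewrite /rho !(mulr_gt0, divr_gt0) //; lra.
have r1 : r <= 1.
  apply: le_trans (_ : p * (n * n) <= _); last by rewrite -expr2.
  rewrite ler_wpM2l //; apply: ler_pM => //.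
    by move: k8; rewrite !natrM; lra.
  have : mu * n <= 1 * n by rewrite ler_wpM2r // ltW.
  rewrite natrM; lra.
have NrA : A <= N%:R * rho.
  move: NA; rewrite ler_pdivrMr ?mulr_gt0 //; last lra.
  rewrite /rho; lra.
apply: le_trans (stage_loss q0 p0 qp N mu0 _ Mk r1) _.
  by move: k8; rewrite !natrM; lra.
apply: lerD.
  rewrite mulrC ler_wpM2l ?(ltW n0) //.
  apply: le_trans (_ : (1 - rho) ^+ N <= _).
    rewrite lerXn2r ?nnegrE ?subr_ge0 //; first exact: le_trans rho_r r1.
    by rewrite lerD2l lerN2.
  have := @expr_le_inv rho N; rewrite (ltW rho0) (le_trans rho_r r1) => /(_ isT) h.
  rewrite -[leRHS]mul1r ler_pdivlMr; last lra.
  apply: le_trans h; apply: ler_wpM2l; last by lra.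
  by rewrite exprn_ge0 // subr_ge0 (le_trans rho_r r1).
rewrite -[leRHS]mulrA; apply: ler_wpM2l; first by rewrite addr_ge0 // divr_ge0 // ltW.
have Np : N%:R * p <= A * 4 / (k%:R * mu * n) + p.
  rewrite (_ : A * 4 / (k%:R * mu * n) + p = (A * 4 / (p * k%:R * mu * n) + 1) * p).
    by rewrite ler_wpM2r.
  by field; rewrite !gt_eqF //; lra.
rewrite mulrA; apply: le_trans (ler_wpM2r _ Np) _; first by rewrite !mulr_ge0 ?sqr_ge0 // ltW.
rewrite natrM mulrDl.
have -> : A * 4 / (k%:R * mu * n) * (2 * n * (2 * k%:R) ^+ 2) = 32 / mu * (A * k%:R).
  by field; rewrite !gt_eqF //; lra.
have -> : 40 / mu * (A * k%:R) = 32 / mu * (A * k%:R) + 8 / mu * (A * k%:R) by ring.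
rewrite lerD2l; apply: le_trans (_ : 8 * k%:R <= _).
  rewrite (_ : p * (2 * n * (2 * k%:R) ^+ 2) = 8 * (k%:R * (p * n * k%:R))); last by ring.
  rewrite ler_pM2l // ler_piMr //; apply: le_trans pn1.
  by rewrite expr2 mulrA ler_wpM2l // mulr_ge0 // ltW.
rewrite [8 / mu]mulrC -!mulrA; rewrite mulrCA ler_pM2l //.
rewrite -[leLHS]mul1r mulrA ler_wpM2r //.
rewrite mulrC ler_pdivlMr // mul1r; lra.
Qed.

End Levels.

Section Phase2.
Context {T : finType} {R : realType}.
Variables (q p : R).
Hypotheses (q0 : 0 <= q) (p0 : 0 < p) (qp : q + p * #|T|%:R ^+ 2 = 1).
Local Notation u := (step_weight q p [set: T]).
Local Notation n := #|T|%:R.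
Implicit Types (s : {perm T}) (o : option (T * T)) (w : seq (option (T * T))).

Lemma sum_geometric_le (x : R) m : 0 <= x -> (1 - x) * \sum_(j < m) x ^+ j <= 1.
Proof. by move=> x0; rewrite -opprB mulNr -subrX1 opprB lerBlDr lerDl exprn_ge0. Qed.

Lemma sum_rev_ord m (f : nat -> R) : \sum_(j < m.+1) f (m - j)%N = \sum_(j < m.+1) f j.
Proof.
rewrite (reindex_inj rev_ord_inj) /=; apply: eq_bigr => j _.
by rewrite subSS subKn // -ltnS.
Qed.

(* The number of steps for level [j] is proportional to [B * (3 / 2) ^ min j
   (I - j)] times the relaxation time of that level: both the error terms and the
   total time are then geometric sums. *)
Lemma phase2 (mu B del : R) K I : 0 < mu -> mu <= 1 -> 1 <= B -> (0 < K)%N ->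
  (K * 2 ^ I)%:R <= del * n -> 8 * del <= mu -> (I < #|T|)%N ->
  exists2 N : nat, N%:R * (p * (2 * n)) <= 32 * B / (K%:R * mu) + 2 * (p * n ^+ 2) &
  forall s, wsum u N (fun w => (#|big_cycles (K * 2 ^ I.+1) (run w s)|%:R < mu * n)%R%:R) <=
    6 / (B * mu) + 160 * (1 + 2 / mu) * B * del / mu ^+ 2 +
    Num.max 0 (2 * (mu * n) - #|big_cycles K s|%:R) / (mu * n).
Proof.
move=> mu0 mu1 B1 K0 Kdel del8 In.
have n0 : 0 < n :> R by rewrite ltr0n; apply: leq_trans In.
have KR : 0 < K%:R :> R by rewrite ltr0n.
have B0 : 0 < B by apply: lt_le_trans B1.
(* Any ratio strictly between 1 and 2 would do: above 1 for the sum of [n / A j], below 2 for the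
   sums of [A j / k j] and [A j * k j]. *)
pose A j : R := B * (3 / 2) ^+ minn j (I - j).
pose k j := (K * 2 ^ j)%N.
have k0 j : (0 < k j)%N by rewrite muln_gt0 K0 expn_gt0.
have kR j : 0 < (k j)%:R :> R by rewrite ltr0n.
pose X j := A j * 4 / (p * (k j)%:R * mu * n).
pose N j := (Num.truncn (X j)).+1.
have A1 j : 1 <= A j.
  by rewrite mulr_ege1 // exprn_ege1 //; lra.
have A0 j : 0 < A j by apply: lt_le_trans (A1 j).
have X0 j : 0 <= X j.
  by apply: divr_ge0; rewrite !mulr_ge0 // ltW.
have XN j : X j <= (N j)%:R by rewrite ltW // truncnS_gt.
have NX j : (N j)%:R <= X j + 1 by rewrite /N -natr1 lerD2r truncn_le.
exists (\sum_(j < I.+1) N j)%N.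
  rewrite natr_sum mulr_suml.
  apply: le_trans (_ : \sum_(j < I.+1) (8 * B / (K%:R * mu) * (3 / 4) ^+ j + p * (2 * n)) <= _).
    apply: ler_sum => j _.
    apply: le_trans (_ : (X j + 1) * (p * (2 * n)) <= _).
      by rewrite ler_wpM2r // !mulr_ge0 // ltW.
    rewrite mulrDl mul1r lerD2r /X /A.
    have Aj : (3 / 2 : R) ^+ minn j (I - j) <= (3 / 2) ^+ j.
      by rewrite ler_weXn2l ?geq_minl //; lra.
    set a := _ ^+ minn _ _ in Aj *.
    rewrite (_ : B * a * 4 / (p * (k j)%:R * mu * n) * (p * (2 * n)) = 8 * B / mu * a / (k j)%:R); last first.
      by field; rewrite !gt_eqF.
    rewrite /k natrM natrX (_ : (3 / 4) ^+ j = (3 / 2) ^+ j / 2 ^+ j); last first.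
      by rewrite -expr_div_n; congr (_ ^+ _); field.
    rewrite (_ : 8 * B / (K%:R * mu) * ((3 / 2) ^+ j / 2 ^+ j) = 8 * B / mu * (3 / 2) ^+ j / (K%:R * 2 ^+ j)); last first.
      by field; rewrite !gt_eqF // exprn_gt0.
    rewrite ler_wpM2r ?invr_ge0 ?mulr_ge0 ?exprn_ge0 ?(ltW KR) //.
    by rewrite ler_wpM2l // divr_ge0 ?mulr_ge0 ?(ltW B0) ?(ltW mu0).
  rewrite big_split /= -mulr_sumr; apply: lerD.
    rewrite (_ : 32 * B / (K%:R * mu) = 8 * B / (K%:R * mu) * 4); last by field; rewrite !gt_eqF.
    rewrite ler_wpM2l ?divr_ge0 ?mulr_ge0 ?(ltW B0) ?(ltW KR) ?(ltW mu0) //.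
    by have := @sum_geometric_le (3 / 4) I.+1; lra.
  (* Rounding up costs at most one step per level, hence at most [#|T|] steps in all since
     [I < #|T|]. *)
  rewrite sumr_const card_ord -[leLHS]mulr_natl.
  rewrite (_ : 2 * (p * n ^+ 2) = n * (p * (2 * n))); last by ring.
  by rewrite ler_wpM2r ?ler_nat // !mulr_ge0 // ltW.
pose D j := n / A j + (1 + 2 / mu) * (40 / mu) * (A j * (k j)%:R).
have c0 : 0 <= (1 + 2 / mu) * (40 / mu).
  by rewrite mulr_ge0 ?addr_ge0 // divr_ge0 // ltW.
move=> s; have th0 : 0 < mu * n by rewrite mulr_gt0.
apply: le_trans (@levels T R q p q0 (ltW p0) qp (mu * n) I.+1 K N D s th0 _ _) _.
- move=> j _; apply: addr_ge0; first by rewrite divr_ge0 // ltW.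
  by rewrite mulr_ge0 // mulr_ge0 // ltW.
- move=> j s' jI Mk; rewrite expnS mulnCA.
  apply: (stage_bound q0 (ltW p0) qp mu0 mu1 (A1 j) (k0 j) p0 _ (XN j) (NX j) Mk).
  rewrite natrM; apply: le_trans (_ : 8 * (K * 2 ^ I)%:R <= _).
    by rewrite ler_pM2l // ler_nat leq_mul2l leq_exp2l // -ltnS jI orbT.
  apply: le_trans (_ : 8 * (del * n) <= _); first by rewrite ler_pM2l.
  by rewrite mulrA ler_wpM2r // ltW.
rewrite mulrDl lerD2r ler_pdivrMr // big_split /= -[X in _ + X]mulr_sumr.
have sA : \sum_(j < I.+1) n / A j <= n / B * 6.
  apply: le_trans (_ : \sum_(j < I.+1) n / B * ((2 / 3) ^+ j + (2 / 3) ^+ (I - j)) <= _).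
    apply: ler_sum => j _; rewrite /A invfM mulrA ler_wpM2l ?divr_ge0 ?(ltW n0) ?(ltW B0) //.
    rewrite -exprVn invf_div; have [_|_] := leqP j (I - j).
      by rewrite lerDl exprn_ge0 // divr_ge0.
    by rewrite lerDr exprn_ge0 // divr_ge0.
  rewrite -mulr_sumr ler_wpM2l ?divr_ge0 ?(ltW n0) ?(ltW B0) // big_split /=.
  rewrite (sum_rev_ord I (fun j => (2 / 3) ^+ j)).
  have := @sum_geometric_le (2 / 3) I.+1; lra.
have sAk : \sum_(j < I.+1) A j * (k j)%:R <= 4 * (B * (del * n)).
  apply: le_trans (_ : \sum_(j < I.+1) B * (K * 2 ^ I)%:R * (3 / 4) ^+ (I - j) <= _).
    apply: ler_sum => j _.
    have jI : (j <= I)%N by rewrite -ltnS.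
    have E : (2 : R) ^+ I = 2 ^+ (I - j) * 2 ^+ j by rewrite -exprD subnK.
    rewrite /A /k !natrM !natrX E.
    have Aj : (3 / 2 : R) ^+ minn j (I - j) <= (3 / 2) ^+ (I - j).
      by rewrite ler_weXn2l ?geq_minr //; lra.
    set a := _ ^+ minn _ _ in Aj *.
    rewrite (_ : B * (K%:R * (2 ^+ (I - j) * 2 ^+ j)) * (3 / 4) ^+ (I - j) =
       B * (3 / 2) ^+ (I - j) * (K%:R * 2 ^+ j)); last first.
      rewrite (_ : 3 / 2 = 2 * (3 / 4)); last by field.
      by rewrite (exprMn _ 2); move: ((3 / 4) ^+ _) (2 ^+ (I - j)) => y z; ring.
    rewrite ler_wpM2r ?mulr_ge0 ?exprn_ge0 ?(ltW KR) //.
    by rewrite ler_wpM2l // ltW.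
  rewrite -mulr_sumr (sum_rev_ord I (fun j => (3 / 4) ^+ j)).
  apply: le_trans (_ : B * (K * 2 ^ I)%:R * 4 <= _).
    rewrite ler_wpM2l ?mulr_ge0 ?(ltW B0) //.
    by have := @sum_geometric_le (3 / 4) I.+1; lra.
  by rewrite [leRHS]mulrC ler_wpM2r // ler_wpM2l // ltW.
apply: le_trans (lerD sA (ler_wpM2l c0 sAk)) _.
by rewrite le_eqVlt; apply/predU1P; left; field; rewrite !gt_eqF.
Qed.

End Phase2.

(** * Choice of the parameters of the two phases *)

Section GiantCycle.
Context {R : realType}.

(** For [v = c - 1] this says that [g0 = 2 / c - 1] satisfies [g0 < expR (- (c * (1 - g0)))], the
    Poisson generating function at [g0]. *)
Lemma expR_lt_ratio (v : R) : 0 < v -> 1 - v < expR (- (2 * v)) * (1 + v).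
Proof.
move=> v0.
pose f (x : R) : R := expR (- 2 * x) * (1 + x) + x.
pose df (x : R) : R := 1 - expR (- 2 * x) * (1 + 2 * x).
have fder (x : R) : is_derive x 1 f (df x).
  have d2 : is_derive x 1 (fun y : R => - 2 * y) (- 2).
    have := is_deriveZ (- 2 : R) (is_derive_id x (1 : R)).
    by rewrite /GRing.scale /= mulr1.
  have dE : is_derive x 1 (fun y : R => expR (- 2 * y)) (expR (- 2 * x) * - 2).
    exact: is_derive1_comp.
  have d1 : is_derive x 1 (fun y : R => 1 + y) 1.
    by have := is_deriveD (is_derive_cst (1 : R) x 1) (is_derive_id x (1 : R)); rewrite add0r.
  have := is_deriveD (is_deriveM dE d1) (is_derive_id x 1).
  rewrite (_ : _ + 1 = df x) //.
  by rewrite /df /GRing.scale /=; ring.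
have fcont : {within `[0, v], continuous f}%classic.
  by apply: derivable_within_continuous => x _; have [] := fder x.
have [x /andP[x0 xv] E] := MVT v0 (fun x _ => fder x) fcont.
have xp : 0 < x by move: x0; rewrite bnd_simp.
have : 0 < df x.
  rewrite /df subr_gt0 mulNr expRN mulrC ltr_pdivrMr ?expR_gt0 // mul1r.
  by rewrite expR_gt1Dx // mulf_neq0 // gt_eqF.
move=> /(mulr_gt0 v0); rewrite mulrC -[X in _ * X]subr0 -E /f mulr0 expR0 mulNr; lra.
Qed.

(** The quadratic [c / 2 + g - c * g ^+ 2 / 2] equals 1 at [g = 1] and at [g0 = 2 / c - 1], where
    its slope is [c - 1 > 0]. By [expR_lt_ratio] there is room to move slightly above [g0], which
    produces the excess, and to replace [c] by a larger [c1], which absorbs finite-size corrections.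
    One of the two [alpha] is meant for the term [2 / r]. *)
Lemma supercritical_parameters (c : R) : 1 < c -> c < 2 ->
  exists g c1 alpha : R, [/\ c < c1, 0 < alpha, 0 < g < 1, c1 * g <= 1 &
    1 + 2 * alpha <= c / 2 + g - c1 * g ^+ 2 / 2 /\ g <= expR (- (c1 * (1 - g)))].
Proof.
move=> c1 c2; pose v := c - 1; have v0 : 0 < v by rewrite subr_gt0.
pose g0 := 2 / c - 1; have cg0 : c * g0 = 2 - c by rewrite /g0; field; rewrite gt_eqF //; lra.
have g00 : 0 < g0 by rewrite subr_gt0 ltr_pdivlMr; lra.
have g01 : g0 < 1 by rewrite ltrBlDr ltr_pdivrMr; lra.
clearbody g0.
pose e0 := expR (- (c * (1 - g0))).
have e01 : e0 <= 1 by rewrite -expR0 ler_expR oppr_le0 mulr_ge0; lra.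
have gam0 : 0 < e0 - g0.
  rewrite subr_gt0 /e0 mulrBr cg0 mulr1 (_ : c - (2 - c) = 2 * v); last by rewrite /v; ring.
  have := expR_lt_ratio v0; set e := expR _ => h.
  rewrite -(ltr_pM2l (_ : 0 < c)) ?cg0; last lra.
  by move: h; rewrite /v; lra.
pose tau := Num.min ((e0 - g0) / 4) (v / 4).
have tau0 : 0 < tau by rewrite lt_min !divr_gt0.
have tau1 : tau <= (e0 - g0) / 4 by rewrite ge_min lexx.
have tau2 : tau <= v / 4 by rewrite ge_min lexx orbT.
have v1 : v < 1 by rewrite /v; lra.
pose t' := tau * v / 2.
have t'0 : 0 < t' by rewrite !divr_gt0 // mulr_gt0.
have t'v : t' <= tau / 2 by rewrite ler_wpM2r // ler_piMr // ltW.
exists (g0 + tau), (c + t'), (tau * v / 4).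
have g1 : g0 + tau < 1.
  rewrite -(ltr_pM2l (_ : 0 < c)) ?mulrDr ?cg0; last lra.
  have : c * tau <= 2 * tau by rewrite ler_wpM2r // ltW.
  move: tau2; rewrite /v; lra.
have g2 : (g0 + tau) ^+ 2 <= 1 by rewrite expr_le1 //; lra.
split.
- lra.
- by rewrite divr_gt0 // mulr_gt0.
- by apply/andP; split; lra.
- rewrite mulrDl mulrDr cg0.
  have : c * tau <= 2 * tau by rewrite ler_wpM2r // ltW.
  have : t' * (g0 + tau) <= t' * 1 by rewrite ler_pM2l // ltW.
  move: tau2; rewrite /v; lra.
split.
  have E : c / 2 + (g0 + tau) - c * (g0 + tau) ^+ 2 / 2 = 1 + tau * v - c * tau ^+ 2 / 2.
    rewrite (_ : c * (g0 + tau) ^+ 2 = c * g0 * g0 + 2 * (c * g0) * tau + c * tau ^+ 2); last by ring.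
    by rewrite cg0 /v; move: cg0; lra.
  have h1 : t' * (g0 + tau) ^+ 2 <= t' * 1 by rewrite ler_pM2l.
  have h2 : c * tau ^+ 2 <= 2 * (tau * (v / 4)).
    apply: ler_pM => //; first lra.
    - exact: sqr_ge0.
    - exact: ltW.
    - by rewrite expr2 ler_pM2l.
  have h3 : 1 + 2 * (tau * v / 4) <= 1 + tau * v - c * tau ^+ 2 / 2 - t' * (g0 + tau) ^+ 2 / 2.
    move: h1 h2; rewrite /t'; lra.
  by apply: le_trans h3 _; rewrite -E; lra.
apply: le_trans (_ : expR (- ((c + t') * (1 - g0))) <= _); last first.
  rewrite ler_expR lerN2 ler_wpM2l //; lra.
rewrite mulrDl opprD expRD -/e0.
apply: le_trans (_ : e0 * (1 - t' * (1 - g0)) <= _); last first.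
  by rewrite ler_wpM2l ?expR_ge0 // expR_ge1Dx.
have : t' * (1 - g0) * e0 <= t' * 1 * 1.
  apply: ler_pM => //; rewrite ?expR_ge0 // ?mulr_ge0 // ?ler_pM2l //; lra.
lra.
Qed.

Lemma le_expR_power (x : R) N : 0 <= x -> x < 1 ->
  expR (- (N%:R * x / (1 - x))) <= (1 - x) ^+ N.
Proof.
move=> x0 x1; have d0 : 0 < 1 - x by rewrite subr_gt0.
rewrite -mulrA -mulrN expRM_natl lerXn2r ?nnegrE ?expR_ge0 ?(ltW d0) //.
rewrite expRN -[leRHS]invrK lef_pV2 ?posrE ?expR_gt0 ?invr_gt0 //.
apply: le_trans (expR_ge1Dx _); rewrite le_eqVlt; apply/predU1P; left.
by field; rewrite gt_eqF.
Qed.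

Lemma level_exists (K X : nat) : (0 < K <= X)%N ->
  exists I, (K * 2 ^ I <= X < K * 2 ^ I.+1)%N.
Proof.
move=> /andP[K0 KX]; exists (trunc_log 2 (X %/ K)).
have X0 : (0 < X %/ K)%N by rewrite divn_gt0.
have /andP[lo hi] := trunc_log_bounds (isT : (1 < 2)%N) X0.
rewrite mulnC -leq_divRL // lo /= mulnC -ltn_divLR //.
Qed.

Definition no_long_cycle (T : finType) (L : R) (s : {perm T}) : bool :=
  [forall v, #|porbit s v|%:R < L].

(** Uniformity in the type and in the initial permutation is essential: the walk will live on a
    random red set and start wherever the other steps have led. The bound [kappa] on the probability
    that a letter is a step reflects a fine discretization. *)
Definition avoids_long_cycles (c eps del kappa : R) (n0 : nat) :=
  forall T : finType, (n0 <= #|T|)%N -> forall (q p : R) F,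
  0 < p -> q + p * #|T|%:R ^+ 2 = 1 -> p * #|T|%:R ^+ 2 <= kappa ->
  c <= F%:R * (p * (2 * #|T|%:R)) -> forall s : {perm T},
  wsum (step_weight q p [set: T]) F
    (fun w => (no_long_cycle (del * #|T|%:R) (run w s))%:R) <= eps.

Lemma giant_cycle (c eps : R) : 1 < c -> 0 < eps ->
  exists del kappa : R, exists n0 : nat,
    [/\ 0 < del, 0 < kappa & avoids_long_cycles c eps del kappa n0].
Proof.
move=> c_gt1 eps0.
(* Phase one runs at mean degree about [c0], below 2 as [supercritical_parameters] requires; the
   remaining [c - c0] is time for phase two. *)
pose m := Num.min c (3 / 2); pose c0 := (1 + m) / 2.
have m1 : 1 < m by rewrite lt_min c_gt1 /=; lra.
have mc : m <= c by rewrite ge_min lexx.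
have m2 : m <= 3 / 2 by rewrite ge_min lexx orbT.
have c0_gt1 : 1 < c0 by rewrite /c0; lra.
have c0c : c0 < c by rewrite /c0; lra.
have c0_le : c0 <= 5 / 4 by rewrite /c0; lra.
have c0_lt2 : c0 < 2 by lra.
have [g [c1 [alpha [c01 a0 /andP[g0 g1] cg [ale gexp]]]]] := supercritical_parameters c0_gt1 c0_lt2.
clearbody c0.
pose d := Num.min 1 (alpha * eps / 32).
have d0 : 0 < d by rewrite lt_min ltr01 /= divr_gt0 // mulr_gt0.
have d1 : d <= 1 by rewrite ge_min lexx.
have d2 : d <= alpha * eps / 32 by rewrite ge_min lexx orbT.
(* The [d * n / 2] points provided by phase one are then [2 * (mu * n)], so the last term of
   [phase2] vanishes. *)
clearbody d; pose mu := d / 4.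
have mu0 : 0 < mu by rewrite divr_gt0.
have mu1 : mu <= 1 by rewrite /mu; lra.
pose B := 48 / (eps * mu) + 1.
have B1 : 1 <= B by rewrite lerDr divr_ge0 // ltW // mulr_gt0.
have B0 : 0 < B by lra.
have Beps : 6 / (B * mu) <= eps / 8.
  rewrite ler_pdivrMr ?mulr_gt0 // /B.
  rewrite (_ : eps / 8 * ((48 / (eps * mu) + 1) * mu) = 6 + eps / 8 * mu); last first.
    by field; rewrite !gt_eqF.
  by rewrite lerDl mulr_ge0 ?divr_ge0 // ltW.
clearbody B.
pose K := (Num.truncn (128 * B / (mu * (c - c0)))).+1.
have cc0 : 0 < c - c0 by rewrite subr_gt0.
have KR : 0 < K%:R :> R by rewrite ltr0n.
have K0 : (0 < K)%N by [].
have Kbig : 32 * B / (K%:R * mu) <= (c - c0) / 4.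
  rewrite ler_pdivrMr ?mulr_gt0 //.
  have : 128 * B / (mu * (c - c0)) <= K%:R by rewrite ltW // truncnS_gt.
  rewrite ler_pdivrMr ?mulr_gt0 //; lra.
clearbody K.
pose C := 160 * (1 + 2 / mu) * B / mu ^+ 2.
have C0 : 0 < C by rewrite !(divr_gt0, mulr_gt0, exprn_gt0) // addr_gt0 // divr_gt0.
pose del := Num.min (mu / 8) (eps / (8 * C)).
have del0 : 0 < del by rewrite lt_min !divr_gt0 // mulr_gt0.
have del1 : del <= mu / 8 by rewrite ge_min lexx.
have del2 : C * del <= eps / 8.
  apply: le_trans (_ : C * (eps / (8 * C)) <= _); first by rewrite ler_pM2l // ge_min lexx orbT.
  by rewrite le_eqVlt; apply/predU1P; left; field; rewrite gt_eqF.
clearbody del.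
(* The bounds serve, in order, to keep [q] away from 0, to absorb the steps added by rounding, and
   to pass from [c0] to [c1] in [Fy]. *)
pose kappa := Num.min (1 / 8) (Num.min ((c - c0) / 8) ((c1 - c0) / (2 + 5 * c1))).
have c1_gt0 : 0 < c1 by move: c01 c0_gt1; clear; lra.
have c1p : 0 < 2 + 5 * c1 by move: c1_gt0; clear; lra.
have kappa0 : 0 < kappa.
  by rewrite !lt_min !divr_gt0 //= ?subr_gt0.
have kappa1 : kappa <= 1 / 8 by rewrite ge_min lexx.
have kappa2 : kappa <= (c - c0) / 8 by rewrite !ge_min lexx orbT.
have kappa3 : kappa * (2 + 5 * c1) <= c1 - c0.
  by rewrite -ler_pdivlMr // !ge_min lexx !orbT.
clearbody kappa.
(* The first term gives [K <= del * n]; each other one makes an error of phase one that depends on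
   [n] at most [eps / 24]. *)
pose Q := K%:R / del + 96 / (eps * alpha ^+ 2) + 96 * K%:R / (eps * alpha) +
   96 * K%:R ^+ 2 / (eps * d).
have Q1 : 0 < K%:R / del by rewrite divr_gt0.
have Q2 : 0 < 96 / (eps * alpha ^+ 2) by rewrite divr_gt0 // mulr_gt0 // exprn_gt0.
have Q3 : 0 < 96 * K%:R / (eps * alpha) by rewrite divr_gt0 // mulr_gt0.
have Q4 : 0 < 96 * K%:R ^+ 2 / (eps * d) by rewrite divr_gt0 // mulr_gt0 // exprn_gt0.
exists del, kappa, (Num.truncn Q).+1; split => // T nT q p F p0 qp pk cF s.
set n := #|T|%:R in qp pk cF *.
have nQ : Q < n by apply: lt_le_trans (truncnS_gt Q) _; rewrite ler_nat.
have n0 : 0 < n by apply: lt_trans nQ; rewrite /Q !addr_gt0.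
have n1 : 1 <= n by rewrite ler1n -(ltr0n R).
have T0 : (0 < #|T|)%N by rewrite -(ltr0n R).
have nK : K%:R <= del * n by rewrite mulrC -ler_pdivrMr //; move: nQ Q2 Q3 Q4; rewrite /Q; clear; lra.
have n2 : 4 / (alpha ^+ 2 * n) <= eps / 24.
  rewrite invfM mulrA ler_pdivrMr // -ler_pdivrMl ?divr_gt0 //.
  apply: le_trans (_ : 96 / (eps * alpha ^+ 2) <= _); last by move: nQ Q1 Q3 Q4; rewrite /Q; clear; lra.
  by rewrite le_eqVlt; apply/predU1P; left; field; rewrite !gt_eqF.
have n3 : 4 * (K%:R / n) / alpha <= eps / 24.
  rewrite mulrA mulrAC ler_pdivrMr // -ler_pdivrMl ?divr_gt0 //.
  apply: le_trans (_ : 96 * K%:R / (eps * alpha) <= _); last by move: nQ Q1 Q2 Q4; rewrite /Q; clear; lra.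
  by rewrite le_eqVlt; apply/predU1P; left; field; rewrite !gt_eqF.
have n4 : 4 * K%:R ^+ 2 / (d * n) <= eps / 24.
  rewrite invfM mulrA ler_pdivrMr // -ler_pdivrMl ?divr_gt0 //.
  apply: le_trans (_ : 96 * K%:R ^+ 2 / (eps * d) <= _); last by move: nQ Q1 Q2 Q3; rewrite /Q; clear; lra.
  by rewrite le_eqVlt; apply/predU1P; left; field; rewrite !gt_eqF.
clear nQ Q1 Q2 Q3 Q4; clearbody Q.
have q0 : 0 < q by move: qp pk kappa1; clear; lra.
have qk : 1 - kappa <= q by move: qp pk; clear; lra.
have u0 := step_weightT_ge0 (ltW q0) (ltW p0).
have u1 := sum_step_weightT qp.
have pn : p * n <= kappa.
  by apply: le_trans pk; rewrite expr2 ler_pM2l // ler_peMr // ltW.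
have pn0 : 0 < p * (2 * n) by rewrite !mulr_gt0.
pose F1 := (Num.truncn (c0 / (p * (2 * n)))).+1.
have F1lo : c0 <= F1%:R * (p * (2 * n)).
  by rewrite -ler_pdivrMr // ltW // truncnS_gt.
have F1hi : F1%:R * (p * (2 * n)) <= c0 + 2 * kappa.
  apply: le_trans (_ : (c0 / (p * (2 * n)) + 1) * (p * (2 * n)) <= _).
    rewrite ler_pM2r // /F1 -natr1 lerD2r truncn_le divr_ge0 ?(ltW pn0) //.
    exact/ltW/(lt_trans ltr01 c0_gt1).
  by rewrite mulrDl divfK ?gt_eqF // mul1r lerD2l mulrCA ler_pM2l.
clearbody F1.
pose y := p * (2 * n) / q.
have y0 : 0 <= y by rewrite divr_ge0 ?ltW.
have yk : y <= 4 * kappa.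
  rewrite ler_pdivrMr //; have : kappa * (1 / 2) <= kappa * q.
    by rewrite ler_pM2l //; move: qk kappa1; clear; lra.
  by move: pn; clear; lra.
have y1 : y <= 1 / 2 by move: yk kappa1; clear; lra.
have Fy : F1%:R * y <= c1 * (1 - y).
  rewrite mulrA ler_pdivrMr //; apply: le_trans F1hi _.
  apply: le_trans (_ : c1 * (1 - 4 * kappa) * (1 - kappa) <= _).
    have : 0 <= c1 * (4 * kappa * kappa) by rewrite !mulr_ge0 // ltW.
    by move: kappa3; clear; lra.
  apply: ler_pM => //.
  - by rewrite mulr_ge0 ?(ltW c1_gt0) //; move: kappa1; clear; lra.
  - by move: kappa1; clear; lra.
  - by rewrite ler_wpM2l ?(ltW c1_gt0) //; move: yk; clear; lra.
have gF : g <= (1 - y * (1 - g)) ^+ F1.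
  apply: le_trans gexp _; apply: le_trans (le_expR_power F1 _ _); last first.
  - have : y * (1 - g) <= 1 / 2 * 1.
      by apply: ler_pM => //; move: g0 g1; clear; lra.
    by clear; lra.
  - by rewrite mulr_ge0 // subr_ge0 ltW.
  rewrite ler_expR lerN2.
  have yg : y * (1 - g) <= y by rewrite ler_piMr // lerBlDr lerDl ltW.
  rewrite ler_pdivrMr; last by move: yg y1; clear; lra.
  apply: le_trans (_ : c1 * (1 - y) * (1 - g) <= _).
    by rewrite mulrA ler_wpM2r // subr_ge0 ltW.
  rewrite -mulrA [(1 - y) * _]mulrC mulrA ler_wpM2l ?lerD2l ?lerN2 //.
  by rewrite mulr_ge0 ?(ltW c1_gt0) // subr_ge0 ltW.
pose r := (Num.truncn (2 / alpha)).+1.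
have r0 : (0 < r)%N by [].
have rR : 2 / r%:R <= alpha.
  rewrite ler_pdivrMr ?ltr0n // mulrC -ler_pdivrMr //.
  by rewrite ltW // truncnS_gt.
clearbody r.
have ph1 s' : wsum (step_weight q p [set: T]) F1
   (fun w => (#|big_cycles K (run w s')|%:R <= d * n / 2)%R%:R) <= eps / 4.
  apply: le_trans (phase1 q0 (ltW p0) qp K s' y1 Fy g0 (ltW g1) cg gF r0 T0 a0 _ d0) _.
    by rewrite -/n; move: ale rR F1lo; clear; lra.
  rewrite -/n; set c' := F1%:R * _ in F1lo F1hi *.
  have c'2 : c' <= 2 by move: F1hi c0_le kappa1; clear; lra.
  have c'4 : 2 * c' <= 4 by move: c'2; clear; lra.
  have h1 : 2 * c' / (alpha ^+ 2 * n) <= 4 / (alpha ^+ 2 * n).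
    by apply: ler_wpM2r => //; rewrite invr_ge0 mulr_ge0 ?sqr_ge0 // ltW.
  have h2 : 2 * c' * (K%:R / n + d) / alpha <= 4 * (K%:R / n + d) / alpha.
    apply: ler_wpM2r; first by rewrite invr_ge0 ltW.
    by apply: ler_wpM2r => //; rewrite addr_ge0 ?divr_ge0 // ltW.
  have h3 : 2 * c' * K%:R ^+ 2 / (d * n) <= 4 * K%:R ^+ 2 / (d * n).
    apply: ler_wpM2r; first by rewrite invr_ge0 mulr_ge0 // ltW.
    by apply: ler_wpM2r => //; rewrite sqr_ge0.
  have h4 : 4 * (K%:R / n + d) / alpha <= eps / 24 + eps / 8.
    rewrite mulrDr mulrDl; apply: lerD => //.
    by rewrite ler_pdivrMr //; move: d2; clear; lra.
  by move: h1 h2 h3 h4 n2 n4; clear; lra.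
pose X := Num.truncn (del * n).
have dn0 : 0 <= del * n by rewrite mulr_ge0 // ltW.
have KX : (0 < K <= X)%N by rewrite K0 /= truncn_ge_nat.
have [I /andP[Ilo Ihi]] := level_exists KX.
have Idel : (K * 2 ^ I)%:R <= del * n by rewrite -truncn_ge_nat.
have In : (I < #|T|)%N.
  apply: leq_trans (ltn_expl I (isT : (1 < 2)%N)) _.
  rewrite -(ler_nat R); apply: le_trans (_ : (K * 2 ^ I)%:R <= _).
    by rewrite ler_nat leq_pmull.
  apply: le_trans Idel _; rewrite ler_piMl ?(ltW n0) //; move: del1 mu1; clear; lra.
have del8 : 8 * del <= mu by move: del1; clear; lra.
have [F2 F2le ph2] := phase2 (ltW q0) p0 qp mu0 mu1 B1 K0 Idel del8 In.
rewrite -/n in F2le ph2.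
have FF : (F1 + F2 <= F)%N.
  rewrite -(ler_nat R) -(ler_pM2r pn0); apply: le_trans cF.
  by rewrite natrD mulrDl; move: F1hi F2le Kbig pk kappa2 c0c; clear; lra.
(* The surplus steps come first, since both phases are uniform in the permutation they produce. *)
rewrite -(subnK FF) wsum_cat.
apply: le_trans (_ : wsum (step_weight q p [set: T]) (F - (F1 + F2)) (fun=> eps) <= _); last first.
  by rewrite wsum_cst u1 expr1n mul1r.
apply: ler_wsum => // w0; rewrite wsum_cat.
set E := 6 / (B * mu) + 160 * (1 + 2 / mu) * B * del / mu ^+ 2 in ph2.
have Eeps : E <= eps / 4.
  have : 160 * (1 + 2 / mu) * B * del / mu ^+ 2 = C * del by rewrite /C; ring.
  by rewrite /E => ->; move: Beps del2; clear; lra.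
(* When phase one fails, the last term of [phase2] is at most 2: hence the factor 2. *)
apply: le_trans (_ : wsum (step_weight q p [set: T]) F1 (fun w => eps / 4 +
   2 * (#|big_cycles K (run w (run w0 s))|%:R <= d * n / 2)%R%:R) <= _); last first.
  rewrite wsumD wsum_cst wsumZ u1 expr1n mul1r; by have := ph1 (run w0 s); move: eps0; clear; lra.
apply: ler_wsum => // w1.
apply: le_trans (_ : wsum (step_weight q p [set: T]) F2 (fun w =>
   (#|big_cycles (K * 2 ^ I.+1) (run w (run w1 (run w0 s)))|%:R < mu * n)%R%:R) <= _).
  (* [K * 2 ^ I.+1] exceeds [del * n], so without long cycles no point reaches this level. *)
  apply: ler_wsum => // w; rewrite !run_cat ler_nat.
  case: (boolP (no_long_cycle _ _)) => // /forallP short.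
  rewrite (_ : #|_| = 0%N) ?mulr_gt0 //.
  apply/eqP; rewrite cards_eq0; apply/eqP/setP => v; rewrite !inE.
  apply/negbTE; rewrite -ltnNge; apply: leq_ltn_trans Ihi.
  by rewrite /X truncn_ge_nat // ltW.
apply: le_trans (ph2 _) _; apply: lerD => //.
have mun0 : 0 < mu * n by rewrite mulr_gt0.
rewrite ler_pdivrMr // ge_max; apply/andP; split.
  by rewrite !mulr_ge0 // ltW.
set M := #|_|%:R; have M0 : 0 <= M by rewrite ler0n.
rewrite /mu; have [_|] := leP M (d * n / 2) => /=; first by move: M0; clear; lra.
by rewrite mulr0 mul0r; clear; lra.
Qed.

End GiantCycle.

(** * Red cycles *)

Section RandomSubset.
Context {R : realFieldType} {U : finType}.
Implicit Types (P Q : {set U}) (x : R) (a : U -> R).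

Lemma big_powersetU1 P c (g : {set U} -> R) : c \notin P ->
  \sum_(Q in powerset (c |: P)) g Q =
  \sum_(Q in powerset P) (g Q + g (c |: Q)).
Proof.
move=> cP; rewrite big_split /= (bigID (fun Q : {set U} => c \in Q)) /= addrC; congr (_ + _).
  apply: eq_bigl => Q; rewrite !inE; apply/andP/idP => [[QcP cQ]|QP].
    by rewrite -(setU1K cP) finset.subsetD1 QcP cQ.
  split; first exact: fintype.subset_trans QP (finset.subsetUr _ _).
  by apply: contra cP; apply/fintype.subsetP.
rewrite (reindex_onto (fun Q => c |: Q) (fun Q => Q :\ c)) /=; last first.
  by move=> Q /andP[_ cQ]; rewrite finset.setD1K.
apply: eq_bigl => Q; rewrite !inE eqxx andbT.
apply/andP/idP => [[QcP /eqP E]|QP].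
  have cQ : c \notin Q by rewrite -E !inE eqxx.
  by rewrite -(setU1K cP) -(setU1K cQ); apply: finset.setSD.
rewrite finset.setUS // setU1K //.
by apply: contra cP; apply/fintype.subsetP.
Qed.

Lemma setD_add1 c P Q : c \notin Q -> (c |: P) :\: Q = c |: (P :\: Q).
Proof.
by move=> cQ; rewrite finset.setDUl; congr (_ :|: _); apply/finset.setDidPl; rewrite finset.disjoints1.
Qed.

Lemma setD_add11 c P Q : c \notin P -> (c |: P) :\: (c |: Q) = P :\: Q.
Proof.
move=> cP; apply/setP => z; rewrite !finset.in_setD !finset.in_setU1.
by have [->|] := eqVneq z c; rewrite /= ?(negbTE cP) ?andbF.
Qed.

Lemma sum_powerset_weight x P :
  \sum_(Q in powerset P) x ^+ #|P :\: Q| = (1 + x) ^+ #|P|.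
Proof.
have [n] := ubnP #|P|; elim: n P => // n IH P; rewrite ltnS => Pn.
have [->|[c cP]] := set_0Vmem P.
  by rewrite finset.powerset0 big_set1 cards0 finset.setDv cards0.
have cNP : c \notin P :\ c by rewrite !inE eqxx.
rewrite -(finset.setD1K cP); set P' := P :\ c in cNP *.
rewrite big_powersetU1 // cardsU1 cNP add1n exprS -IH; last first.
  by apply: leq_trans Pn; rewrite [leqRHS](cardsD1 c) cP.
rewrite mulr_sumr; apply: eq_bigr => Q; rewrite inE => QP.
have cQ : c \notin Q by apply: contra cNP; apply/fintype.subsetP.
by rewrite setD_add1 // setD_add11 // cardsU1 finset.in_setD (negbTE cNP) andbF add1n exprS mulrDl mul1r addrC.
Qed.

(** Up to normalization, each element is in [Q] independently with probability [1 / (1 + x)], and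
    variances add up. In the induction the linear terms of the two choices for [c] cancel by
    centring. *)
Lemma sum_powerset_variance x P a : 0 <= x ->
  \sum_(Q in powerset P) x ^+ #|P :\: Q| *
     (\sum_(c in Q) a c - (\sum_(c in P) a c) / (1 + x)) ^+ 2 =
  (1 + x) ^+ #|P| * (x / (1 + x) ^+ 2 * \sum_(c in P) a c ^+ 2).
Proof.
move=> x0; have x1 : 1 + x != 0 by rewrite gt_eqF // ltr_wpDr.
have [n] := ubnP #|P|; elim: n P => // n IH P; rewrite ltnS => Pn.
have [->|[c cP]] := set_0Vmem P.
  by rewrite finset.powerset0 big_set1 !big_set0 mul0r subrr expr0n /= !mulr0.
have cNP : c \notin P :\ c by rewrite !inE eqxx.
set P' := P :\ c in cNP *.
have IH' : _ := IH P' _.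
rewrite -(finset.setD1K cP) big_powersetU1 // -/P'.
rewrite cardsU1 cNP add1n exprS !(big_setU1 _ cNP) /=.
set m := \sum_(i in P') a i in IH' *; set v := \sum_(i in P') a i ^+ 2 in IH' *.
transitivity (\sum_(Q in powerset P') ((1 + x) * (x ^+ #|P' :\: Q| * (\sum_(i in Q) a i - m / (1 + x)) ^+ 2) +
   x ^+ #|P' :\: Q| * (a c ^+ 2 * x / (1 + x)))); last first.
  rewrite big_split /= -mulr_sumr IH'; last first.
    by apply: leq_trans Pn; rewrite [leqRHS](cardsD1 c) cP.
  rewrite -mulr_suml sum_powerset_weight; field.
  by [].
apply: eq_bigr => Q; rewrite inE => QP.
have cQ : c \notin Q by apply: contra cNP; apply/fintype.subsetP.
rewrite setD_add1 // setD_add11 // cardsU1 finset.in_setD (negbTE cNP) andbF add1n exprS big_setU1 //=.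
by field.
Qed.

End RandomSubset.

Section Colouring.
Context {R : realFieldType} {V : finType}.
Implicit Types (s : {perm V}) (S : {set V}) (theta : R).
Local Notation n := #|V|%:R.

(* [S] is the union of the red cycles; each other cycle carries the weight
   [theta - 1], so that a cycle is red with probability [1 / theta]. *)
Definition colour_weight theta s S : R :=
  (theta - 1) ^+ #|porbits s :\: porbit s @: S| *+ saturated (porbit s) S.

Lemma imset_porbitT s : porbit s @: [set: V] = porbits s.
Proof. by apply/setP => A; apply/imsetP/imsetP => -[x _ ->]; exists x. Qed.

Lemma sum_colour_weight theta s (phi : {set V} -> R) :
  \sum_S colour_weight theta s S * phi S =
  \sum_(Q in powerset (porbits s)) (theta - 1) ^+ #|porbits s :\: Q| * phi (porbit s @^-1: Q).
Proof.
transitivity (\sum_(S in [set S | saturated (porbit s) S])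
   (theta - 1) ^+ #|porbits s :\: porbit s @: S| * phi S).
  rewrite [RHS]big_mkcond; apply: eq_bigr => S _; rewrite inE /colour_weight.
  by case: (saturated _ _); rewrite ?mul0r.
rewrite saturated_imset big_imset /=; last exact: preim_inj.
rewrite imset_porbitT; apply: eq_bigr => Q; rewrite inE => /fintype.subsetP QP.
congr (_ ^+ #|_ :\: _| * _).
apply/setP => A; apply/imsetP/idP => [[x + ->]|AQ]; first by rewrite inE.
by have /imsetP[x _ E] := QP A AQ; exists x => //; rewrite inE -E.
Qed.

Lemma sum_colours theta s : \sum_S colour_weight theta s S = theta ^+ #|porbits s|.
Proof.
transitivity (\sum_S colour_weight theta s S * (fun=> 1) S).
  by apply: eq_bigr => S _; rewrite mulr1.
rewrite sum_colour_weight.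
transitivity (\sum_(Q in powerset (porbits s)) (theta - 1) ^+ #|porbits s :\: Q|).
  by apply: eq_bigr => Q _; rewrite mulr1.
by rewrite sum_powerset_weight addrC subrK.
Qed.

Lemma sum_porbits s (f : nat -> R) :
  \sum_(C in porbits s) #|C|%:R * f #|C| = \sum_v f #|porbit s v|.
Proof.
rewrite [RHS](partition_big_imset (porbit s)) /=.
rewrite (eq_bigl (mem (porbits s))); last first.
  by move=> C; apply/imsetP/imsetP => -[x _ ->]; exists x.
apply: eq_bigr => _ /imsetP[x _ ->].
rewrite (eq_bigr (fun=> f #|porbit s x|)) => [|v /eqP -> //].
rewrite sumr_const -[RHS]mulr_natl; congr (_%:R * _).
by apply: eq_card => v; rewrite -eq_porbit_mem.
Qed.

Lemma card_preim_porbits s (Q : {set {set V}}) : Q \subset porbits s ->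
  #|porbit s @^-1: Q| = (\sum_(C in Q) #|C|)%N.
Proof.
move=> /fintype.subsetP QP; rewrite -sum1_card (partition_big (porbit s) (mem Q)) /=; last first.
  by move=> v; rewrite inE.
apply: eq_bigr => C CQ; have /imsetP[x _ E] := QP C CQ.
rewrite sum1_card; apply: eq_card => v; rewrite unfold_in inE.
rewrite [in RHS]E -eq_porbit_mem -E.
by apply/andP/idP => [[]//|/eqP E']; rewrite E' eqxx.
Qed.

(** The red points have mean number [n / theta] and variance at most the sum of the squared cycle
    lengths, which is also the sum over points of the lengths of their cycles, hence at most
    [L * n]. *)
Lemma colour_deviation theta s (L t : R) : 1 <= theta -> 0 < t ->
  (forall v, #|porbit s v|%:R <= L) ->
  \sum_(S : {set V} | #|S|%:R <= n / theta - t) colour_weight theta s S <=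
  theta ^+ #|porbits s| * (L * n / t ^+ 2).
Proof.
move=> th1 t0 shortL; have th0 : 0 < theta by lra.
have th10 : 0 <= theta - 1 by lra.
have E : 1 + (theta - 1) = theta by ring.
have L0 : 0 < n :> R -> 0 <= L.
  rewrite ltr0n => /card_gt0P[v _]; exact: le_trans (shortL v).
have var := sum_powerset_variance (porbits s) (fun C => #|C|%:R) th10.
rewrite E in var.
have sumP : \sum_(C in porbits s) #|C|%:R = n :> R.
  have := sum_porbits s (fun=> 1); under eq_bigr do rewrite mulr1.
  by move=> ->; rewrite sumr_const cardT -cardE.
rewrite sumP in var.
rewrite mulrA ler_pdivlMr ?exprn_gt0 //.
apply: le_trans (_ : \sum_S colour_weight theta s S * (#|S|%:R - n / theta) ^+ 2 <= _).
  rewrite mulr_suml big_mkcond /=; apply: ler_sum => S _.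
  have cw0 : 0 <= colour_weight theta s S by rewrite mulrn_wge0 // exprn_ge0.
  case: ifPn => [small|_]; last by rewrite mulr_ge0 // sqr_ge0.
  have dev : t <= n / theta - #|S|%:R by rewrite lerBrDr -lerBrDl.
  apply: ler_wpM2l => //; rewrite -(sqrrN (#|S|%:R - _)) opprB.
  by rewrite lerXn2r ?nnegrE ?(ltW t0) // (le_trans (ltW t0) dev).
rewrite (sum_colour_weight _ _ (fun S => (#|S|%:R - n / theta) ^+ 2)).
rewrite [leLHS](_ : _ = \sum_(Q in powerset (porbits s)) (theta - 1) ^+ #|porbits s :\: Q| *
   (\sum_(C in Q) #|C|%:R - n / theta) ^+ 2); last first.
  by apply: eq_bigr => Q; rewrite inE => QP; rewrite card_preim_porbits // natr_sum.
rewrite var ler_wpM2l ?exprn_ge0 ?(ltW th0) //.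
apply: le_trans (_ : 1 * \sum_(C in porbits s) #|C|%:R ^+ 2 <= _).
  apply: ler_wpM2r; first by apply: sumr_ge0 => C _; exact: sqr_ge0.
  rewrite ler_pdivrMr ?exprn_gt0 // mul1r.
  by have := sqr_ge0 (theta - 1); move: th1; clear; lra.
rewrite mul1r.
under eq_bigr do rewrite expr2.
rewrite (sum_porbits s (fun k => k%:R)).
apply: le_trans (_ : \sum_(v : V) L <= _); first exact: ler_sum.
by rewrite sumr_const -[leLHS]mulr_natr.
Qed.

End Colouring.

(** * The walk on the red set given the other steps *)

Section Skeleton.
Context {R : realFieldType} {V : finType}.
Variable eta : R.
Implicit Types (s t : {perm V}) (S : {set V}) (o : option (V * V)) (w : seq (option (V * V))).

Local Notation u S := (step_weight 1 eta S).

Fixpoint word_perm w : {perm V} := if w is o :: w' then (act o * word_perm w')%g else 1%g.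

Definition inside S o := if o is Some (a, b) then (a \in S) && (b \in S) else false.

Fixpoint is_skeleton S w : bool :=
  if w is o :: w' then ~~ inside S o && is_skeleton (act o @: S) w' else true.

(* In a skeleton the letter [None] marks the places where a step inside the
   current image of [S], or no step, may be inserted. *)
Definition free_steps w := count (pred1 None) w.

Definition map_step (t : {perm V}) o := omap (fun ab : V * V => (t ab.1, t ab.2)) o.

Lemma map_stepK t : cancel (map_step t) (map_step t^-1%g).
Proof. by case=> [[a b]|] //=; rewrite !permK. Qed.

Lemma act_map_step t o : act (map_step t o) = (act o ^ t)%g.
Proof. by case: o => [[a b]|] /=; rewrite ?conj1g ?tpermJ. Qed.

(** Relabelling the points by [t] conjugates the transpositions and carries steps inside [S] to
    steps inside its image, with the same weights. *)
Lemma wsum_conj S t F (f : {perm V} -> R) s :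
  wsum (u (t @: S)) F (fun w => f (t * run w s)%g) =
  wsum (u S) F (fun w => f (run w (t * s)%g)).
Proof.
elim: F s => [//|F IH] s /=.
rewrite (reindex_inj (can_inj (map_stepK t))) /=; apply: eq_bigr => o _.
have -> : u (t @: S) (map_step t o) = u S o.
  by case: o => [[a b]|] //=; rewrite !(mem_imset _ _ perm_inj).
congr (_ * _); transitivity (wsum (u (t @: S)) F (fun w => f (t * run w (act (map_step t o) * s))%g)).
  exact: eq_wsum.
rewrite IH; apply: eq_wsum => w; congr (f (run w _)).
by rewrite act_map_step conjgE !mulgA mulgV mul1g.
Qed.

Lemma wsum_rcons S F (f : {perm V} -> R) s :
  wsum (u S) F (fun w => \sum_o u S o * f (act o * run w s)%g) =
  wsum (u S) F.+1 (fun w => f (run w s)).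
Proof.
rewrite -addn1 wsum_cat; apply: eq_wsum => w /=.
by apply: eq_bigr => o _; rewrite /run foldl_cat.
Qed.

Lemma act_invol o : (act o * act o)%g = 1%g.
Proof. by case: o => [[a b]|] /=; rewrite ?tperm2 ?mulg1. Qed.

(* A step joining two points of the current image of [S] can be moved to the
   beginning of the word: conjugating it by the steps that precede it turns it
   into a step inside [S], and this is a bijection between steps of both kinds. *)
Lemma wsum_skeleton L S (f : {perm V} -> R) :
  wsum (u [set: V]) L (fun w => f (word_perm w)) =
  wsum (u [set: V]) L (fun w => (is_skeleton S w)%:R *
    wsum (u S) (free_steps w) (fun w' => f (run w' (word_perm w)))).
Proof.
elim: L S f => [|L IH] S f; first by rewrite /= mul1r.
rewrite [LHS]/= [RHS]/= [LHS](bigID (inside S)) [RHS](bigID (inside S)) /=.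
rewrite [X in _ = X + _]big1 ?add0r; last first.
  move=> o oS; rewrite (eq_wsum _ _ (g := fun=> 0)) ?wsum_cst ?mulr0 // => w.
  by rewrite oS mul0r.
(* A first letter that is [None] or inside [S] becomes one more step of the walk on [S], its last
   one, by [wsum_rcons]. *)
rewrite [X in _ + X = _](bigD1 None) // [RHS](bigD1 None) //= !mul1r addrA; congr (_ + _).
  transitivity (wsum (u [set: V]) L (fun w => \sum_o u S o * f (act o * word_perm w)%g)).
    rewrite wsum_sum [RHS](bigID (inside S)) /=; congr (_ + _).
      apply: eq_bigr => o oS; rewrite wsumZ; congr (_ * _).
      by case: o oS => [[a b]|] //= -> ; rewrite !inE.
    rewrite (bigD1 None) //= big1 ?addr0 ?mul1r; last first.
      move=> [[a b]|] //= /andP[/negbTE -> _].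
      by rewrite mulr0n wsumZ mul0r.
    by rewrite wsumZ mul1r.
  rewrite (IH S (fun s => \sum_o u S o * f (act o * s)%g)).
  apply: eq_wsum => w; rewrite wsum_rcons /= add0n mul1g.
  by rewrite (eq_imset (g := id)) ?imset_id // => x; rewrite perm1.
(* A first letter that is a step not inside [S] moves the set to [act o @: S]; conjugation brings
   the walk on that image back to [S]. *)
apply: eq_bigr => o /andP[oS oN]; congr (_ * _).
rewrite (IH (act o @: S) (fun s => f (act o * s)%g)).
apply: eq_wsum => w; rewrite oS (negbTE oN) add0n /=; congr (_ * _).
exact: wsum_conj.
Qed.

End Skeleton.

Section RestrictedWalk.
Context {R : realFieldType} {V : finType}.
Implicit Types (s t : {perm V}) (S : {set V}) (o : option (V * V)) (w : seq (option (V * V))).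

Lemma porbits_setD s S : saturated (porbit s) S ->
  porbits s :\: porbit s @: S = porbit s @: ~: S.
Proof.
move=> /saturatedP sat; apply/setP => A; rewrite finset.in_setD; apply/andP/imsetP.
  move=> [AS /imsetP[x _ E]]; exists x => //; rewrite inE.
  by apply: contra AS => xS; rewrite E imset_f.
move=> [x]; rewrite inE => xS ->; split; last exact: imset_f.
by apply: contra xS => /imsetP[y yS /sat ->].
Qed.

Lemma saturated_act s S o : inside S o || (o == None) ->
  saturated (porbit (act o * s)) S = saturated (porbit s) S.
Proof.
move=> oS; have actS x : (act o x \in S) = (x \in S).
  case: o oS => [[a b]|] /=; last by rewrite perm1.
  by rewrite orbF => /andP[aS bS]; case: tpermP => [->|->|//]; rewrite aS bS.
apply/porbit_saturatedP/porbit_saturatedP => sat x; last by rewrite permM sat actS.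
have := sat (act o x); rewrite permM -(permM (act o) (act o)) act_invol perm1 => ->.
exact: actS.
Qed.

Lemma porbit_act_out s S o v : inside S o || (o == None) ->
  saturated (porbit s) S -> v \notin S -> porbit (act o * s) v = porbit s v.
Proof.
case: o => [[a b]|] oS sat vS; last by rewrite /= mul1g.
have out s' : saturated (porbit s') S -> forall c, c \in S -> (c \in porbit s' v) = false.
  move=> /saturatedP sat' c cS; apply/negbTE; apply: contra vS.
  by rewrite -eq_porbit_mem => /eqP/sat' <-.
have /andP[aS bS] : (a \in S) && (b \in S) by move: oS; rewrite orbF.
have sat' : saturated (porbit (act (Some (a, b)) * s)) S by rewrite saturated_act.
apply/eqP; rewrite finset.eqEsubset; apply/andP; split; last first.
  by apply: sub_porbit_tperm; rewrite !(out _ sat').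
have := @sub_porbit_tperm _ (tperm a b * s)%g a b v.
by rewrite mulgA tperm2 mul1g; apply; rewrite !(out _ sat).
Qed.

(** Red cycles carry weight 1 whatever their number, and a step inside [S] leaves the other cycles
    untouched: this is why the walk on [S] is unweighted. *)
Lemma colour_weight_act (theta : R) s S o : inside S o || (o == None) ->
  colour_weight theta (act o * s) S = colour_weight theta s S.
Proof.
move=> oS; rewrite /colour_weight saturated_act //.
case: (boolP (saturated _ _)) => // sat; rewrite !porbits_setD ?saturated_act //.
rewrite (eq_in_imset (g := porbit s)) // => v; rewrite inE => vS.
exact: (porbit_act_out oS sat vS).
Qed.

Lemma colour_weight_run (theta : R) s S w : all (fun o => inside S o || (o == None)) w ->
  colour_weight theta (run w s) S = colour_weight theta s S.
Proof.
elim: w s => //= o w IH s /andP[oS wS].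
by rewrite -(colour_weight_act theta s oS); exact: IH.
Qed.

Lemma restriction s S : saturated (porbit s) S ->
  exists r : {perm {x | x \in S}}, forall x, val (r x) = s (val x).
Proof.
move=> /porbit_saturatedP sat.
have sS (x : {x | x \in S}) : s (val x) \in S by rewrite sat (valP x).
pose f (x : {x | x \in S}) : {x | x \in S} := exist _ (s (val x)) (sS x).
have finj : injective f by move=> x y /(congr1 val) /= /perm_inj /val_inj.
by exists (perm finj) => x; rewrite permE.
Qed.

Lemma card_porbit_restriction s S (r : {perm {x | x \in S}}) x :
  (forall x, val (r x) = s (val x)) -> #|porbit r x| = #|porbit s (val x)|.
Proof.
move=> rs; rewrite -(card_imset _ val_inj); apply: eq_card => y.
have rsi i z : val ((r ^+ i)%g z) = (s ^+ i)%g (val z).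
  elim: i => [|i IH]; first by rewrite !expg0 !perm1.
  by rewrite !expgSr !permM rs IH.
apply/imsetP/porbitP => [[_ /porbitP[i ->] ->]|[i ->]].
  by exists i; rewrite rsi.
by exists ((r ^+ i)%g x); rewrite ?mem_porbit ?rsi.
Qed.

Lemma wsum_restriction (eta : R) (P : nat -> bool) S s (r : {perm {x | x \in S}}) F :
  (forall x, val (r x) = s (val x)) ->
  wsum (step_weight 1 eta S) F (fun w => [forall v, (v \in S) ==> P #|porbit (run w s) v|]%:R) =
  wsum (step_weight 1 eta [set: {x | x \in S}]) F
    (fun z => [forall v, P #|porbit (run z r) v|]%:R) :> R.
Proof.
elim: F s r => [|F IH] s r rs.
  rewrite /=; congr ((nat_of_bool _)%:R); apply/forallP/forallP => [Ps x|Pr v].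
    by have := Ps (val x); rewrite (valP x) /= (card_porbit_restriction _ rs).
  apply/implyP => vS; have := Pr (exist _ v vS).
  by rewrite (card_porbit_restriction _ rs).
rewrite /= !big_option /=; congr (_ + _).
  congr (_ * _); apply: IH => x; by rewrite !mul1g rs.
pose G ab : R := wsum (step_weight 1 eta S) F (fun w =>
  [forall v, (v \in S) ==> P #|porbit (run w (act (Some ab) * s)%g) v|]%:R).
transitivity (\sum_(a in S) \sum_(b in S) eta * G (a, b)).
  rewrite pair_big /= [RHS]big_mkcond; apply: eq_bigr => -[a b] _ /=.
  by case: (_ && _); rewrite ?mulr0n ?mul0r.
transitivity (\sum_(x : {x | x \in S}) \sum_(y : {x | x \in S}) eta * G (val x, val y)).
  by rewrite big_sub; apply: eq_bigr => x _; rewrite big_sub.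
rewrite pair_big /=; apply: eq_bigr => -[a b] _; rewrite !inE /=; congr (_ * _).
by apply: IH => x; rewrite !permM rs /= (inj_tperm _ _ _ val_inj).
Qed.

Lemma wsum_scale (X : finType) (c : R) (u : X -> R) F f :
  wsum (fun x => c * u x) F f = c ^+ F * wsum u F f.
Proof.
elim: F f => [|F IH] f /=; first by rewrite mul1r.
by rewrite mulr_sumr; apply: eq_bigr => x _; rewrite IH exprS; ring.
Qed.

End RestrictedWalk.

(** * From red sets to the weighted walk *)

Section WeightedWalk.
Context {R : realType} {V : finType}.
Implicit Types (s : {perm V}) (S : {set V}) (w : seq (option (V * V))).
Local Notation n := #|V|%:R.

Lemma step_weight_scale (T : finType) (eta : R) : 0 <= eta ->
  let b := 1 + eta * #|T|%:R ^+ 2 in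
  step_weight 1 eta [set: T] =1 (fun o => b * step_weight b^-1 (eta / b) [set: T] o).
Proof.
move=> eta0 b; have b0 : b != 0 by rewrite gt_eqF // ltr_wpDr // mulr_ge0 // sqr_ge0.
by case=> [[x y]|] /=; rewrite ?inE /= ?mulr1n ?mulfV // mulrCA mulfV ?mulr1.
Qed.

Lemma step_weight_scale_sum (T : finType) (eta : R) : 0 <= eta ->
  let b := 1 + eta * #|T|%:R ^+ 2 in b^-1 + eta / b * #|T|%:R ^+ 2 = 1.
Proof.
move=> eta0 b; have b0 : b != 0 by rewrite gt_eqF // ltr_wpDr // mulr_ge0 // sqr_ge0.
by rewrite mulrAC -[X in X + _]mul1r -mulrDl mulfV.
Qed.

Lemma inner_walk c eps del kappa n0 (L eta : R) S s F :
  avoids_long_cycles c eps del kappa n0 -> (n0 <= #|S|)%N -> 0 < eta ->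
  eta * #|S|%:R ^+ 2 <= kappa ->
  c * (1 + eta * #|S|%:R ^+ 2) <= F%:R * (eta * (2 * #|S|%:R)) ->
  L <= del * #|S|%:R -> saturated (porbit s) S ->
  wsum (step_weight 1 eta S) F
    (fun w => [forall v, (v \in S) ==> (#|porbit (run w s) v|%:R < L)%R]%:R) <=
  eps * (1 + eta * #|S|%:R ^+ 2) ^+ F.
Proof.
move=> avoid n0S eta0 ek cF Ldel sat.
have [r rs] := restriction sat.
rewrite (wsum_restriction eta (fun k => (k%:R < L)%R) _ rs).
have cS : #|{: {x | x \in S}}| = #|S| by rewrite card_sig.
rewrite (eq_wsum_weight _ _ (@step_weight_scale _ eta (ltW eta0))) wsum_scale cS mulrC.
set b := 1 + _; have b1 : 1 <= b by rewrite lerDl mulr_ge0 ?sqr_ge0 // ltW.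
have b0 : 0 < b by apply: lt_le_trans b1.
apply: ler_wpM2r; first by rewrite exprn_ge0 // ltW.
have u0 o := @step_weight_ge0 {x | x \in S} R b^-1 (eta / b) [set: _] o.
apply: le_trans (avoid {x | x \in S} _ b^-1 (eta / b) F _ _ _ _ r).
- apply: ler_wsum => [x|w].
    by rewrite u0 ?divr_ge0 ?invr_ge0 ?(ltW b0) ?(ltW eta0).
  rewrite ler_nat cS; set P := [forall _, _]; have [/forallP short|//] := boolP P.
  have -> // : no_long_cycle (del * #|S|%:R) (run w r).
  by apply/forallP => v; apply: lt_le_trans (short v) Ldel.
- by rewrite cS.
- by rewrite divr_gt0.
- by have := step_weight_scale_sum {x | x \in S} (ltW eta0); rewrite cS.
- rewrite cS; apply: le_trans ek; rewrite mulrAC ler_pdivrMr // ler_peMr //.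
  by rewrite mulr_ge0 ?sqr_ge0 // ltW.
- rewrite cS -(ler_pM2r b0) [leRHS](_ : _ = F%:R * (eta * (2 * #|S|%:R)) * (b^-1 * b)).
    by rewrite mulVf ?gt_eqF // mulr1.
  by ring.
Qed.

Lemma colour_weight_ge0 (theta : R) s S : 1 <= theta -> 0 <= colour_weight theta s S.
Proof. by move=> th1; rewrite mulrn_wge0 // exprn_ge0 // subr_ge0. Qed.

Lemma colour_weight_le (theta : R) s S : 1 <= theta -> colour_weight theta s S <= theta ^+ #|V|.
Proof.
move=> th1; rewrite /colour_weight.
apply: le_trans (_ : (theta - 1) ^+ #|porbits s :\: porbit s @: S| <= _).
  by case: (saturated _ _); rewrite ?mulr1n ?mulr0n // exprn_ge0 // subr_ge0.
apply: le_trans (_ : theta ^+ #|porbits s :\: porbit s @: S| <= _).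
  by rewrite lerXn2r ?nnegrE ?subr_ge0 // ?(le_trans ler01) // lerBlDr lerDl.
rewrite ler_weXn2l //; apply: leq_trans (subset_leq_card (subsetDl _ _)) _.
exact: leq_imset_card.
Qed.

Lemma step_inside (eta : R) S w : all (fun o => step_weight 1 eta S o != 0) w ->
  all (fun o => inside S o || (o == None)) w.
Proof.
apply: sub_all => -[[a b]|] //=; case: (_ && _) => //.
by rewrite mulr0n eqxx.
Qed.

(** The colour weight is constant along the walk on [S] and factors out. It vanishes unless [S] is a
    union of cycles of [s], in which case [inner_walk] applies. *)
Lemma inner_colour c eps del kappa n0 (theta L eta : R) S s F :
  avoids_long_cycles c eps del kappa n0 -> (n0 <= #|S|)%N -> 0 < eta -> 1 <= theta ->
  eta * #|S|%:R ^+ 2 <= kappa ->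
  c * (1 + eta * #|S|%:R ^+ 2) <= F%:R * (eta * (2 * #|S|%:R)) ->
  L <= del * #|S|%:R ->
  wsum (step_weight 1 eta S) F (fun w => colour_weight theta (run w s) S * (no_long_cycle L (run w s))%:R) <=
  eps * wsum (step_weight 1 eta S) F (fun w => colour_weight theta (run w s) S).
Proof.
move=> avoid n0S eta0 th1 ek cF Ldel.
have u0 o : 0 <= step_weight 1 eta S o by rewrite step_weight_ge0 // ltW.
have colE (g : seq (option (V * V)) -> R) :
    wsum (step_weight 1 eta S) F (fun w => colour_weight theta (run w s) S * g w) =
    colour_weight theta s S * wsum (step_weight 1 eta S) F g.
  rewrite -wsumZ; apply/eqP; rewrite eq_le; apply/andP; split;
    by apply: ler_in_wsum => // w /step_inside wS _; rewrite colour_weight_run.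
have := colE (fun=> 1); under eq_wsum do rewrite mulr1.
rewrite colE => ->; rewrite wsum_cst sum_step_weight mulr1.
have [sat|/negbTE nsat] := boolP (saturated (porbit s) S); last first.
  by rewrite /colour_weight nsat mulr0n !mul0r mulr0.
rewrite mulrCA; apply: ler_wpM2l; first exact: colour_weight_ge0.
apply: le_trans (inner_walk avoid n0S eta0 ek cF Ldel sat).
apply: ler_wsum => // w; rewrite ler_nat; case: (boolP (no_long_cycle _ _)) => // /forallP short.
have -> // : [forall v, (v \in S) ==> (#|porbit (run w s) v|%:R < L)%R].
by apply/forallP => v; rewrite short implybT.
Qed.

Lemma free_steps_tail (eta z : R) F : 0 < eta -> 0 < z -> (0 < F)%N ->
  wsum (step_weight 1 eta [set: V]) F (fun w => ((free_steps w)%:R < (1 - z) * F%:R)%R%:R) <=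
  eta * n ^+ 2 / z * (1 + eta * n ^+ 2) ^+ F.
Proof.
move=> eta0 z0 F0; have u0 o : 0 <= step_weight 1 eta [set: V] o by rewrite step_weight_ge0 // ltW.
have FR : 0 < F%:R :> R by rewrite ltr0n.
have zF : 0 < z * F%:R by rewrite mulr_gt0.
apply: le_trans (_ : wsum (step_weight 1 eta [set: V]) F (fun w => (z * F%:R)^-1 * (count isSome w)%:R) <= _).
  apply: ler_in_wsum => // w _ szw; case: ltP => [few|_]; last by rewrite mulr_ge0 // invr_ge0 ltW.
  rewrite mulrC ler_pdivlMr // mul1r.
  have : (count isSome w + free_steps w)%N = F.
    by rewrite -szw -(count_predC isSome w); congr (_ + _)%N; apply: eq_count => -[].
  by move/(congr1 (fun k => k%:R : R)); rewrite natrD; move: few; clear; lra.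
rewrite wsumZ (eq_wsum_weight _ _ (@step_weight_scale _ eta (ltW eta0))) wsum_scale.
set b := 1 + _; have b1 : 1 <= b by rewrite lerDl mulr_ge0 ?sqr_ge0 // ltW.
have b0 : 0 < b by apply: lt_le_trans b1.
have bi : 0 < b^-1 by rewrite invr_gt0.
have eb : 0 <= eta / b by rewrite divr_ge0 // ltW.
rewrite (mean_count (step_weight_scale_sum V (ltW eta0))).
rewrite (_ : (z * F%:R)^-1 * (b ^+ F * (F%:R * (eta / b * n ^+ 2))) = eta / b * (n ^+ 2 / z * b ^+ F)); last first.
  by field; rewrite !gt_eqF.
rewrite (_ : eta * n ^+ 2 / z * b ^+ F = eta * (n ^+ 2 / z * b ^+ F)); last by ring.
apply: ler_wpM2r; last by rewrite ler_pdivrMr // ler_peMr // ltW.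
by rewrite mulr_ge0 ?exprn_ge0 ?divr_ge0 ?sqr_ge0 // ltW.
Qed.

(** Skeletons with at least [(1 - z) * F] free steps leave enough steps for [inner_colour]. For the
    others the colour weight is at most [theta ^+ #|V|]; one factor [(1 + eta * n ^+ 2) ^+ F] bounds
    the mass of the walk on [S], the other comes from [free_steps_tail]. *)
Lemma outer_walk c eps del kappa n0 (theta L eta z : R) S F :
  avoids_long_cycles c eps del kappa n0 -> (n0 <= #|S|)%N -> 0 < eta -> 1 <= theta ->
  0 <= eps -> 0 < z -> (0 < F)%N ->
  eta * n ^+ 2 <= kappa ->
  c * (1 + eta * #|S|%:R ^+ 2) <= (1 - z) * F%:R * (eta * (2 * #|S|%:R)) ->
  L <= del * #|S|%:R ->
  wsum (step_weight 1 eta [set: V]) F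
    (fun w => colour_weight theta (word_perm w) S * (no_long_cycle L (word_perm w))%:R) <=
  eps * wsum (step_weight 1 eta [set: V]) F (fun w => colour_weight theta (word_perm w) S) +
  theta ^+ #|V| * (eta * n ^+ 2 / z) * (1 + eta * n ^+ 2) ^+ (2 * F).
Proof.
move=> avoid n0S eta0 th1 eps0 z0 F0 ek cF Ldel.
have u0 (A : {set V}) o : 0 <= step_weight 1 eta A o by rewrite step_weight_ge0 // ltW.
have th0 : 0 <= theta by apply: le_trans th1.
have Sn : eta * #|S|%:R ^+ 2 <= eta * n ^+ 2.
  by rewrite ler_pM2l // lerXn2r ?nnegrE // ler_nat max_card.
rewrite (wsum_skeleton eta F S (fun s => colour_weight theta s S * (no_long_cycle L s)%:R)).
rewrite (wsum_skeleton eta F S (fun s => colour_weight theta s S)).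
set b := 1 + eta * n ^+ 2.
have b1 : 1 <= b by rewrite lerDl mulr_ge0 ?sqr_ge0 // ltW.
rewrite -wsumZ.
pose few w : R := ((free_steps w)%:R < (1 - z) * F%:R)%R%:R.
apply: le_trans (_ : wsum (step_weight 1 eta [set: V]) F (fun w =>
  eps * ((is_skeleton S w)%:R * wsum (step_weight 1 eta S) (free_steps w)
    (fun w' => colour_weight theta (run w' (word_perm w)) S)) +
  theta ^+ #|V| * b ^+ F * few w) <= _); last first.
  rewrite wsumD lerD2l wsumZ.
  apply: le_trans (ler_wpM2l _ (free_steps_tail eta0 z0 F0)) _.
    by rewrite mulr_ge0 ?exprn_ge0 // (le_trans _ b1).
  by rewrite -/b mul2n -addnn exprD le_eqVlt; apply/predU1P; left; ring.
apply: ler_in_wsum => // w _ szw.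
have few0 : 0 <= few w by rewrite ler0n.
have err0 : 0 <= theta ^+ #|V| * b ^+ F * few w.
  by rewrite !mulr_ge0 ?exprn_ge0 // (le_trans _ b1).
case: (is_skeleton S w); last by rewrite !mul0r mulr0 add0r.
rewrite !mul1r /few; have [lt_free|ge_free] := ltP (free_steps w)%:R ((1 - z) * F%:R).
  rewrite mulr1; apply: ler_wpDl.
    by rewrite mulr_ge0 // wsum_ge0 // => w'; exact: colour_weight_ge0.
  apply: le_trans (_ : wsum (step_weight 1 eta S) (free_steps w) (fun=> theta ^+ #|V|) <= _).
    apply: ler_wsum => // w'; apply: le_trans (colour_weight_le (run w' (word_perm w)) S th1) => /=.
    by rewrite ler_piMr ?colour_weight_ge0 // lern1; case: (no_long_cycle _ _).
  rewrite wsum_cst sum_step_weight mulrC; apply: ler_wpM2l; first exact: exprn_ge0.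
  apply: le_trans (_ : b ^+ free_steps w <= _).
    rewrite lerXn2r ?nnegrE ?addr_ge0 ?mulr_ge0 ?sqr_ge0 ?(ltW eta0) //.
    by rewrite /b lerD2l.
  by rewrite ler_weXn2l // -szw count_size.
rewrite mulr0 addr0; apply: (inner_colour _ avoid) => //.
  exact: le_trans Sn ek.
apply: le_trans cF _; apply: ler_wpM2r => //.
by rewrite !mulr_ge0 // ltW.
Qed.

End WeightedWalk.

(** The three thirds of [eps] pay for small red sets, for walks without long cycles on large ones,
    and for words with few free steps. As [eta0] may depend on [V], the last error is summed crudely
    over all subsets. *)
Lemma weighted_walk (R : realType) (lambda theta eps : R) :
  1 < theta -> theta < lambda -> 0 < eps ->
  exists2 del : R, 0 < del & exists N : nat, forall V : finType, (N <= #|V|)%N ->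
  exists2 eta0 : R, 0 < eta0 & forall (eta : R) F, 0 < eta -> eta <= eta0 -> (0 < F)%N ->
  lambda <= 2 * (eta * F%:R * #|V|%:R) -> eta * F%:R * #|V|%:R <= lambda ->
  wsum (step_weight 1 eta [set: V]) F (fun w => theta ^+ #|porbits (word_perm w)| *
     (no_long_cycle (del * #|V|%:R) (word_perm w))%:R) <=
  eps * wsum (step_weight 1 eta [set: V]) F (fun w => theta ^+ #|porbits (word_perm w)|).
Proof.
move=> th_gt1 th_lt eps_gt0.
have th_gt0 : 0 < theta by apply: lt_trans th_gt1.
have th_ge1 := ltW th_gt1.
pose rho := lambda / theta.
have rho1 : 1 < rho by rewrite ltr_pdivlMr // mul1r.
(* Then [rho * (1 - z) ^+ 2] is at least [rho - (rho - 1) / 4], that is [c + (rho - 1) / 4]: the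
   margin covers smaller red sets, steps that are not free and the factor [1 + eta * n ^+ 2]. *)
pose z := (rho - 1) / (8 * rho).
have rho0 : 0 < rho by apply: lt_trans rho1.
have z0 : 0 < z by rewrite divr_gt0 ?subr_gt0 // mulr_gt0.
have zrho : rho * z = (rho - 1) / 8 by rewrite /z; field; rewrite gt_eqF.
have z1 : z < 1 by rewrite -(ltr_pM2l rho0) zrho; move: rho1; clear; lra.
clearbody z.
pose c := (1 + rho) / 2.
have c1 : 1 < c by rewrite /c; move: rho1; clear; lra.
have eps3 : 0 < eps / 3 by rewrite divr_gt0.
have [del0 [kappa [n0 [del0_gt0 kappa_gt0 avoid]]]] := giant_cycle c1 eps3.
pose beta := (1 - z) / theta.
have beta0 : 0 < beta by rewrite divr_gt0 // subr_gt0.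
pose t := z / theta.
have t0 : 0 < t by rewrite divr_gt0.
(* The first bound gives [del * n <= del0 * #|S|] for red sets of at least [beta * n] points; the
   second makes the Chebyshev bound [del / t ^+ 2] at most [eps / 3]. *)
pose del := Num.min (del0 * beta) (eps / 3 * t ^+ 2).
have del_gt0 : 0 < del.
  by rewrite lt_min (mulr_gt0 del0_gt0 beta0) (mulr_gt0 eps3) ?exprn_gt0.
have del1 : del <= del0 * beta by rewrite ge_min lexx.
have del2 : del <= eps / 3 * t ^+ 2 by rewrite ge_min lexx orbT.
clearbody del.
exists del => //; exists (Num.truncn (n0%:R / beta)).+1 => V nV.
set n := #|V|%:R in nV *.
have nb : n0%:R / beta < n.
  by apply: lt_le_trans (truncnS_gt _) _; rewrite ler_nat.
have n_gt0 : 0 < n by apply: le_lt_trans nb; rewrite divr_ge0 // ltW.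
have lam0 : 0 < lambda by apply: lt_trans th_lt.
pose M := 2 ^+ #|V| * (theta ^+ #|V| * (n ^+ 2 / z) * expR (2 * (lambda * n))).
have M0 : 0 < M by rewrite !mulr_gt0 ?exprn_gt0 ?expR_gt0 ?invr_gt0.
pose eta0 := Num.min (kappa / n ^+ 2) (Num.min ((rho - 1) / (4 * c) / n ^+ 2) (eps / 3 / M)).
have n2 : 0 < n ^+ 2 by rewrite exprn_gt0.
have eta00 : 0 < eta0.
  have c0 : 0 < 4 * c by rewrite mulr_gt0 // (lt_trans ltr01).
  have r0 : 0 < rho - 1 by rewrite subr_gt0.
  by rewrite !lt_min (divr_gt0 kappa_gt0 n2) (divr_gt0 (divr_gt0 r0 c0) n2) (divr_gt0 eps3 M0).
exists eta0 => // eta F eta_gt0 eta_le F0 lamF Flam.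
have ek : eta * n ^+ 2 <= kappa.
  by rewrite -ler_pdivlMr //; apply: le_trans eta_le _; rewrite ge_min lexx.
have ec : c * (eta * n ^+ 2) <= (rho - 1) / 4.
  have : eta * n ^+ 2 <= (rho - 1) / (4 * c).
    by rewrite -ler_pdivlMr //; apply: le_trans eta_le _; rewrite !ge_min lexx orbT.
  have c0 : 0 < 4 * c by rewrite mulr_gt0 // (lt_trans ltr01).
  by rewrite ler_pdivlMr //; clear; lra.
have eM : eta * M <= eps / 3.
  by rewrite -ler_pdivlMr //; apply: le_trans eta_le _; rewrite !ge_min lexx !orbT.
clear eta_le; clearbody eta0.
have u0 o : 0 <= step_weight 1 eta [set: V] o by rewrite step_weight_ge0 // ltW.
set W := step_weight 1 eta [set: V] in u0 *.
pose Z := wsum W F (fun w => theta ^+ #|porbits (word_perm w)|).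
rewrite -/Z.
pose bad (w : seq (option (V * V))) : R := (no_long_cycle (del * n) (word_perm w))%:R.
have bad0 w : 0 <= bad w by rewrite ler0n.
have Z1 : 1 <= Z.
  apply: le_trans (_ : wsum W F (fun=> 1) <= _).
    rewrite wsum_cst mulr1 sum_step_weight exprn_ege1 // lerDl mulr_ge0 ?sqr_ge0 //.
    exact: ltW.
  by apply: ler_wsum => // w; rewrite exprn_ege1.
pose small (S : {set V}) := (#|S|%:R <= n / theta - t * n)%R.
have split_bad w : theta ^+ #|porbits (word_perm w)| * bad w <=
    eps / 3 * theta ^+ #|porbits (word_perm w)| +
    \sum_(S | ~~ small S) colour_weight theta (word_perm w) S * bad w.
  rewrite /bad; have [/forallP short|_] := boolP (no_long_cycle _ _); last first.
    rewrite mulr0 addr_ge0 //; first by rewrite mulr_ge0 ?exprn_ge0 ?ltW.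
    by apply: sumr_ge0 => S _; rewrite mulr0.
  rewrite mulr1 -{1}(sum_colours theta) (bigID small) /=; apply: lerD; last first.
    by apply: ler_sum => S _; rewrite mulr1.
  have tn : 0 < t * n by rewrite mulr_gt0.
  have short' v : #|porbit (word_perm w) v|%:R <= del * n by rewrite ltW.
  apply: le_trans (colour_deviation th_ge1 tn short') _.
  rewrite mulrC ler_wpM2r ?exprn_ge0 ?(ltW th_gt0) //.
  rewrite ler_pdivrMr ?exprn_gt0 // exprMn mulrA -[del * n * n]mulrA -expr2.
  by rewrite ler_wpM2r // ltW.
apply: le_trans (ler_wsum F u0 split_bad) _.
rewrite wsumD wsumZ -/Z wsum_sum.
have large S : ~~ small S -> wsum W F (fun w => colour_weight theta (word_perm w) S * bad w) <=
    eps / 3 * wsum W F (fun w => colour_weight theta (word_perm w) S) +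
    theta ^+ #|V| * (eta * n ^+ 2 / z) * (1 + eta * n ^+ 2) ^+ (2 * F).
  rewrite -ltNge => largeS.
  have bS : beta * n <= #|S|%:R.
    rewrite (_ : beta * n = n / theta - t * n) ?ltW // /beta /t; ring.
  have nbS : n0%:R <= beta * n by rewrite mulrC -ler_pdivrMr // ltW.
  have n0S : (n0 <= #|S|)%N by rewrite -(ler_nat R) (le_trans nbS).
  apply: (outer_walk avoid n0S eta_gt0 th_ge1 (ltW eps3) z0 F0 ek).
    apply: le_trans (_ : c * (1 + eta * n ^+ 2) <= _).
      rewrite ler_pM2l ?(lt_trans ltr01 c1) // lerD2l ler_pM2l //.
      by rewrite lerXn2r ?nnegrE // ler_nat max_card.
    apply: le_trans (_ : (1 - z) * (2 * (eta * F%:R * (beta * n))) <= _); last first.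
      rewrite (_ : (1 - z) * F%:R * (eta * (2 * #|S|%:R)) = (1 - z) * (2 * (eta * F%:R * #|S|%:R))); last by ring.
      rewrite ler_pM2l ?subr_gt0 // ler_pM2l // ler_pM2l // mulr_gt0 ?ltr0n //.
    apply: le_trans (_ : rho * (1 - z) ^+ 2 <= _); last first.
      rewrite (_ : (1 - z) * (2 * (eta * F%:R * (beta * n))) = (1 - z) ^+ 2 / theta * (2 * (eta * F%:R * n))); last first.
        by rewrite /beta; ring.
      rewrite (_ : rho * (1 - z) ^+ 2 = (1 - z) ^+ 2 / theta * lambda); last by rewrite /rho; ring.
      by rewrite ler_wpM2l // divr_ge0 ?sqr_ge0 // ltW.
    have : 0 <= rho * z ^+ 2 by rewrite mulr_ge0 ?sqr_ge0 // ltW.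
    by move: ec zrho; rewrite /c; clear; lra.
  apply: le_trans (_ : del0 * (beta * n) <= _); last by rewrite ler_pM2l.
  by rewrite mulrA ler_pM2r.
apply: le_trans (_ : eps / 3 * Z + (eps / 3 * Z + eps / 3) <= _); last first.
  have : eps / 3 * 1 <= eps / 3 * Z by rewrite ler_pM2l.
  clear; lra.
rewrite lerD2l.
apply: le_trans (_ : \sum_(S | ~~ small S) (eps / 3 * wsum W F (fun w => colour_weight theta (word_perm w) S) +
    theta ^+ #|V| * (eta * n ^+ 2 / z) * (1 + eta * n ^+ 2) ^+ (2 * F)) <= _).
  by apply: ler_sum => S; exact: large.
rewrite big_split /=; apply: lerD.
  rewrite -mulr_sumr ler_pM2l // -wsum_sum; apply: ler_wsum => // w.
  rewrite -[leRHS](sum_colours theta) [leRHS](bigID small) /= lerDr.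
  by apply: sumr_ge0 => S _; exact: colour_weight_ge0.
apply: le_trans eM; rewrite sumr_const -[leLHS]mulr_natl.
have Epow : (1 + eta * n ^+ 2) ^+ (2 * F) <= expR (2 * (lambda * n)).
  apply: le_trans (_ : expR (eta * n ^+ 2) ^+ (2 * F) <= _).
    rewrite lerXn2r ?nnegrE ?expR_ge0 ?expR_ge1Dx // addr_ge0 // mulr_ge0 ?sqr_ge0 //.
    exact: ltW.
  rewrite -expRM_natl ler_expR natrM -mulrA ler_pM2l //.
  rewrite (_ : F%:R * (eta * n ^+ 2) = eta * F%:R * n * n); last by ring.
  by rewrite ler_pM2r.
rewrite (_ : eta * M = 2 ^+ #|V| * (theta ^+ #|V| * (eta * n ^+ 2 / z) * expR (2 * (lambda * n)))); last first.
  by rewrite /M; ring.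
have c0' : 0 <= theta ^+ #|V| * (eta * n ^+ 2 / z).
  by rewrite mulr_ge0 ?exprn_ge0 ?divr_ge0 ?mulr_ge0 ?sqr_ge0 ?ltW.
apply: ler_pM => //.
- by rewrite mulr_ge0 // exprn_ge0 // addr_ge0 // mulr_ge0 ?sqr_ge0 // ltW.
- rewrite -natrX ler_nat; apply: leq_trans (max_card _) _.
  by rewrite -cardsT -powersetT card_powerset cardsT.
- by rewrite ler_wpM2l.
Qed.

(** * Discretization of the Poisson processes *)

Section EdgeWords.
Context {R : realFieldType} {n : nat}.
Implicit Types (w : seq (option (edge n))).

Definition edge_act (o : option (edge n)) : {perm 'I_n} := if o is Some e then transp e else 1%g.

Fixpoint edge_perm w : {perm 'I_n} := if w is o :: w' then (edge_act o * edge_perm w')%g else 1%g.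

Definition edge_weight (h : R) (o : option (edge n)) : R := if o is Some _ then h else 1.

Lemma sum_edges (g : 'I_n * 'I_n -> R) :
  \sum_(e : edge n) g (val e) = \sum_(ab : 'I_n * 'I_n | (ab.1 < ab.2)%N) g ab.
Proof.
rewrite [RHS](reindex_omap (val : edge n -> _) insub) /=; last first.
  by move=> ab lt_ab; rewrite insubT.
by apply: eq_bigl => e; rewrite (valP e) valK eqxx.
Qed.

Lemma sum_pairs_edges (g : {perm 'I_n} -> R) :
  \sum_(ab : 'I_n * 'I_n) g (tperm ab.1 ab.2) =
  n%:R * g 1%g + 2 * \sum_(e : edge n) g (transp e).
Proof.
pose H (a b : 'I_n) : R := g (tperm a b) *+ (a < b)%N.
have E : \sum_(e : edge n) g (transp e) = \sum_a \sum_b H a b.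
  rewrite (sum_edges (fun ab => g (tperm ab.1 ab.2))) big_mkcond /= pair_big /=.
  by apply: eq_bigr => ab _; rewrite /H; case: ifP.
transitivity (\sum_a \sum_b (g 1%g *+ (a == b) + (H a b + H b a))).
  rewrite pair_big /=; apply: eq_bigr => -[a b] _ /=; rewrite /H (tpermC b a).
  have [ab|ab|/val_inj ab] := ltngtP a b.
  - by rewrite (_ : (a == b) = false) ?mulr0n ?add0r ?addr0 //; apply/negbTE; rewrite neq_ltn ab.
  - by rewrite (_ : (a == b) = false) ?mulr0n ?add0r ?addr0 //; apply/negbTE; rewrite neq_ltn ab orbT.
  - by rewrite ab eqxx tperm1 !mulr0n !addr0.
rewrite (eq_bigr (fun a => g 1%g + (\sum_b H a b + \sum_b H b a))) => [|a _]; last first.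
  rewrite !big_split /=; congr (_ + _); rewrite (bigD1 a) //= eqxx big1 ?addr0 // => b ba.
  by rewrite eq_sym (negbTE ba).
rewrite !big_split /= [X in _ + (_ + X)]exchange_big /= -E sumr_const card_ord.
by rewrite !mulr_natl mulr2n.
Qed.

(* Ordered pairs, including the diagonal ones, replace edges: the diagonal pairs
   act trivially and are compensated by the factor [b]. *)
Lemma wsum_edges (h : R) L (f : {perm 'I_n} -> R) : h * n%:R < 2 ->
  let b := 1 - h * n%:R / 2 in
  wsum (edge_weight h) L (fun w => f (edge_perm w)) =
  b ^+ L * wsum (step_weight 1 (h / 2 / b) [set: 'I_n]) L (fun z => f (word_perm z)).
Proof.
move=> hn b; have b0 : b != 0 by rewrite gt_eqF // subr_gt0; lra.
elim: L f => [|L IH] f; first by rewrite mul1r.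
rewrite /=.
pose G t := wsum (edge_weight h) L (fun w => f (t * edge_perm w)%g).
transitivity (\sum_o edge_weight h o * G (edge_act o)); first by [].
pose G' t := wsum (step_weight 1 (h / 2 / b) [set: 'I_n]) L (fun z => f (t * word_perm z)%g).
transitivity (b ^+ L.+1 * \sum_o step_weight 1 (h / 2 / b) [set: 'I_n] o * G' (act o)); last by [].
have GG' t : G t = b ^+ L * G' t by exact: (IH (fun s => f (t * s)%g)).
rewrite !big_option /= !mul1r.
rewrite (eq_bigr (fun ab : 'I_n * 'I_n => h / 2 / b * G' (tperm ab.1 ab.2))) => [|[x y] _]; last first.
  by rewrite !inE mulr1n.
rewrite -!mulr_sumr sum_pairs_edges GG' (eq_bigr _ (fun e _ => GG' (transp e))) -mulr_sumr exprS.
rewrite (_ : b * b ^+ L * _ = b ^+ L * (b * G' 1%g + (h / 2 / b * b) * (n%:R * G' 1%g + 2 * \sum_i G' (transp i)))); last by ring.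
by rewrite divfK // /b; field.
Qed.

End EdgeWords.

(** The right-hand side is the probability that none of [L] equal slots contains two points of a
    Poisson process of total intensity [b]; it is bounded through [1 + x >= expR (x / (1 + x))]. *)
Lemma poisson_mass_ge (R : realType) (b : R) L : 0 <= b -> (0 < L)%N ->
  1 - b ^+ 2 / L%:R <= expR (- b) * (1 + b / L%:R) ^+ L.
Proof.
move=> b0 L0; have LR : 0 < L%:R :> R by rewrite ltr0n.
set x := b / L%:R; have x0 : 0 <= x by rewrite divr_ge0 // ltW.
have x1 : 0 < 1 + x by rewrite ltr_wpDr.
apply: le_trans (_ : expR (- (b ^+ 2 / L%:R)) <= _); first exact: expR_ge1Dx.
apply: le_trans (_ : expR (- b) * expR (L%:R * (x / (1 + x))) <= _).
  rewrite -expRD ler_expR -subr_ge0.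
  rewrite (_ : _ - _ = b ^+ 2 / L%:R * (x / (1 + x))).
    by rewrite mulr_ge0 ?divr_ge0 ?sqr_ge0 // ltW.
  rewrite /x; field.
  by rewrite gt_eqF //= gt_eqF // ltr_wpDr.
rewrite ler_pM2l ?expR_gt0 // expRM_natl lerXn2r ?nnegrE ?expR_ge0 ?(ltW x1) //.
rewrite -[x / _]opprK expRN -[leRHS]invrK lef_pV2 ?posrE ?expR_gt0 ?invr_gt0 //.
apply: le_trans (expR_ge1Dx _); rewrite le_eqVlt; apply/predU1P; left.
by field; rewrite gt_eqF.
Qed.

Local Open Scope classical_set_scope.
Local Open Scope ring_scope.

Lemma sum_tuple_wsum (R : realFieldType) (X : finType) (u : X -> R) L (f : seq X -> R) :
  \sum_(w : L.-tuple X) (\prod_(l < L) u (tnth w l)) * f w = wsum u L f.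
Proof.
elim: L f => [|L IH] f.
  rewrite (big_pred1 [tuple]) ?big_ord0 ?mul1r // => w.
  by apply/esym/eqP; rewrite [w]tuple0; apply: val_inj.
pose hd (p : X * L.-tuple X) := [tuple of p.1 :: p.2].
rewrite (reindex hd) /=; last first.
  exists (fun w => (thead w, [tuple of behead w])) => [[x w] _|w _].
    by congr (_, _); apply: val_inj.
  by rewrite /hd /= -tuple_eta.
rewrite -(pair_bigA _ (fun x w => (\prod_(l < L.+1) u (tnth (hd (x, w)) l)) * f (hd (x, w)))) /=.
apply: eq_bigr => x _; rewrite -IH mulr_sumr; apply: eq_bigr => w _.
rewrite big_ord_recl tnth0 -mulrA; congr (_ * (_ * _)).
by apply: eq_bigr => l _; rewrite tnthS.
Qed.

(** * Integrals of nonnegative functions and counting measures *)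

Section MonotoneIntegral.
Context {d : measure_display} {T : measurableType d} {R : realType}.
Variable P : probability T R.

(* No measurability is required: the integral of a nonnegative function is a
   supremum over the simple functions below it. *)
Lemma le_integral_nonneg (f g : T -> \bar R) :
  (forall x, (0 <= f x)%E) -> (forall x, (f x <= g x)%E) ->
  (\int[P]_x f x <= \int[P]_x g x)%E.
Proof.
move=> f0 fg; have g0 x : (0 <= g x)%E by apply: le_trans (fg x).
rewrite !ge0_integralTE //; apply: ereal_sup_le => _ [h hf <-].
by exists h => // x; apply: le_trans (hf x) (fg x).
Qed.

Lemma integral_steps (I : finType) (E : I -> set T) (a : I -> R) :
  (forall i, measurable (E i)) -> (forall i, 0 <= a i) ->
  (\int[P]_x (\sum_i a i * \1_(E i) x)%:E = (\sum_i a i * fine (P (E i)))%:E)%E.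
Proof.
move=> mE a0; under eq_integral do rewrite -sumEFin.
rewrite ge0_integral_sum //; first last.
- by move=> i x _; rewrite lee_fin mulr_ge0.
- move=> i; apply/measurable_EFinP; apply: measurable_funM => //.
rewrite -sumEFin; apply: eq_bigr => i _.
under eq_integral do rewrite EFinM.
rewrite ge0_integralZl //; [|exact/measurable_EFinP|by rewrite lee_fin].
by rewrite integral_indic // setIT EFinM fineK // fin_num_measure.
Qed.

End MonotoneIntegral.

Lemma counting0 (T : choiceType) (R : realType) (A : set T) :
  counting A = 0%:E :> \bar R -> A = set0.
Proof.
rewrite /counting; case: asboolP => // finA [] /eqP; rewrite pnatr_eq0 => /eqP E.
by rewrite -(fset_setK finA) (finmap.cardfs0_eq E) set_fset0.
Qed.

Lemma counting1 (T : choiceType) (R : realType) (A : set T) :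
  counting A = 1%:E :> \bar R -> exists t, A = [set t].
Proof.
rewrite /counting; case: asboolP => // finA [] /eqP; rewrite pnatr_eq1 => /finmap.cardfs1P[t E].
by exists t; rewrite -(fset_setK finA) E set_fset1.
Qed.

Section Discretization.
Context {R : realType} {n : nat}.
Variables (beta : R) (L : nat).
Hypotheses (beta0 : 0 < beta) (L0 : (0 < L)%N).
Let h : R := beta / L%:R.

(* The first slot is closed at 0, so that the slots partition [0, beta]. *)
Definition slot (l : 'I_L) : set R :=
  [set` Interval (BSide (l == 0%N :> nat) (h * l%:R)) (BRight (h * l.+1%:R))].

Let h0 : 0 < h. Proof. by rewrite divr_gt0 // ltr0n. Qed.

Lemma slotP (l : 'I_L) x : slot l x <->
  (if l == 0%N :> nat then h * l%:R <= x else h * l%:R < x) /\ x <= h * l.+1%:R.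
Proof.
rewrite /slot /=; case: (_ == _) => /=; rewrite in_itv /=.
  by split=> [/andP[]|[-> ->]].
by split=> [/andP[]|[-> ->]].
Qed.

Lemma slot_lt (l l' : 'I_L) x x' : slot l x -> slot l' x' -> (l < l')%N -> x < x'.
Proof.
move=> /slotP[_ xl] /slotP[+ _] ll'; rewrite gtn_eqF ?(leq_ltn_trans _ ll') //.
by apply: le_lt_trans; apply: le_trans xl _; rewrite ler_pM2l // ler_nat.
Qed.

Lemma slot_trivIset : trivIset setT slot.
Proof.
move=> l l' _ _ [x [xl xl']]; apply: val_inj.
have [ll'|l'l|//] := ltngtP l l'.
  by have := slot_lt xl xl' ll'; rewrite ltxx.
by have := slot_lt xl' xl l'l; rewrite ltxx.
Qed.

Lemma slot_sub (l : 'I_L) : slot l `<=` `[0, beta].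
Proof.
move=> x /slotP[lx xl]; rewrite /= in_itv /=; apply/andP; split.
  apply: le_trans (_ : h * l%:R <= _); first by rewrite mulr_ge0 // ltW.
  by move: lx; case: ifP => // _; exact: ltW.
apply: le_trans xl _; rewrite /h mulrAC ler_pdivrMr ?ltr0n // ler_pM2l // ler_nat.
exact: ltn_ord.
Qed.

Lemma slot_cover x : `[0, beta]%classic x -> exists l, slot l x.
Proof.
rewrite /= in_itv /= => /andP[x0 xb].
have ex : exists l, (x <= h * l.+1%:R)%R.
  exists L.-1; rewrite prednK // /h mulrAC -mulrA divff ?mulr1 //.
  by rewrite pnatr_eq0 -lt0n.
case: (ex_minnP ex) => l xl lmin.
have lL : (l < L)%N.
  rewrite -(prednK L0) ltnS; apply: lmin.
  by rewrite prednK // /h mulrAC -mulrA divff ?mulr1 // pnatr_eq0 -lt0n.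
exists (Ordinal lL); apply/slotP; split => //=.
case: eqP => [->|/eqP]; first by rewrite mulr0.
case: l xl lmin lL => // l _ lmin _ _; rewrite ltNge; apply/negP => /lmin.
by rewrite ltnn.
Qed.

Lemma measurable_slot (l : 'I_L) : measurable (slot l).
Proof. exact: measurable_itv. Qed.

Lemma lebesgue_slot (l : 'I_L) : fine (lebesgue_measure (slot l)) = h.
Proof.
rewrite /slot lebesgue_measure_itv /= lte_fin ltr_pM2l // ltr_nat ltnSn.
by rewrite -EFinB /= -natr1 mulrDr mulr1 addrAC subrr add0r.
Qed.

Context {d : measure_display} {Omega : measurableType d}.
Variables (P : probability Omega R) (omega : edge n -> Omega -> set R).
Hypothesis poisson : independent_poisson_processes P beta omega.
Implicit Types (w : L.-tuple (option (edge n))) (e : edge n) (l : 'I_L).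

(* [word_event w] states that every slot [l] contains exactly one point, on the
   edge [tnth w l], or none at all when this letter is [None]. *)
Definition slot_event w e l : set Omega :=
  npoints (omega e) (slot l) @^-1` [set ((tnth w l == Some e)%:R : R)%:E].

Definition word_event w : set Omega :=
  \bigcap_(e in [set: edge n]) \bigcap_(l in [set: 'I_L]) slot_event w e l.

Lemma slot_event_prob w e l :
  P (slot_event w e l) = ((if tnth w l == Some e then h else 1) * expR (- h))%:E.
Proof.
have [pois _] := poisson.
have := poisson_process_law (pois e) (measurable_slot l) (@slot_sub l) [set nat_of_bool (tnth w l == Some e)].
rewrite image_set1 => ->; rewrite lebesgue_slot /poisson_prob h0 esum_set1; last first.
  by rewrite lee_fin poisson_pmf_ge0.
rewrite /poisson_pmf h0; case: (tnth w l == Some e); congr (_%:E).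
  by rewrite /= expr1 factS fact0 muln1 invr1 mulr1.
by rewrite expr0 fact0 invr1 !mulr1.
Qed.

Lemma slot_event_sigma w e l : sigma_count (omega e) (slot l) (slot_event w e l).
Proof. by exists [set ((tnth w l == Some e)%:R : R)%:E] => //; rewrite setTI. Qed.

(** Each pair of an edge and a slot contributes [expR (- h)], and each letter that is an edge one
    more factor [h]; up to a constant the letters are thus independent. *)
Lemma word_event_prob w :
  P (word_event w) = (expR (- (beta * #|{: edge n}|%:R)) * \prod_(l < L) edge_weight h (tnth w l))%:E.
Proof.
have [pois indep] := poisson.
have mB e (l : 'I_L) := measurable_slot l.
have Pe e : P (\bigcap_(l in [set: 'I_L]) slot_event w e l) =
    (\prod_(l < L) ((if tnth w l == Some e then h else 1) * expR (- h)))%:E.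
  have := poisson_process_indep (pois e) measurable_slot (fun l => @slot_sub l) slot_trivIset
    (J := finset.setT) (A := slot_event w e).
  rewrite (_ : [set` finset.setT] = [set: 'I_L]); last by apply/seteqP; split => // l _ /=; rewrite inE.
  move=> ->; last by move=> l _; exact: slot_event_sigma.
  rewrite (eq_bigl xpredT) => [|l]; last by rewrite inE.
  rewrite -prodEFin; apply: eq_bigr => l _; exact: slot_event_prob.
have := indep finset.setT (fun e => \bigcap_(l in [set: 'I_L]) slot_event w e l).
rewrite (_ : [set` finset.setT] = [set: edge n]); last by apply/seteqP; split => // e _ /=; rewrite inE.
move=> ->; last first.
  move=> e _; apply: (@fin_bigcap_measurable _ (g_sigma_algebraType _)).
    exact: finite_finset.
  move=> l _; apply: sub_sigma_algebra; exists (slot l); first exact: measurable_slot.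
  exact: slot_event_sigma.
rewrite (eq_bigl xpredT) => [|e]; last by rewrite inE.
under eq_bigr do rewrite Pe.
rewrite prodEFin; congr (_%:E).
rewrite exchange_big /=.
transitivity (\prod_(l < L) (edge_weight h (tnth w l) * expR (- (h * #|{: edge n}|%:R)))).
  apply: eq_bigr => l _; rewrite big_split /= prodr_const; congr (_ * _); last first.
    by rewrite -expRM_natl mulrN mulrC.
  case: (tnth w l) => [e0|]; last by rewrite big1.
  rewrite (bigD1 e0) //= eqxx big1 ?mulr1 // => e /negbTE ee0.
  by case: eqP => // -[] E; rewrite E eqxx in ee0.
rewrite big_split /= prodr_const card_ord mulrC -expRM_natl; congr (expR _ * _).
by rewrite /h; field; rewrite pnatr_eq0 -lt0n.
Qed.

Lemma measurable_slot_event w e l : measurable (slot_event w e l).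
Proof.
have [pois _] := poisson.
rewrite -[slot_event w e l]setTI.
have mX := poisson_process_measurable (pois e) (measurable_slot l).
by apply: mX; [exact: measurableT|exact: emeasurable_set1].
Qed.

Lemma measurable_word_event w : measurable (word_event w).
Proof.
apply: fin_bigcap_measurable; first exact: finite_finset.
move=> e _; apply: fin_bigcap_measurable; first exact: finite_finset.
move=> l _; exact: measurable_slot_event.
Qed.

Lemma word_event_inj w w' o : word_event w o -> word_event w' o -> w = w'.
Proof.
move=> ow ow'; apply: eq_from_tnth => l.
have E e : (tnth w l == Some e) = (tnth w' l == Some e).
  have := ow e I l I; have := ow' e I l I; rewrite /slot_event /= => -> [] /eqP.
  by rewrite eqr_nat; case: (tnth w l == _); case: (tnth w' l == _).
case Ew : (tnth w l) => [e|]; first by have := E e; rewrite Ew eqxx => /esym/eqP ->.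
case Ew' : (tnth w' l) => [e|] //.
by have := E e; rewrite Ew Ew' eqxx.
Qed.

Lemma time_listing_inj (X : edge n -> set R) s s' :
  time_listing X s -> time_listing X s' -> s = s'.
Proof.
move=> [sort_s mem_s] [sort_s' mem_s'].
apply: (irr_sorted_eq _ _ sort_s sort_s').
- by move=> p p' p'' /= /lt_trans; apply.
- by move=> p /=; rewrite ltxx.
- by move=> p; apply/idP/idP => [/mem_s/mem_s'|/mem_s'/mem_s].
Qed.

Lemma pi_perm_listing (X : edge n -> set R) s : time_listing X s ->
  pi_perm X = (\prod_(p <- s) transp p.1)%g.
Proof.
move=> Xs; rewrite /pi_perm; congr (\prod_(p <- _) _)%g.
by apply: (@time_listing_inj X) => //; apply: xgetPex; exists s.
Qed.

Definition listed w (t : 'I_L -> R) (ls : seq 'I_L) : seq (edge n * R) :=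
  pmap (fun l => omap (fun e => (e, t l)) (tnth w l)) ls.

Lemma prod_listed w t ls :
  (\prod_(p <- listed w t ls) transp p.1)%g = edge_perm [seq tnth w l | l <- ls].
Proof.
elim: ls => [|l ls IH]; first by rewrite big_nil.
rewrite /listed /=; case: (tnth w l) => [e|] /=; last by rewrite mul1g.
by rewrite big_cons -IH.
Qed.

(** Slots are ordered in time and cover [[0, beta]], so reading their points in order gives the
    unique time listing. *)
Lemma pi_perm_word w o : word_event w o ->
  pi_perm (fun e => omega e o) = edge_perm w.
Proof.
move=> ow; have [pois _] := poisson.
have one l e : tnth w l = Some e -> exists t, omega e o `&` slot l = [set t].
  move=> wl; have := ow e I l I; rewrite /slot_event /= wl eqxx; exact: counting1.
have none l e : tnth w l != Some e -> omega e o `&` slot l = set0.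
  move=> /negbTE wl; have := ow e I l I; rewrite /slot_event /= wl; exact: counting0.
pose t l : R := if tnth w l is Some e then xget 0 (omega e o `&` slot l) else 0.
have tP l e : tnth w l = Some e -> omega e o `&` slot l = [set t l].
  move=> wl; have [x E] := one l e wl.
  rewrite /t wl E; congr [set _]; have : [set x] (xget 0 [set x]) by apply: xgetPex; exists x.
  by move=> ->.
have mem_listed ls p : (p \in listed w t ls) <->
    exists2 l, l \in ls & tnth w l = Some p.1 /\ p.2 = t l.
  rewrite /listed mem_pmap; split.
    move=> /mapP[l lls]; case wl : (tnth w l) => [e|] //= [->].
    by exists l.
  move=> [l lls [wl pl]]; apply/mapP; exists l => //.
  by rewrite wl /= -pl; case: (p).
have in_slot l e : tnth w l = Some e -> omega e o (t l) /\ slot l (t l).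
  move=> wl; have : [set t l] (t l) by [].
  by rewrite -(tP l _ wl).
have listing : time_listing (fun e => omega e o) (listed w t (enum 'I_L)).
  split.
    have : sorted (fun l l' : 'I_L => (l < l')%N) (enum 'I_L).
      by have := iota_ltn_sorted 0 L; rewrite -val_enum_ord sorted_map.
    rewrite !sorted_pairwise; last 2 first.
    - by move=> p p' p'' /= /lt_trans; apply.
    - by move=> l l' l'' /= /ltn_trans; apply.
    elim: (enum 'I_L) => [//|l ls IH] /= /andP[/allP lls /IH {}IH].
    rewrite {1}/listed /=; case wl : (tnth w l) => [e|] //=.
    apply/andP; split => //; apply/allP => p /mem_listed[l' l'ls [wl' ->]] /=.
    exact: slot_lt (in_slot _ _ wl).2 (in_slot _ _ wl').2 (lls l' l'ls).
  move=> p; rewrite mem_listed; split.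
    by move=> [l _ [wl ->]]; have [] := in_slot _ _ wl.
  move=> pX; have [l pl] := slot_cover (poisson_process_sub (pois p.1) pX).
  have pl' : (omega p.1 o `&` slot l) p.2 by [].
  exists l; first by rewrite mem_enum.
  have [wl|wl] := eqVneq (tnth w l) (Some p.1).
    by split => //; move: pl'; rewrite (tP l _ wl).
  by move: pl'; rewrite none.
rewrite (pi_perm_listing listing) prod_listed; congr edge_perm.
exact: map_tnth_enum.
Qed.

End Discretization.

Lemma largest_cycle_short (R : realType) n (L : R) (s : {perm 'I_n}) :
  ~~ (L <= (largest_cycle s)%:R)%R -> no_long_cycle L s.
Proof.
rewrite -ltNge => short; apply/forallP => v; apply: le_lt_trans short.
rewrite ler_nat /largest_cycle.
by rewrite (bigD1 (porbit s v)) ?imset_f //= leq_maxl.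
Qed.

Section FinitePartition.
Context {d : measure_display} {Omega : measurableType d} {R : realType} {W : finType}.
Variables (P : probability Omega R) (A : W -> set Omega).
Hypothesis mA : forall w, measurable (A w).
Hypothesis A_inj : forall w w' o, A w o -> A w' o -> w = w'.

Definition completed (i : option W) : set Omega :=
  if i is Some w then A w else \bigcap_(w in [set: W]) ~` A w.

Lemma measurable_completed i : measurable (completed i).
Proof.
case: i => [w|] /=; first exact: mA.
apply: fin_bigcap_measurable; first exact: finite_finset.
by move=> w _; apply: measurableC.
Qed.

Lemma completed_cover o : exists i, completed i o.
Proof.
have [[w Aw]|noA] := pselect (exists w, A w o); first by exists (Some w).
by exists None => w _ Aw; apply: noA; exists w.
Qed.

Lemma completed_inj i j o : completed i o -> completed j o -> i = j.
Proof.
case: i j => [w|] [w'|] //=; first by move=> /A_inj h /h ->.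
  by move=> Aw /(_ w I).
by move=> /(_ w' I) nA Aw.
Qed.

Lemma sum_completed (a : option W -> R) i o : completed i o ->
  \sum_j a j * \1_(completed j) o = a i.
Proof.
move=> io; rewrite (bigD1 i) //= big1 ?addr0 => [|j ji].
  by rewrite indicE mem_set // mulr1.
rewrite indicE memNset ?mulr0 // => jo.
by rewrite (completed_inj jo io) eqxx in ji.
Qed.

Lemma mass_completed :
  fine (P (completed None)) = 1 - \sum_w fine (P (A w)).
Proof.
have := integral_steps P (a := fun=> 1) measurable_completed (fun=> ler01).
have -> : (fun o => (\sum_i 1 * \1_(completed i) o)%:E) = cst 1%:E :> (Omega -> \bar R).
  by apply/funext => o; have [i io] := completed_cover o; rewrite (sum_completed (fun=> 1) io).
rewrite integral_cst // mul1e [X in X = _](_ : _ = 1%E); last exact: probability_setT.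
case; rewrite big_option mul1r => ->.
by under [X in _ + X - _]eq_bigr do rewrite mul1r; rewrite addrK.
Qed.

(** The comparison is required only where [a w] is nonzero, so words whose event may miss [B] can be
    given coefficient 0. *)
Lemma integral_lower_bound (f : Omega -> R) (a : W -> R) (B : set Omega) :
  (forall w, 0 <= a w) -> (forall o, 0 <= f o) ->
  (forall w o, A w o -> a w != 0 -> B o /\ a w <= f o) ->
  ((\sum_w a w * fine (P (A w)))%:E <= \int[P]_(o in B) (f o)%:E)%E.
Proof.
move=> a0 f0 af; pose a' i := if i is Some w then a w else 0.
have a'0 i : 0 <= a' i by case: i => /=.
have := integral_steps P measurable_completed a'0.
rewrite big_option mul0r add0r => <-; rewrite [leRHS]integral_mkcond.
apply: le_integral_nonneg => o; have [i io] := completed_cover o.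
  by rewrite (sum_completed _ io) lee_fin.
rewrite (sum_completed _ io) patchE.
have [oB|oB] := boolP (o \in B).
  rewrite lee_fin; case: i io => [w Aw|_] /=; last exact: f0.
  by have [->|/(af _ _ Aw)[]] := eqVneq (a w) 0; [exact: f0|].
case: i io => [w Aw|_] //=; have [->//|/(af _ _ Aw)[Bo _]] := eqVneq (a w) 0.
by rewrite mem_set in oB.
Qed.

Lemma integral_upper_bound (f : Omega -> R) (a : W -> R) (c : R) :
  (forall w, 0 <= a w) -> 0 <= c -> (forall o, 0 <= f o) -> (forall o, f o <= c) ->
  (forall w o, A w o -> f o <= a w) ->
  (\int[P]_o (f o)%:E <= (\sum_w a w * fine (P (A w)) + c * (1 - \sum_w fine (P (A w))))%:E)%E.
Proof.
move=> a0 c0 f0 fc fa; pose a' i := if i is Some w then a w else c.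
have a'0 i : 0 <= a' i by case: i => /=.
have := integral_steps P measurable_completed a'0.
rewrite big_option mass_completed addrC => <-.
apply: le_integral_nonneg => o; first by rewrite lee_fin.
have [i io] := completed_cover o; rewrite (sum_completed _ io) lee_fin.
by case: i io => [w /fa|_] /=.
Qed.

End FinitePartition.

(** * Transfer to the Poisson processes and conclusion *)

Section WordSums.
Context {R : realType} {n : nat} {d : measure_display} {Omega : measurableType d}.
Context {P : probability Omega R} {omega : edge n -> Omega -> set R} {beta : R} {L : nat}.
Hypotheses (beta0 : 0 < beta) (L0 : (0 < L)%N).
Hypothesis poisson : independent_poisson_processes P beta omega.
Local Notation b := (beta * #|{: edge n}|%:R).

Lemma sum_word_event (f : {perm 'I_n} -> R) :
  \sum_(w : L.-tuple (option (edge n))) f (edge_perm w) * fine (P (word_event beta omega w)) =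
  expR (- b) * wsum (edge_weight (beta / L%:R)) L (fun w => f (edge_perm w)).
Proof.
rewrite -sum_tuple_wsum mulr_sumr; apply: eq_bigr => w _.
by rewrite (word_event_prob beta0 L0 poisson) /= mulrC mulrA.
Qed.

Lemma word_event_mass :
  1 - b ^+ 2 / L%:R <= \sum_(w : L.-tuple (option (edge n))) fine (P (word_event beta omega w)).
Proof.
have -> : \sum_(w : L.-tuple (option (edge n))) fine (P (word_event beta omega w)) =
          expR (- b) * (1 + b / L%:R) ^+ L.
  have <- := eq_bigr _ (fun w _ => mul1r (fine (P (word_event beta omega w)))).
  rewrite (sum_word_event (fun=> 1)).
  rewrite wsum_cst mulr1 big_option /= sumr_const -[beta / _ *+ _]mulr_natr.
  by congr (_ * (1 + _) ^+ _); rewrite mulrAC.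
by apply: poisson_mass_ge => //; rewrite mulr_ge0 // ltW.
Qed.

End WordSums.

(** For [L >= lambda] the compensating factor [bb] lies in [[1 / 2, 1]], so [eta] lies between
    [h / 2] and [h]. As [h * L * n = lambda], this is the two-sided condition of [weighted_walk]. *)
Lemma edge_walk (R : realType) (lambda theta eps : R) :
  1 < theta -> theta < lambda -> 0 < eps ->
  exists2 del : R, 0 < del & exists N : nat, forall n, (N <= n)%N -> (0 < n)%N ->
  exists L0 : nat, forall L, (L0 <= L)%N ->
  wsum (edge_weight (lambda / n%:R / L%:R)) L (fun w : seq (option (edge n)) =>
    theta ^+ #|porbits (edge_perm w)| * (no_long_cycle (del * n%:R) (edge_perm w))%:R) <=
  eps * wsum (edge_weight (lambda / n%:R / L%:R)) L (fun w : seq (option (edge n)) =>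
    theta ^+ #|porbits (edge_perm w)|).
Proof.
move=> th1 th_lam eps0; have lam0 : 0 < lambda by lra.
have [del del0 [N HN]] := weighted_walk th1 th_lam eps0.
exists del => //; exists N => n Nn n_gt0; have nR : 0 < n%:R :> R by rewrite ltr0n.
have := HN 'I_n; rewrite card_ord => /(_ Nn) [eta0 eta0_gt0 walk].
pose x := lambda + lambda / (n%:R * eta0).
have x0 : 0 <= lambda / (n%:R * eta0) by rewrite divr_ge0 ?mulr_ge0 // ltW.
exists (Num.truncn x).+1 => L xL.
have {xL} xL : x < L%:R by rewrite (lt_le_trans (truncnS_gt x)) // ler_nat.
have LR : 0 < L%:R :> R by rewrite (lt_trans _ xL) // ltr_wpDr.
set h := lambda / n%:R / L%:R.
have h0 : 0 < h by rewrite !divr_gt0.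
have hnE : h * n%:R = lambda / L%:R by rewrite /h; field; rewrite !gt_eqF.
have hn1 : h * n%:R <= 1 by rewrite hnE ler_pdivrMr // mul1r /x in xL *; lra.
have hLn : h * L%:R * n%:R = lambda by rewrite /h; field; rewrite !gt_eqF.
have h_eta0 : h <= eta0.
  rewrite /h ler_pdivrMr // ler_pdivrMr // (_ : _ * n%:R = eta0 * n%:R * L%:R); last by ring.
  rewrite mulrC -ler_pdivrMr ?mulr_gt0 // [eta0 * _]mulrC (le_trans _ (ltW xL)) // /x.
  by rewrite lerDr ltW.
have hn0 : 0 < h * n%:R by rewrite mulr_gt0.
have hn2 : h * n%:R < 2 by lra.
rewrite (wsum_edges L (fun s : {perm 'I_n} => theta ^+ #|porbits s| *
  (no_long_cycle (del * n%:R) s)%:R) hn2) (wsum_edges L (fun s => theta ^+ #|porbits s|) hn2).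
set bb := 1 - _; have bb0 : 1 / 2 <= bb by rewrite /bb; lra.
have bb_gt0 : 0 < bb by lra.
rewrite mulrCA ler_pM2l ?exprn_gt0 //.
set eta := h / 2 / bb.
have eta_ge : h / 2 <= eta.
  by rewrite /eta ler_pdivlMr // ler_piMr ?divr_ge0 ?(ltW h0) // /bb; lra.
have eta_le : eta <= h by rewrite /eta ler_pdivrMr //; nra.
have eta_gt0 : 0 < eta by lra.
apply: walk => //.
- exact: le_trans h_eta0.
- by rewrite -(ltr0n R).
- rewrite -[leLHS]hLn (_ : _ * (eta * _ * _) = 2 * eta * L%:R * n%:R); last by ring.
  by rewrite !ler_pM2r //; lra.
- by rewrite -[leRHS]hLn !ler_pM2r.
Qed.

Theorem theorem1p1 (R : realType) (lambda theta : R)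
    (htheta : 1 < theta) (hlambda : theta < lambda)
    (eps : R) (heps : 0 < eps) :
  exists2 delta : R, 0 < delta &
  exists n0 : nat, forall n : nat, (n0 <= n)%N ->
  forall (d : measure_display) (Omega : measurableType d)
    (P1 : probability Omega R) (omega : edge n -> Omega -> set R),
    independent_poisson_processes P1 (lambda / n%:R) omega ->
    ((1 - eps)%:E <=
      P_theta P1 omega theta
        [set o | (largest_cycle (pi_perm (fun e => omega e o)))%:R >=
                 delta * n%:R]%R)%E.
Proof.
have eps2 : 0 < eps / 2 by rewrite divr_gt0.
have [del del0 [N HN]] := edge_walk htheta hlambda eps2.
exists del => //; exists N.+1 => n Nn d Omega P omega pois.
have n_gt0 : (0 < n)%N by apply: leq_trans Nn.
have [L0 HL] := HN n (ltnW Nn) n_gt0; move: HN => _.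
have th0 : 0 < theta by lra.
have thn0 : 0 < theta ^+ n by rewrite exprn_gt0.
set beta := lambda / n%:R in pois.
have beta0 : 0 < beta by rewrite divr_gt0 ?ltr0n //; lra.
pose b2 := (beta * #|{: edge n}|%:R) ^+ 2; have b2_ge0 : 0 <= b2 by rewrite sqr_ge0.
(* The term [2 * b2] gives [Zd >= 1 / 2]; the other makes outcomes fixed by no word contribute at
   most [eps / 4] to the partition function. *)
pose x := 4 * theta ^+ n * b2 / eps + 2 * b2.
have x0 : 0 <= 4 * theta ^+ n * b2 / eps.
  by apply: divr_ge0; [apply: mulr_ge0 => //; rewrite mulr_ge0 // ltW|exact: ltW].
pose L := maxn L0 (Num.truncn x).+1.
have L_gt0 : (0 < L)%N by rewrite leq_max orbT.
have LR : 0 < L%:R :> R by rewrite ltr0n.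
have xL : x <= L%:R.
  by rewrite (le_trans (ltW (truncnS_gt x))) // ler_nat leq_maxr.
have small1 : b2 / L%:R <= 1 / 2.
  by rewrite ler_pdivrMr //; move: xL x0; rewrite /x; clear; lra.
have small2 : theta ^+ n * (b2 / L%:R) <= eps / 4.
  rewrite mulrA ler_pdivrMr // -ler_pdivrMl ?divr_gt0 //.
  rewrite (_ : (eps / 4)^-1 * _ = 4 * theta ^+ n * b2 / eps); last by field; rewrite gt_eqF.
  by move: xL b2_ge0; rewrite /x; clear; lra.
pose A (w : L.-tuple (option (edge n))) := word_event beta omega w.
pose p w := fine (P (A w)).
pose wt (w : L.-tuple (option (edge n))) := theta ^+ #|porbits (edge_perm w)|.
pose bad (w : L.-tuple (option (edge n))) := no_long_cycle (del * n%:R) (edge_perm w).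
have mA w : measurable (A w) by exact: measurable_word_event pois w.
have A_inj w w' o : A w o -> A w' o -> w = w' by exact: word_event_inj.
have p0 w : 0 <= p w by rewrite fine_ge0.
have wt1 w : 1 <= wt w by rewrite exprn_ege1 // ltW.
have wt0 w : 0 <= wt w by rewrite (le_trans ler01).
pose Zd := \sum_w wt w * p w.
have walk : \sum_w wt w * (bad w)%:R * p w <= eps / 2 * Zd.
  rewrite /Zd /wt (sum_word_event beta0 L_gt0 pois (fun s => theta ^+ #|porbits s|)).
  rewrite (sum_word_event beta0 L_gt0 pois
    (fun s => theta ^+ #|porbits s| * (no_long_cycle (del * n%:R) s)%:R)).
  by rewrite mulrCA ler_pM2l ?expR_gt0 // HL // leq_maxl.
have mass : 1 - b2 / L%:R <= \sum_w p w by exact: word_event_mass.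
have ZdE : \sum_w p w <= Zd by apply: ler_sum => w _; rewrite ler_peMl.
pose f := weight (R := R) omega theta.
have f1 o : 1 <= f o by rewrite exprn_ege1 // ltW.
have f0 o : 0 <= f o by rewrite (le_trans ler01).
have fn o : f o <= theta ^+ n.
  rewrite /f /weight ler_weXn2l ?(ltW htheta) // /num_cycles.
  by rewrite (leq_trans (leq_imset_card _ _)) // card_ord.
have fA w o : A w o -> f o = wt w.
  by move=> Aw; rewrite /f /weight (pi_perm_word beta0 L_gt0 pois Aw).
set Z := partition_fun P omega theta.
(* [partition_fun] is the real value of an extended integral, whose finiteness follows from the
   bounds 1 and [theta ^+ n] on the weight. *)
have intf : (\int[P]_o (f o)%:E)%E = Z%:E /\ 1 <= Z.
  have up : (\int[P]_o (f o)%:E <= (theta ^+ n)%:E)%E.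
    apply: le_trans (_ : \int[P]_o (cst (theta ^+ n)%:E o) <= _)%E.
      by apply: le_integral_nonneg => o; rewrite lee_fin.
    by rewrite integral_cst // [X in (_ * X)%E](_ : _ = 1%E) ?mule1 //; exact: probability_setT.
  have lo : (1%:E <= \int[P]_o (f o)%:E)%E.
    apply: le_trans (_ : _ <= \int[P]_o (cst 1%:E o))%E _.
      by rewrite integral_cst // [X in (_ * X)%E](_ : _ = 1%E) ?mule1 //; exact: probability_setT.
    by apply: le_integral_nonneg => o; rewrite lee_fin.
  have fin : (\int[P]_o (f o)%:E)%E \is a fin_num.
    by rewrite ge0_fin_numE ?(le_lt_trans up) ?ltry // (le_trans _ lo).
  have E : (\int[P]_o (f o)%:E)%E = Z%:E by rewrite -(fineK fin).
  by split=> //; rewrite -lee_fin -E.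
have [ZE Z1] := intf; have Z0 : 0 < Z by lra.
have Zup : Z <= Zd + theta ^+ n * (1 - \sum_w p w).
  rewrite -lee_fin -ZE; apply: integral_upper_bound => // [|w o /fA ->//].
  exact: ltW.
have [eps1|eps1] := leP 1 eps.
  apply: le_trans (_ : 0%:E <= _)%E; first by rewrite lee_fin subr_le0.
  by apply: integral_ge0 => o _; rewrite lee_fin divr_ge0 // ltW.
pose a w := wt w * (~~ bad w)%:R / Z.
apply: le_trans (_ : (\sum_w a w * p w)%:E <= _)%E; last first.
  apply: integral_lower_bound => // [w|o|w o Aw aw].
  - by rewrite divr_ge0 ?mulr_ge0 // ltW.
  - by rewrite divr_ge0 // ltW.
  split.
    rewrite /= (pi_perm_word beta0 L_gt0 pois Aw); apply/negPn/negP => /largest_cycle_short short.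
    by rewrite /a /bad short mulr0 mul0r eqxx in aw.
  rewrite ler_pM2r ?invr_gt0 // [weight _ _ _](fA _ _ Aw) ler_piMr //.
  by case: (bad w).
rewrite lee_fin.
have -> : \sum_w a w * p w = (Zd - \sum_w wt w * (bad w)%:R * p w) / Z.
  rewrite /Zd -sumrB mulr_suml; apply: eq_bigr => w _; rewrite /a.
  by case: (bad w); rewrite ?mulr0 ?mulr1 ?mul0r ?subrr ?subr0 ?mul0r // mulrAC.
rewrite ler_pdivlMr //.
have Zle : Z <= Zd + eps / 4.
  apply: le_trans Zup _; rewrite lerD2l; apply: le_trans small2.
  by rewrite ler_pM2l //; move: mass; clear; lra.
have Zd2 : 1 / 2 <= Zd by move: mass ZdE small1; clear; lra.
(* What remains is [(1 - eps) * (eps / 4) <= eps / 2 * Zd], which follows from [Zd >= 1 / 2]. *)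
apply: le_trans (_ : (1 - eps) * (Zd + eps / 4) <= _).
  by rewrite ler_pM2l // subr_gt0.
move: walk Zd2 heps eps1; set X := \sum_w _; clear; nra.
Qed.
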